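(* Let $n\ge1$, let $a,b\in\partial\mathbb{B}^n$, let $e_1=(1,0,\dots,0)$, and for $\zeta\in\{a,b\}$ let $\Phi_\zeta\in\operatorname{Aut}(\overline{\mathbb{B}^n})$ map $e_1$ to $\zeta$. Every nonconstant geodesic-preserving map $f\in GP(\mathfrak{G}^{\mathbb{B}^n}_a,\mathfrak{G}^{\mathbb{B}^n}_b)$ is of the form $$f=\Phi_b\circ C_{e_1}^{-1}\circ F\circ C_{e_1}\circ\Phi_a^{-1},$$ where $F=(F_1,\tilde F)$ is given on the Siegel domain $\mathcal{S}_n$ by $$F_1(z_1,z')=m z_1+\beta(z'),\qquad \tilde F=\tilde F(z'),\qquad (z_1,z')\in\mathbb{C}\times\mathbb{C}^{n-1},$$ with a constant $m>0$, a holomorphic function $\beta:\mathbb{C}^{n-1}\to\mathbb{C}$ and a holomorphic map $\tilde F:\mathbb{C}^{n-1}\to\mathbb{C}^{n-1}$ satisfying $$|\tilde F(z')|^2\le m|z'|^2+\operatorname{Im}(\beta(z'))\qquad\text{for all }z'\in\mathbb{C}^{n-1}.$$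
   Context: $\mathbb{B}^n$ is the open Euclidean unit ball of $\mathbb{C}^n$; $\operatorname{Aut}(\overline{\mathbb{B}^n})$ denotes the automorphisms of $\mathbb{B}^n$, extended to the closed ball. A geodesic in a domain $\Omega$ is a curve that is length-minimizing for the Kobayashi metric $k_\Omega$ between any two of its points; a geodesic line is a geodesic defined on all of $\mathbb{R}$ whose limits at $\pm\infty$ lie on $\partial\Omega$. Geodesics are identified with their images. For $a\in\overline{\Omega}$, $\mathfrak{G}^{\Omega}_a$ is the family of all images $\gamma$ of geodesic lines in $\Omega$ with $a\in\overline{\gamma}$. Given families $\mathfrak{F}_1,\mathfrak{F}_2$ of geodesics in $\Omega_1,\Omega_2$, a holomorphic map $f:\Omega_1\to\Omega_2$ is geodesic-preserving, written $f\in GP(\mathfrak{F}_1,\mathfrak{F}_2)$, if for every $\gamma_1\in\mathfrak{F}_1$ there is $\gamma_2\in\mathfrak{F}_2$ with $f(\gamma_1)\subset\gamma_2$. The Siegel domain is $\mathcal{S}_n=\{(z_1,z')\in\mathbb{C}\times\mathbb{C}^{n-1}:\operatorname{Im}(z_1)>|z'|^2\}$. The Cayley transform around $e_1$ is the biholomorphism $C_{e_1}:\mathbb{B}^n\to\mathcal{S}_n$, $$C_{e_1}(z_1,z')=\left(i\frac{1+z_1}{1-z_1},\ i\frac{z'}{1-z_1}\right).$$ For $n=1$, $\mathbb{C}^{0}$ is a point and the $z'$-components are absent. *)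

(* Defs.v *)
From HB Require Import structures.
From mathcomp Require Import all_boot all_order all_algebra.
From mathcomp Require Import complex.
From mathcomp Require Import all_classical all_reals all_analysis.

Set Implicit Arguments.
Unset Strict Implicit.
Unset Printing Implicit Defensive.

Import Order.TTheory GRing.Theory Num.Theory.
Import numFieldNormedType.Exports.

Local Open Scope ring_scope.
Local Open Scope classical_set_scope.

(* The cast is what lets the normed-module structure that MathComp-Analysis
   attaches to an abstract numClosedFieldType be found on R[i]. *)
Notation Cplx R := (R[i] : numClosedFieldType) (only parsing).

Section SeveralComplexVariables.
Context {R : realType}.
Local Notation C := (Cplx R).

(* The library norm on 'rV[C]_n is the max norm; it induces the same topology
   and the same differentiable functions as this one. *)
Definition enorm n (z : 'rV[C]_n) : R :=
  Num.sqrt (\sum_i Normc.normc (z 0 i) ^+ 2).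

Definition unit_disc : set C := [set z | Normc.normc z < 1].

Definition unit_ball n : set 'rV[C]_n := [set z | enorm z < 1].

Definition boundary (T : topologicalType) (A : set T) : set T :=
  closure A `\` interior A.

(* Complex Frechet differentiability at each point; meaningful for open A. *)
Definition holomorphic_on (V W : normedModType C) (A : set V) (f : V -> W) :=
  forall z, A z -> differentiable f z.

Definition biholomorphic n (A B : set 'rV[C]_n) (f : 'rV[C]_n -> 'rV[C]_n) :=
  [/\ set_bij A B f, holomorphic_on A f
    & holomorphic_on B ('pinv_(fun=> 0) A f)].

(* Automorphisms of the unit ball, extended to the closed ball. *)
Definition closed_ball_automorphism n (Phi : 'rV[C]_n -> 'rV[C]_n) :=
  [/\ biholomorphic (@unit_ball n) (@unit_ball n) Phi,
      set_bij (closure (@unit_ball n)) (closure (@unit_ball n)) Phi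
    & {within closure (@unit_ball n), continuous Phi}].

(* Hyperbolic distance of the unit disc, artanh of the pseudo-hyperbolic one. *)
Definition poincare (z w : C) : R :=
  let r := Normc.normc ((z - w) / (1 - w^* * z)) in
  2^-1 * ln ((1 + r) / (1 - r)).

Definition holomorphic_disc n (Om : set 'rV[C]_n) (phi : C -> 'rV[C]_n) :=
  holomorphic_on unit_disc phi /\ phi @` unit_disc `<=` Om.

(* [disc_chain Om z w l]: z is joined to w by finitely many holomorphic discs
   in Om, of total hyperbolic length l. *)
Inductive disc_chain n (Om : set 'rV[C]_n) :
    'rV[C]_n -> 'rV[C]_n -> R -> Prop :=
| disc_chain_nil z : disc_chain Om z z 0
| disc_chain_cons phi x y w l :
    holomorphic_disc Om phi -> unit_disc x -> unit_disc y ->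
    disc_chain Om (phi y) w l ->
    disc_chain Om (phi x) w (poincare x y + l).

Definition kobayashi n (Om : set 'rV[C]_n) (z w : 'rV[C]_n) : \bar R :=
  ereal_inf [set l%:E | l in disc_chain Om z w].

(* Length of g on [s, t] for the Kobayashi distance: x ranges over the
   partitions s < x_1 < ... < x_N = t, and the zip lists the pairs of
   consecutive points. *)
Definition kobayashi_length n (Om : set 'rV[C]_n) (g : R -> 'rV[C]_n)
    (s t : R) : \bar R :=
  ereal_sup [set (\sum_(p <- zip (s :: x) x)
                    kobayashi Om (g p.1) (g p.2))%E
            | x in itv_partition s t].

Definition curve_in n (Om : set 'rV[C]_n) (I : interval R)
    (g : R -> 'rV[C]_n) :=
  {within [set` I], continuous g} /\ g @` [set` I] `<=` Om.

Definition geodesic n (Om : set 'rV[C]_n) (I : interval R)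
    (g : R -> 'rV[C]_n) :=
  curve_in Om I g /\
  forall s t, s \in I -> t \in I -> s <= t ->
  forall (u v : R) (h : R -> 'rV[C]_n), u <= v -> curve_in Om `[u, v]%R h ->
    h u = g s -> h v = g t ->
    (kobayashi_length Om g s t <= kobayashi_length Om h u v)%E.

Definition geodesic_line n (Om : set 'rV[C]_n) (g : R -> 'rV[C]_n) :=
  [/\ geodesic Om `]-oo, +oo[%R g,
      exists2 p, boundary Om p & g t @[t --> -oo] --> p
    & exists2 q, boundary Om q & g t @[t --> +oo] --> q].

Definition geodesic_lines_at n (Om : set 'rV[C]_n) (a : 'rV[C]_n) :
    set (set 'rV[C]_n) :=
  [set G | (exists2 g, geodesic_line Om g & G = range g) /\ closure G a].

Definition geodesic_preserving n (Om1 Om2 : set 'rV[C]_n)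
    (F1 F2 : set (set 'rV[C]_n)) (f : 'rV[C]_n -> 'rV[C]_n) :=
  [/\ holomorphic_on Om1 f, f @` Om1 `<=` Om2
    & forall G1, F1 G1 -> exists2 G2, F2 G2 & f @` G1 `<=` G2].

Definition e1 n : 'rV[C]_n.+1 := delta_mx 0 0.

(* C^(1+n) = C * C^n: z = vcons (vhead z) (vtail z). *)
Definition vhead n (z : 'rV[C]_n.+1) : C := z 0 0.
Definition vtail n (z : 'rV[C]_n.+1) : 'rV[C]_n := rsubmx (z : 'rV[C]_(1 + n)).
Definition vcons n (c : C) (w : 'rV[C]_n) : 'rV[C]_n.+1 :=
  row_mx (c%:M : 'rV[C]_1) w.

Definition siegel n : set 'rV[C]_n.+1 :=
  [set z | enorm (vtail z) ^+ 2 < complex.Im (vhead z)].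

Definition cayley n (z : 'rV[C]_n.+1) : 'rV[C]_n.+1 :=
  vcons ('i * ((1 + vhead z) / (1 - vhead z)))
        (('i / (1 - vhead z)) *: vtail z).

(* cayley maps the unit ball bijectively onto the Siegel domain. *)
Definition cayley_inv n : 'rV[C]_n.+1 -> 'rV[C]_n.+1 :=
  'pinv_(fun=> 0) (@unit_ball n.+1) (@cayley n).

End SeveralComplexVariables.

Arguments unit_ball {R} n.
Arguments e1 {R} n.
Arguments siegel {R} n.

(* Main.v *)
Require Import Defs.
From HB Require Import structures.
From mathcomp Require Import all_boot all_order all_algebra.
From mathcomp Require Import complex.
From mathcomp Require Import all_classical all_reals all_analysis.
From mathcomp Require Import ring lra.
Set Implicit Arguments.
Unset Strict Implicit.
Unset Printing Implicit Defensive.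
Import Order.TTheory GRing.Theory Num.Theory.
Import numFieldNormedType.Exports.
Local Open Scope ring_scope.
Local Open Scope classical_set_scope.

(** Conjugating f by Phi_a, Phi_b and the Cayley transform gives a holomorphic
    self-map T of the Siegel domain. The proof has two halves: T preserves the
    vertical half-lines Re Z_1 = const, Z' = const, and this forces its form.

    For the second half, fix Z' = w. On vertical lines the tail of T and the real
    part of its head are constant. A holomorphic function of Z_1 that is constant on
    vertical lines is constant, and one whose real part is constant on them is
    affine with a real slope (half_plane_affine). The slope is real and holomorphic
    in w, so it is a constant m (siegel_affine). As T stays in the domain, m >= 0,
    and m = 0 would make T constant by Liouville's theorem (siegel_affine_pos).

    For the first half one has to know the geodesic lines of the ball that end at
    e1. The Kobayashi distance d of the ball is computed in kobayashi_ball: any two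
    points lie on a complex slice, which is a disc with a holomorphic left inverse,
    so the Schwarz-Pick lemma shows that the slice realises the distance. The
    result is cosh^2 d = |1 - <x, y>|^2 / ((1 - |x|^2) (1 - |y|^2)), and in Siegel
    coordinates the numerator becomes the polarised defining function (sform). With
    this formula vertical lines are geodesics. Conversely, distances add up
    along a geodesic; letting one of three points tend to e1 compares the distance
    of the other two with the ratio of their heights, and the formula then forces
    them to lie on one vertical line (busemann_rigid). Automorphisms of the closed
    ball carry this description over to the boundary points a and b
    (aut_vertical, geodesic_line_siegel).

    The Schwarz-Pick lemma is needed for functions that are merely differentiable
    at every point, and is proved from Goursat's lemma. Goursat's lemma for
    w |-> f (exp w) / exp w on rectangles shows that the circular means of f(z) / z
    do not depend on the radius, whence |f'(0)| <= 1 for f fixing 0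
    (cderiv_Cauchy_le). Moebius maps turn this into the infinitesimal Schwarz-Pick
    inequality, which is integrated along segments (schwarz). *)

(** * Complex numbers *)

Notation cnorm := Normc.normc.
Section Complex.
Context {R : realType}.
Local Notation C := (Cplx R).
Implicit Types (z w : C) (x y : R).

Lemma normCE z : `|z| = ((cnorm z)%:C%C : C). Proof. by []. Qed.

Lemma cnorm_ge0 z : 0 <= cnorm z.
Proof. by case: z => a b; exact: sqrtr_ge0. Qed.

Lemma cnormD z w : cnorm (z + w) <= cnorm z + cnorm w.
Proof. exact: (@le_normcD R z w). Qed.

Lemma cnormN z : cnorm (- z) = cnorm z.
Proof. exact: (@normcN R z). Qed.

Lemma cnormB z w : cnorm (z - w) = cnorm (w - z).
Proof. by rewrite -cnormN opprB. Qed.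

Lemma cnormM z w : cnorm (z * w) = cnorm z * cnorm w.
Proof. exact: Normc.normcM. Qed.

Lemma cnormV z : cnorm z^-1 = (cnorm z)^-1.
Proof. exact: Normc.normcV. Qed.

Lemma cnorm0 : cnorm (0 : C) = 0. Proof. exact: Normc.normc0. Qed.
Lemma cnorm1 : cnorm (1 : C) = 1. Proof. exact: Normc.normc1. Qed.

Lemma cnorm_eq0 z : (cnorm z == 0) = (z == 0).
Proof.
by apply/eqP/eqP => [/Normc.eq0_normc //|->]; exact: cnorm0.
Qed.

Lemma cnorm_gt0 z : (0 < cnorm z) = (z != 0).
Proof. by rewrite lt_def cnorm_eq0 cnorm_ge0 andbT. Qed.

Lemma sqr_cnorm z : cnorm z ^+ 2 = complex.Re z ^+ 2 + complex.Im z ^+ 2.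
Proof. by case: z => a b /=; rewrite sqr_sqrtr // addr_ge0 ?sqr_ge0. Qed.

Lemma cnorm_conj z : cnorm z^* = cnorm z.
Proof. by case: z => a b /=; rewrite sqrrN. Qed.

Lemma mulc_conj z : z * z^* = ((cnorm z ^+ 2)%:C%C : C).
Proof. by rewrite rmorphXn /= -normCE normCK. Qed.

Lemma Re_le_cnorm z : `|complex.Re z| <= cnorm z.
Proof. by rewrite -lecR; exact: normc_ge_Re. Qed.

Lemma Im_le_cnorm z : `|complex.Im z| <= cnorm z.
Proof.
by rewrite -(ler_pXn2r (n := 2)) ?nnegrE ?cnorm_ge0 // sqr_cnorm real_normK
  ?num_real // lerDr sqr_ge0.
Qed.

Lemma cnorm_real x : cnorm (x%:C%C : C) = `|x|.
Proof. by rewrite /= expr0n addr0 sqrtr_sqr. Qed.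

Lemma cnormB_le z w : cnorm z - cnorm w <= cnorm (z - w).
Proof. by rewrite lerBlDr -{1}(subrK w z) cnormD. Qed.

Lemma cReD z w : complex.Re (z + w) = complex.Re z + complex.Re w.
Proof. by case: z; case: w. Qed.
Lemma cImD z w : complex.Im (z + w) = complex.Im z + complex.Im w.
Proof. by case: z; case: w. Qed.
Lemma cReN z : complex.Re (- z) = - complex.Re z. Proof. by case: z. Qed.
Lemma cImN z : complex.Im (- z) = - complex.Im z. Proof. by case: z. Qed.
Lemma cReM z w :
  complex.Re (z * w) = complex.Re z * complex.Re w - complex.Im z * complex.Im w.
Proof. by case: z; case: w. Qed.
Lemma cImM z w :
  complex.Im (z * w) = complex.Re z * complex.Im w + complex.Im z * complex.Re w.
Proof. by case: z => a b; case: w => c d /=. Qed.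
Lemma complexP z w : complex.Re z = complex.Re w -> complex.Im z = complex.Im w -> z = w.
Proof. by case: z => a b; case: w => c d /= -> ->. Qed.

(** * Complex derivatives with real bounds *)

(** The norm on R[i] takes its values in R[i]; with the real modulus instead, all
    estimates stay inside R. *)
Definition cderiv (f : C -> C) z (d : C) :=
  forall e : R, 0 < e -> exists2 r : R, 0 < r &
    forall h : C, cnorm h < r -> cnorm (f (z + h) - f z - d * h) <= e * cnorm h.

Lemma nbhs_cnorm (z : C) (P : C -> Prop) :
  nbhs z P <-> exists2 r : R, 0 < r & forall w, cnorm (w - z) < r -> P w.
Proof.
split.
  move=> /nbhs_normP[[e e'] /=]; rewrite ltcE /= => /andP[/eqP e'0 e0] H.
  rewrite e'0 in H.
  exists e => // w wz; apply: H => /=.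
  by rewrite distrC normCE ltcR.
move=> [r r0 H]; apply/nbhs_normP; exists (r%:C%C : C); first by rewrite /= ltcR.
by move=> w /=; rewrite distrC normCE ltcR => /H.
Qed.

Lemma derivable_cderiv (f : C -> C) z :
  derivable f z 1 -> cderiv f z ('D_1 f z).
Proof.
move=> df e e0.
have : (fun h => h^-1 *: ((f \o shift z) h%:A - f z)) @ 0^' --> 'D_1 f z by exact: df.
move/cvgrPdist_le => /(_ (e%:C%C : C)); rewrite ltcR => /(_ e0).
rewrite near_withinE => /nbhs_cnorm[r r0 H]; exists r => // h hr.
have [->|h0] := eqVneq h 0.
  by rewrite addr0 subrr mulr0 subr0 cnorm0 mulr0.
have := H h; rewrite subr0 => /(_ hr h0).
rewrite normCE lecR /= [h%:A]mulr1 => Hh.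
rewrite -ler_pdivrMr ?cnorm_gt0 // -cnormV -cnormM -cnormN.
rewrite (_ : - _ = 'D_1 f z - h^-1 *: (f (h + z) - f z)) // /GRing.scale /=.
rewrite (addrC z h); field; exact: h0.
Qed.

Lemma differentiable_cderiv (f : C -> C) z :
  differentiable f z -> exists d, cderiv f z d.
Proof. by move=> /derivable1_diffP/derivable_cderiv; eexists; eassumption. Qed.

Lemma cderiv_comp (f g : C -> C) z d e :
  cderiv f z d -> cderiv g (f z) e -> cderiv (g \o f) z (e * d).
Proof.
move=> fd ge k k0.
have De : 0 < cnorm e + 1 by rewrite ltr_wpDl ?cnorm_ge0.
have Dd : 0 < cnorm d + 1 by rewrite ltr_wpDl ?cnorm_ge0.
pose k1 := Num.min 1 (k / 2 / (cnorm e + 1)).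
pose k2 := k / 2 / (cnorm d + 1).
have k10 : 0 < k1 by rewrite lt_min ltr01 /= !divr_gt0.
have k20 : 0 < k2 by rewrite !divr_gt0.
have [r r0 Hf] := fd _ k10.
have [s s0 Hg] := ge _ k20.
exists (Num.min r (s / (cnorm d + 1))); first by rewrite lt_min r0 /= divr_gt0.
move=> h; rewrite lt_min => /andP[hr hs].
have Ff := Hf _ hr.
set u := f (z + h) - f z - d * h in Ff.
pose q := f (z + h) - f z.
have qE : q = d * h + u by rewrite /u /q; ring.
have k11 : k1 <= 1 by rewrite ge_min lexx.
have qn : cnorm q <= (cnorm d + 1) * cnorm h.
  rewrite qE (le_trans (cnormD _ _)) // cnormM mulrDl mul1r lerD2l.
  by rewrite (le_trans Ff) // ler_piMl ?cnorm_ge0.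
have qs : cnorm q < s.
  by rewrite (le_lt_trans qn) // mulrC -ltr_pdivlMr.
have := Hg _ qs; rewrite /q (addrC (f z)) subrK => Gg.
rewrite /= (_ : _ - _ - _ = (g (f (z + h)) - g (f z) - e * (f (z + h) - f z)) + e * u);
  last by rewrite /u; ring.
rewrite (le_trans (cnormD _ _)) // (_ : k = k / 2 + k / 2); last by field.
rewrite mulrDl lerD //.
  rewrite (le_trans Gg) // (le_trans (ler_wpM2l (ltW k20) qn)) //.
  by rewrite mulrA /k2 divfK // gt_eqF.
rewrite cnormM (le_trans (ler_wpM2l (cnorm_ge0 _) Ff)) // mulrA ler_wpM2r ?cnorm_ge0 //.
have : k1 <= k / 2 / (cnorm e + 1) by rewrite ge_min lexx orbT.
rewrite ler_pdivlMr // => h1; rewrite (le_trans _ h1) // mulrC ler_wpM2l ?(ltW k10) //.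
by rewrite lerDl.
Qed.

Lemma cderiv_continuous (f : C -> C) z d : cderiv f z d ->
  forall e : R, 0 < e -> exists2 r : R, 0 < r &
    forall h : C, cnorm h < r -> cnorm (f (z + h) - f z) <= e.
Proof.
move=> fd e e0; have [r r0 H] := fd _ ltr01.
have D0 : 0 < cnorm d + 1 by rewrite ltr_wpDl ?cnorm_ge0.
exists (Num.min r (e / (cnorm d + 1))); first by rewrite lt_min r0 divr_gt0.
move=> h; rewrite lt_min => /andP[hr he].
rewrite -(subrK (d * h) (f (z + h) - f z)) (le_trans (cnormD _ _)) //.
have := H _ hr; rewrite mul1r ltr_pdivlMr // in he * => Hh.
rewrite (le_trans (lerD Hh (lexx _))) // cnormM.
by rewrite -[X in X + _]mul1r -mulrDl mulrC addrC (le_trans (ltW he)).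
Qed.

(** * Goursat's lemma on rectangles *)

(** The mean value theorem stands in for every estimate of an integral: an
    integral only occurs as the increment of a primitive. *)
Lemma mvt_bound (f df : R -> R) a b c k : a <= b ->
  (forall x, a <= x <= b -> is_derive x 1 f (df x)) ->
  (forall x, a <= x <= b -> `|df x - c| <= k) ->
  `|f b - f a - c * (b - a)| <= k * (b - a).
Proof.
move=> ab Df Hk.
have [||t tab ->] := @MVT_segment R f df a b ab.
- by move=> x; rewrite in_itv /= => /andP[/ltW ax /ltW xb]; apply: Df; rewrite ax.
- by apply: derivable_within_continuous => x; rewrite in_itv /= => /Df[].
- rewrite -mulrBl normrM [X in _ * X]ger0_norm ?subr_ge0 //.
  by rewrite ler_wpM2r ?subr_ge0 //; apply: Hk; rewrite in_itv in tab.
Qed.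

Lemma primitive (f : R -> R) a b :
  (forall x, a <= x <= b -> {for x, continuous f}) ->
  exists F : R -> R, forall x, a < x < b -> is_derive x 1 F (f x).
Proof.
move=> cf; exists (fun x => \int[lebesgue_measure]_(t in `[a, x]) f t).
move=> x /andP[ax xb].
have cfx : {for x, continuous f} by apply: cf; rewrite !ltW.
have [|dF <-] := @continuous_FTC1_closed R f a x b xb _ ax cfx.
  apply: continuous_compact_integrable => //; first exact: segment_compact.
  apply: continuous_in_subspaceT => t; rewrite inE /= in_itv /=; exact: cf.
by rewrite derive1E; apply: DeriveDef.
Qed.

Lemma nested_intervals (a b : nat -> R) :
  (forall n, a n <= a n.+1) -> (forall n, b n.+1 <= b n) -> (forall n, a n <= b n) ->
  exists p, forall n, a n <= p <= b n.
Proof.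
move=> ha hb hab.
have am m n : (m <= n)%N -> a m <= a n by apply/nondecreasing_seqP: m n.
have bm m n : (m <= n)%N -> b n <= b m by apply/nonincreasing_seqP: m n.
have ub n : ubound (range a) (b n).
  move=> _ [m _ <-]; have [mn|/ltnW nm] := leqP m n.
    by rewrite (le_trans (am _ _ mn)).
  by rewrite (le_trans (hab m)) // bm.
exists (sup (range a)) => n; apply/andP; split.
  by apply: ub_le_sup; [exists (b 0%N)|exists n].
by apply: ge_sup => //; exists (a 0%N), 0%N.
Qed.

Lemma expn2_small (k r : R) : 0 < r -> exists n, k / 2 ^+ n < r.
Proof.
move=> r0; have [n kn] : exists n : nat, k / r < n%:R.
  exists (Num.bound `|k / r|).
  exact: le_lt_trans (ler_norm _) (archi_boundP (normr_ge0 _)).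
exists n; rewrite ltr_pdivrMr ?exprn_gt0 // mulrC -ltr_pdivrMr // (lt_trans kn) //.
by rewrite -natrX ltr_nat ltn_expl.
Qed.
End Complex.

Section Goursat.
Context {R : realType}.
Local Notation C := (Cplx R).
Implicit Types (x y : R).

Local Notation mk x y := ((x +i* y)%C : C).

(* A y is a primitive of Re g on the horizontal line of height y, and B x one of
   Im g on the vertical line through x. *)
Section Bisection.
Variables (g : C -> C) (A B : R -> R -> R) (x1 x2 y1 y2 : R).
Hypotheses (x12 : x1 <= x2) (y12 : y1 <= y2).
Hypothesis dg : forall x y, x1 <= x <= x2 -> y1 <= y <= y2 ->
  exists d, cderiv g (mk x y) d.
Hypothesis dA : forall x y, x1 <= x <= x2 -> y1 <= y <= y2 ->
  is_derive x 1 (A y) (complex.Re (g (mk x y))).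
Hypothesis dB : forall x y, x1 <= x <= x2 -> y1 <= y <= y2 ->
  is_derive y 1 (B x) (complex.Im (g (mk x y))).

(* The real part of the integral of g along the boundary of [x, x'] * [y, y']. *)
Let E x x' y y' :=
  (A y x' - A y x) - (A y' x' - A y' x) - ((B x' y' - B x' y) - (B x y' - B x y)).

(* The affine part of g at the point (px, py) contributes nothing to E, and the
   remainder is at most e times the diameter on a boundary of comparable length. *)
Let E_small x x' y y' px py d e r :
  x1 <= x -> x <= px <= x' -> x' <= x2 -> y1 <= y -> y <= py <= y' -> y' <= y2 ->
  0 < e ->
  (forall h : C, cnorm h < r ->
    cnorm (g (mk px py + h) - g (mk px py) - d * h) <= e * cnorm h) ->
  (x' - x) + (y' - y) < r ->
  `|E x x' y y'| <= 2 * e * ((x' - x) + (y' - y)) ^+ 2.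
Proof.
move=> hx /andP[xp px'] hx' hy /andP[yp py'] hy' e0 Hg hr.
set s := (x' - x) + (y' - y) in hr *.
have s0 : 0 <= s by rewrite /s; lra.
have lin t u : x <= t <= x' -> y <= u <= y' ->
    cnorm (g (mk t u) - g (mk px py) - d * mk (t - px) (u - py)) <= e * s.
  move=> /andP[t1 t2] /andP[u1 u2].
  have hs : cnorm (mk (t - px) (u - py)) <= s.
    rewrite -(ler_pXn2r (n := 2)) ?nnegrE ?cnorm_ge0 // sqr_cnorm /=.
    have : `|t - px| <= x' - x by rewrite ler_norml; lra.
    have : `|u - py| <= y' - y by rewrite ler_norml; lra.
    rewrite -(real_normK (num_real (t - px))) -(real_normK (num_real (u - py))) /s.
    move: (normr_ge0 (u - py)) (normr_ge0 (t - px)).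
    move: `|u - py| `|t - px| => p q; nra.
  have := Hg _ (le_lt_trans hs hr).
  rewrite (_ : mk px py + mk (t - px) (u - py) = mk t u).
    by move=> /le_trans -> //; rewrite ler_wpM2l // ltW.
  by apply: complexP => /=; ring.
have bound2 (z z' z0 : C) (D : C) t u t' u' :
    cnorm (z - z0 - d * mk t u) <= e * s -> cnorm (z' - z0 - d * mk t' u') <= e * s ->
    D = d * mk (t - t') (u - u') ->
    `|complex.Re (z - z') - complex.Re D| <= 2 * e * s /\
    `|complex.Im (z - z') - complex.Im D| <= 2 * e * s.
  move=> h1 h2 ->; set D' := d * _.
  have hh : cnorm (z - z' - D') <= 2 * e * s.
    rewrite (_ : _ - _ = (z - z0 - d * mk t u) - (z' - z0 - d * mk t' u')).
      rewrite (le_trans (cnormD _ _)) // cnormN.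
      by move: h1 h2; lra.
    rewrite /D' (_ : mk (t - t') (u - u') = mk t u - mk t' u') //; ring.
  split; [have := Re_le_cnorm (z - z' - D')|have := Im_le_cnorm (z - z' - D')];
    by rewrite ?cReD ?cReN ?cImD ?cImN => /le_trans; apply.
have hyy : y <= y <= y' by apply/andP; split; lra.
have hyy' : y <= y' <= y' by apply/andP; split; lra.
have hxx : x <= x <= x' by apply/andP; split; lra.
have hxx' : x <= x' <= x' by apply/andP; split; lra.
have H1 : `|(fun t => A y t - A y' t) x' - (fun t => A y t - A y' t) x
    - complex.Re (d * mk 0 (y - y')) * (x' - x)| <= 2 * e * s * (x' - x).
  apply: (@mvt_bound R (fun t => A y t - A y' t) (fun t => complex.Re (g (mk t y)) - complex.Re (g (mk t y')))).
  - lra.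
  - move=> t tx; apply: is_deriveB; apply: dA; lra.
  - move=> t tx; have [] := bound2 _ _ _ (d * mk 0 (y - y')) _ _ _ _
      (lin t y tx hyy) (lin t y' tx hyy').
      by congr (_ * mk _ _); ring.
    by rewrite cReD cReN.
have H2 : `|(fun t => B x' t - B x t) y' - (fun t => B x' t - B x t) y
    - complex.Im (d * mk (x' - x) 0) * (y' - y)| <= 2 * e * s * (y' - y).
  apply: (@mvt_bound R (fun t => B x' t - B x t) (fun t => complex.Im (g (mk x' t)) - complex.Im (g (mk x t)))).
  - lra.
  - move=> t tx; apply: is_deriveB; apply: dB; lra.
  - move=> t ty; have [] := bound2 _ _ _ (d * mk (x' - x) 0) _ _ _ _
      (lin x' t hxx' ty) (lin x t hxx ty).
      by congr (_ * mk _ _); ring.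
    by rewrite cImD cImN.
move: H1 H2; rewrite /= !cReM !cImM /= => H1 H2.
rewrite (_ : 2 * e * s ^+ 2 = 2 * e * s * (x' - x) + 2 * e * s * (y' - y)); last by rewrite /s; ring.
move: H1 H2; rewrite !ler_norml /E; lra.
Qed.

Let E_quarter x x' x'' y y' y'' : [\/ `|E x x'' y y''| <= 4 * `|E x x' y y'|,
  `|E x x'' y y''| <= 4 * `|E x' x'' y y'|, `|E x x'' y y''| <= 4 * `|E x x' y' y''|
  | `|E x x'' y y''| <= 4 * `|E x' x'' y' y''| ].
Proof.
have -> : E x x'' y y'' = E x x' y y' + E x' x'' y y' + E x x' y' y'' + E x' x'' y' y''.
  by rewrite /E; ring.
move: (E x x' y y') (E x' x'' y y') (E x x' y' y'') (E x' x'' y' y'') => a b c d.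
have [|c1] := leP `|a + b + c + d| (4 * `|a|); first by constructor 1.
have [|c2] := leP `|a + b + c + d| (4 * `|b|); first by constructor 2.
have [|c3] := leP `|a + b + c + d| (4 * `|c|); first by constructor 3.
constructor 4.
have := ler_normD (a + b + c) d; have := ler_normD (a + b) c; have := ler_normD a b.
lra.
Qed.

Let w n := (x2 - x1) / 2 ^+ n.
Let h n := (y2 - y1) / 2 ^+ n.
Let wS n : w n = w n.+1 + w n.+1.
Proof. by rewrite /w exprS; field; rewrite expf_neq0. Qed.
Let hS n : h n = h n.+1 + h n.+1.
Proof. by rewrite /h exprS; field; rewrite expf_neq0. Qed.
Let w0 n : 0 <= w n. Proof. by rewrite divr_ge0 ?subr_ge0 // exprn_ge0. Qed.
Let h0 n : 0 <= h n. Proof. by rewrite divr_ge0 ?subr_ge0 // exprn_ge0. Qed.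

(** Goursat's argument: E is additive under subdivision and o(diam^2) near a
    point where g is differentiable, so that quartering the rectangle again and
    again forces E = 0. The derivative of g need not be continuous. *)
Lemma goursat_rectangle :
  (A y1 x2 - A y1 x1) - (A y2 x2 - A y2 x1) =
  (B x2 y2 - B x2 y1) - (B x1 y2 - B x1 y1).
Proof.
suff : E x1 x2 y1 y2 = 0 by move/subr0_eq.
pose Q n (p : R * R) :=
  `|E x1 x2 y1 y2| <= 4 ^+ n * `|E p.1 (p.1 + w n) p.2 (p.2 + h n)|.
have next n p : exists p', Q n p ->
    [/\ p'.1 = p.1 \/ p'.1 = p.1 + w n.+1,
        p'.2 = p.2 \/ p'.2 = p.2 + h n.+1 & Q n.+1 p'].
  have [q|nq] := pselect (Q n p); last by exists p => /nq.
  have key (z t : R) :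
      `|E p.1 (p.1 + w n) p.2 (p.2 + h n)| <= 4 * `|E z (z + w n.+1) t (t + h n.+1)| ->
      Q n.+1 (z, t).
    move=> hE; rewrite /Q [(z, t).1]/= [(z, t).2]/= (le_trans q) //.
    by rewrite exprS (mulrC 4) -mulrA ler_wpM2l ?exprn_ge0.
  move: key; rewrite {1}(wS n) {1}(hS n) !addrA => key.
  have := E_quarter p.1 (p.1 + w n.+1) (p.1 + w n.+1 + w n.+1)
                    p.2 (p.2 + h n.+1) (p.2 + h n.+1 + h n.+1).
  case=> /key hq.
  - by exists (p.1, p.2) => _; split; [left|left|].
  - by exists (p.1 + w n.+1, p.2) => _; split; [right|left|].
  - by exists (p.1, p.2 + h n.+1) => _; split; [left|right|].
  - by exists (p.1 + w n.+1, p.2 + h n.+1) => _; split; [right|right|].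
have [nx Hnx] : {nx : nat -> R * R -> R * R & forall n p, Q n p ->
    [/\ (nx n p).1 = p.1 \/ (nx n p).1 = p.1 + w n.+1,
        (nx n p).2 = p.2 \/ (nx n p).2 = p.2 + h n.+1 & Q n.+1 (nx n p)]}.
  exists (fun n p => projT1 (cid (next n p))) => n p; exact: (projT2 (cid (next n p))).
pose P := fix P n := if n is k.+1 then nx k (P k) else (x1, y1).
have PQ n : Q n (P n).
  elim: n => [|n IH] /=; last by have [] := Hnx n _ IH.
  by rewrite /Q /= expr0 mul1r /w /h expr0 !divr1 !subrKC.
have Px n : (P n.+1).1 = (P n).1 \/ (P n.+1).1 = (P n).1 + w n.+1 by have [] := Hnx n _ (PQ n).
have Py n : (P n.+1).2 = (P n).2 \/ (P n.+1).2 = (P n).2 + h n.+1 by have [] := Hnx n _ (PQ n).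
have [px Hpx] : exists p, forall n, (P n).1 <= p <= (P n).1 + w n.
  apply: nested_intervals => n; last by rewrite lerDl.
    by have := w0 n.+1; case: (Px n); lra.
  by have := w0 n.+1; have := wS n; case: (Px n); lra.
have [py Hpy] : exists p, forall n, (P n).2 <= p <= (P n).2 + h n.
  apply: nested_intervals => n; last by rewrite lerDl.
    by have := h0 n.+1; case: (Py n); lra.
  by have := h0 n.+1; have := hS n; case: (Py n); lra.
have Ix n : x1 <= (P n).1 /\ (P n).1 + w n <= x2.
  elim: n => [|n [IH1 IH2]]; first by rewrite /= /w expr0 divr1 subrKC.
  by have := w0 n.+1; have := wS n; case: (Px n) => ->; split; lra.
have Iy n : y1 <= (P n).2 /\ (P n).2 + h n <= y2.
  elim: n => [|n [IH1 IH2]]; first by rewrite /= /h expr0 divr1 subrKC.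
  by have := h0 n.+1; have := hS n; case: (Py n) => ->; split; lra.
have [d Hd] : exists d, cderiv g (mk px py) d.
  apply: dg; first by have [? ?] := Ix 0%N; have /andP[? ?] := Hpx 0%N; apply/andP; split; lra.
  by have [? ?] := Iy 0%N; have /andP[? ?] := Hpy 0%N; apply/andP; split; lra.
apply/normr0_eq0/le_anti; rewrite normr_ge0 andbT.
apply/ler_addgt0Pr => e e0; rewrite add0r.
pose S := (x2 - x1) + (y2 - y1).
have S0 : 0 <= S by rewrite addr_ge0 ?subr_ge0.
pose e' := e / (2 * (S ^+ 2 + 1)).
have S1 : 0 < S ^+ 2 + 1 by rewrite ltr_wpDl ?sqr_ge0.
have e'0 : 0 < e' by rewrite divr_gt0 // mulr_gt0.
have [r r0 Hr] := Hd _ e'0.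
have [n nr] := expn2_small S r0.
have := PQ n; rewrite /Q => /le_trans; apply.
have [Ix1 Ix2] := Ix n; have [Iy1 Iy2] := Iy n.
have wh : w n + h n = S / 2 ^+ n by rewrite /w /h /S -mulrDl.
have := @E_small (P n).1 ((P n).1 + w n) (P n).2 ((P n).2 + h n) px py d e' r
  Ix1 (Hpx n) Ix2 Iy1 (Hpy n) Iy2 e'0 Hr.
rewrite !(addrAC _ _ (- _)) !subrr !add0r wh => /(_ nr) Hs.
have := ler_wpM2l (exprn_ge0 n (ler0n R 4)) Hs => /le_trans; apply.
have -> : 4 ^+ n * (2 * e' * (S / 2 ^+ n) ^+ 2) = 2 * e' * S ^+ 2.
  rewrite exprMn exprVn -exprM mulnC exprM (_ : 2 ^+ 2 = 4 :> R); last by ring.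
  by field; rewrite expf_neq0.
have -> : 2 * e' * S ^+ 2 = e * (S ^+ 2 / (S ^+ 2 + 1)) by rewrite /e'; field; rewrite gt_eqF.
by rewrite ler_piMr ?(ltW e0) // ler_pdivrMr // mul1r lerDl.
Qed.
End Bisection.
End Goursat.

(** * The derivative of a bounded function at the centre of the disc *)

Section Polar.
Context {R : realType}.
Local Notation C := (Cplx R).
Implicit Types (x y : R).
Local Notation mk x y := ((x +i* y)%C : C).

(** The complex exponential turns circles around 0 into vertical segments, to
    which Goursat's lemma on rectangles applies. *)
Definition cexp (w : C) : C :=
  mk (expR (complex.Re w) * cos (complex.Im w)) (expR (complex.Re w) * sin (complex.Im w)).

Lemma cexpD w h : cexp (w + h) = cexp w * cexp h.
Proof.
rewrite /cexp cReD cImD expRD cosD sinD.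
by apply: complexP => /=; ring.
Qed.

Lemma cexp_neq0 w : cexp w != 0.
Proof.
apply/eqP => /(congr1 (fun z : C => cnorm z ^+ 2)).
rewrite sqr_cnorm cnorm0 expr0n /= !exprMn -mulrDr cos2Dsin2 mulr1 => /eqP.
by rewrite expf_eq0 /= gt_eqF ?expR_gt0.
Qed.

Lemma cnorm_cexp w : cnorm (cexp w) = expR (complex.Re w).
Proof.
apply/eqP; rewrite -(eqrXn2 (n := 2)) ?cnorm_ge0 ?expR_ge0 //.
by rewrite sqr_cnorm /= !exprMn -mulrDr cos2Dsin2 mulr1.
Qed.

Lemma cnorm_le_ReIm (z : C) : cnorm z <= `|complex.Re z| + `|complex.Im z|.
Proof.
rewrite -(ler_pXn2r (n := 2)) ?nnegrE ?cnorm_ge0 ?addr_ge0 // sqr_cnorm.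
rewrite -(real_normK (num_real (complex.Re z))) -(real_normK (num_real (complex.Im z))).
by rewrite sqrrD addrAC lerDl mulrn_wge0 ?mulr_ge0.
Qed.

Lemma is_derive_eps (f : R -> R) x d : is_derive x 1 f d ->
  forall e, 0 < e -> exists2 r, 0 < r &
    forall h, `|h| < r -> `|f (x + h) - f x - d * h| <= e * `|h|.
Proof.
move=> [df <-] e e0.
have : (fun h => h^-1 *: ((f \o shift x) h%:A - f x)) @ 0^' --> 'D_1 f x by exact: df.
move/cvgrPdist_le => /(_ e e0).
rewrite near_withinE => /nbhs_normP[r /= r0 H]; exists r => // h hr.
have [->|h0] := eqVneq h 0; first by rewrite addr0 subrr mulr0 subr0 normr0 mulr0.
have := H h; rewrite /= sub0r normrN => /(_ hr h0).
rewrite /= [h%:A]mulr1 => Hh.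
rewrite -ler_pdivrMr ?normr_gt0 // -normfV -normrM -normrN.
rewrite (_ : - _ = 'D_1 f x - h^-1 *: (f (h + x) - f x)) // /GRing.scale /=.
rewrite (addrC x h); field; exact: h0.
Qed.

Lemma cderiv_cexp w : cderiv cexp w (cexp w).
Proof.
have near0 (e : R) : 0 < e -> exists2 r : R, 0 < r &
    forall h, cnorm h < r -> cnorm (cexp h - 1 - h) <= e * cnorm h.
  move=> e0; pose k := Num.min 1 (e / 8).
  have k0 : 0 < k by rewrite lt_min ltr01 divr_gt0.
  have k1 : k <= 1 by rewrite ge_min lexx.
  have ke : k <= e / 8 by rewrite ge_min lexx orbT.
  have [r r0 Hr] := is_derive_eps (is_derive_expR 0) k0.
  have [s s0 Hs] := is_derive_eps (is_derive_cos 0) k0.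
  have [t t0 Ht] := is_derive_eps (is_derive_sin 0) k0.
  exists (Num.min (Num.min r (k / 2)) (Num.min s t)).
    by rewrite !lt_min r0 s0 t0 divr_gt0.
  move=> [x y]; rewrite !lt_min => /andP[/andP[hr hk] /andP[hs ht]].
  have nx := Re_le_cnorm (mk x y); have ny := Im_le_cnorm (mk x y).
  rewrite [complex.Re _]/= in nx; rewrite [complex.Im _]/= in ny.
  move: (cnorm (mk x y)) hr hk hs ht nx ny => N hr hk hs ht nx ny.
  have := Hr _ (le_lt_trans nx hr); have := Hs _ (le_lt_trans ny hs); have := Ht _ (le_lt_trans ny ht).
  rewrite !add0r expR0 cos0 sin0 !subr0 oppr0 mul0r !mul1r !subr0 => hsin hcos hexp.
  have Hle : cnorm (cexp (mk x y) - 1 - mk x y) <= `|expR x * cos y - 1 - x| + `|expR x * sin y - y|.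
    apply: (le_trans (cnorm_le_ReIm _)).
    by rewrite !cReD !cImD !cReN !cImN /= subr0.
  apply: (le_trans Hle).
  have N0 : 0 <= N by rewrite (le_trans (normr_ge0 x)).
  have hE1 : `|expR x - 1| <= 2 * N.
    have -> : expR x - 1 = (expR x - 1 - x) + x by ring.
    rewrite (le_trans (ler_normD _ _)) //.
    have : k * `|x| <= `|x| by rewrite ler_piMl.
    lra.
  have hE3 : `|expR x| <= 3.
    have -> : expR x = (expR x - 1) + 1 by ring.
    rewrite (le_trans (ler_normD _ _)) // normr1; lra.
  have h1 : `|expR x * cos y - 1 - x| <= k * N + 3 * (k * N).
    have -> : expR x * cos y - 1 - x = (expR x - 1 - x) + expR x * (cos y - 1) by ring.
    rewrite (le_trans (ler_normD _ _)) // lerD //.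
      by rewrite (le_trans hexp) // ler_wpM2l // ltW.
    by rewrite normrM ler_pM // (le_trans hcos) // ler_wpM2l // ltW.
  have h2 : `|expR x * sin y - y| <= 3 * (k * N) + k * N.
    have -> : expR x * sin y - y = expR x * (sin y - y) + (expR x - 1) * y by ring.
    rewrite (le_trans (ler_normD _ _)) // lerD //.
      by rewrite normrM ler_pM // (le_trans hsin) // ler_wpM2l // ltW.
    by rewrite normrM ler_pM // (le_trans hE1) //; lra.
  apply: (le_trans (lerD h1 h2)).
  have : k * N <= e / 8 * N by rewrite ler_wpM2r.
  lra.
move=> e e0.
have c0 : 0 < cnorm (cexp w) by rewrite cnorm_gt0 cexp_neq0.
have [r r0 H] := near0 (e / cnorm (cexp w)) (divr_gt0 e0 c0).
exists r => // h /H hh.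
have -> : cexp (w + h) - cexp w - cexp w * h = cexp w * (cexp h - 1 - h).
  by rewrite cexpD; ring.
by rewrite cnormM mulrC -ler_pdivlMr // mulrAC.
Qed.

(** The mean of Im K over a circle around 0 does not depend on the radius: this
    is Goursat's lemma for w |-> K (exp w) on a rectangle of height 2 pi, whose
    horizontal sides cancel by periodicity. *)
Lemma circle_primitives (K : C -> C) (x1 x2 L : R) : x1 <= x2 -> x2 < L ->
  (forall z, z != 0 -> cnorm z <= expR (L) -> exists d, cderiv K z d) ->
  exists B1 B2 : R -> R,
    [/\ forall y, -1 < y < pi *+ 2 + 1 ->
          is_derive y 1 B1 (complex.Im (K (cexp (mk x1 y)))),
        forall y, -1 < y < pi *+ 2 + 1 ->
          is_derive y 1 B2 (complex.Im (K (cexp (mk x2 y)))) &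
        B1 (pi *+ 2) - B1 0 = B2 (pi *+ 2) - B2 0].
Proof.
move=> x12 x2L dK; pose g := K \o cexp.
have dg (z : C) : complex.Re z <= L -> exists d, cderiv g z d.
  move=> hz; have [|d Hd] := dK (cexp z) (cexp_neq0 z); first by rewrite cnorm_cexp ler_expR.
  by exists (d * cexp z); apply: cderiv_comp => //; exact: cderiv_cexp.
have cRe x y : x <= L -> {for x, continuous (fun t => complex.Re (g (mk t y)))}.
  move=> hx; have [//|d Hd] := dg (mk x y).
  apply/cvgrPdist_le => e e0; have [r r0 Hr] := cderiv_continuous Hd e0.
  apply/nbhs_normP; exists r => // t /=; rewrite (distrC x) => tx.
  rewrite (_ : mk t y = mk x y + mk (t - x) 0); last by apply: complexP => /=; ring.
  rewrite [X in X <= _]distrC.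
  have := Hr (mk (t - x) 0); rewrite -[X in cnorm X < _]/((t - x)%:C%C : C) cnorm_real.
  by move=> /(_ tx) /(le_trans (Re_le_cnorm _)); rewrite cReD cReN.
have cIm x y : x <= L -> {for y, continuous (fun t => complex.Im (g (mk x t)))}.
  move=> hx; have [//|d Hd] := dg (mk x y).
  apply/cvgrPdist_le => e e0; have [r r0 Hr] := cderiv_continuous Hd e0.
  apply/nbhs_normP; exists r => // t /=; rewrite (distrC y) => ty.
  rewrite (_ : mk x t = mk x y + mk 0 (t - y)); last by apply: complexP => /=; ring.
  rewrite [X in X <= _]distrC.
  have := Hr (mk 0 (t - y)); rewrite [X in X < _](_ : _ = `|t - y|); last first.
    by rewrite /= expr0n add0r sqrtr_sqr.
  by move=> /(_ ty) /(le_trans (Im_le_cnorm _)); rewrite cImD cImN.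
have pi0 : 0 < pi *+ 2 :> R by rewrite mulrn_wgt0 // pi_gt0.
have [A HA] : {A : R -> R -> R & forall y x, x1 - 1 < x < L ->
    is_derive x 1 (A y) (complex.Re (g (mk x y)))}.
  apply: (@choice R (R -> R) (fun y F => forall x, x1 - 1 < x < L ->
    is_derive x 1 F (complex.Re (g (mk x y))))) => y; apply: primitive => x /andP[_ hx]; exact: cRe.
have [B HB] : {B : R -> R -> R & forall x y, x <= L -> -1 < y < pi *+ 2 + 1 ->
    is_derive y 1 (B x) (complex.Im (g (mk x y)))}.
  apply: (@choice R (R -> R) (fun x F => forall y, x <= L -> -1 < y < pi *+ 2 + 1 ->
    is_derive y 1 F (complex.Im (g (mk x y))))) => x; have [hx|hx] := leP x (L); last by exists (fun=> 0) => y h; lra.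
  have [F HF] := @primitive R (fun t => complex.Im (g (mk x t))) (-1) (pi *+ 2 + 1)
    (fun y _ => cIm x y hx).
  by exists F => y _; exact: HF.
have gper x : g (mk x (pi *+ 2)) = g (mk x 0).
  by rewrite /g /cexp /= cos2pi sin2pi cos0 sin0.
(* the primitives on the two horizontal sides have to be the same function *)
pose A' y := A (if y == pi *+ 2 then 0 else y).
have HA' y x : x1 - 1 < x < L -> is_derive x 1 (A' y) (complex.Re (g (mk x y))).
  by rewrite /A'; have [->|_] := eqVneq y (pi *+ 2); rewrite ?gper; exact: HA.
have x1' : x1 - 1 < x1 by lra.
exists (B x1), (B x2); split.
- by move=> y hy; apply: HB => //; lra.
- by move=> y hy; apply: HB => //; lra.
have A0 x : A' 0 x = A 0 x by rewrite /A'; case: ifP.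
have A2 x : A' (pi *+ 2) x = A 0 x by rewrite /A' eqxx.
have H1 x y : x1 <= x <= x2 -> 0 <= y <= pi *+ 2 -> exists d, cderiv g (mk x y) d.
  by move=> /andP[? ?] _; apply: dg => /=; lra.
have H2 x y : x1 <= x <= x2 -> 0 <= y <= pi *+ 2 ->
    is_derive x 1 (A' y) (complex.Re (g (mk x y))).
  by move=> /andP[? ?] _; apply: HA'; apply/andP; split; lra.
have H3 x y : x1 <= x <= x2 -> 0 <= y <= pi *+ 2 ->
    is_derive y 1 (B x) (complex.Im (g (mk x y))).
  by move=> /andP[? ?] /andP[? ?]; apply: HB; [lra|apply/andP; split; lra].
have := goursat_rectangle x12 (ltW pi0) H1 H2 H3.
by rewrite !A0 !A2 subrr => /esym/subr0_eq.
Qed.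

(** After multiplication by a unit c with c d = i |d|, the mean of Im (c f(z) / z)
    is close to |d| on small circles, and at most 1 / p on the circle of radius p.
    The two agree by circle_primitives, so |d| > 1 is impossible. *)
Lemma cderiv_Cauchy_le (f : C -> C) (d : C) :
  (forall z : C, cnorm z < 1 -> differentiable f z) ->
  (forall z : C, cnorm z < 1 -> cnorm (f z) <= 1) ->
  f 0 = 0 -> cderiv f 0 d -> cnorm d <= 1.
Proof.
move=> df f1 f0 fd; rewrite leNgt; apply/negP => d1.
have dp : 0 < cnorm d by rewrite (lt_trans ltr01).
pose q := (1 + cnorm d) / 2; pose p := q^-1.
have q1 : 1 < q by rewrite /q; lra.
have p0 : 0 < p by rewrite invr_gt0 (lt_trans ltr01).
have p1 : p < 1 by rewrite invf_lt1 // (lt_trans ltr01).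
pose e := (cnorm d - q) / 2.
have e0 : 0 < e by rewrite /e /q; lra.
have [r r0 Hr] := fd _ e0.
pose s := Num.min (r / 2) p.
have s0 : 0 < s by rewrite lt_min p0 divr_gt0.
have sp : s <= p by rewrite ge_min lexx orbT.
have sr : s < r.
  by rewrite (@le_lt_trans _ _ (r / 2)) ?ge_min ?lexx // ltr_pdivrMr //; lra.
pose c : C := 'i%C * d^* / (cnorm d)%:C%C.
have dC : (cnorm d)%:C%C != 0 :> C by rewrite -normCE normr_eq0 -cnorm_gt0.
have cd : c * d = 'i%C * (cnorm d)%:C%C.
  rewrite (_ : c * d = 'i%C * (d * d^*) / (cnorm d)%:C%C); last by rewrite /c; ring.
  by rewrite mulc_conj rmorphXn /=; field.
have c1 : cnorm c = 1.
  rewrite /c !cnormM cnormV cnorm_conj cnorm_real ger0_norm ?cnorm_ge0 //.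
  by rewrite mulfK ?gt_eqF //= expr0n expr1n add0r sqrtr1.
clearbody c.
pose K z := c * f z / z.
have x12 : ln s <= ln p by rewrite ler_ln ?posrE.
have lnp : ln p < 0 by rewrite ln_lt0 // p0.
have lnpL : ln p < ln p / 2 by rewrite ltr_pdivlMr //; lra.
have dK (z : C) : z != 0 -> cnorm z <= expR (ln p / 2) -> exists d, cderiv K z d.
  move=> z0 zL; apply: differentiable_cderiv.
  have z1 : cnorm z < 1.
    by rewrite (le_lt_trans zL) // expR_lt1 pmulr_llt0 // invr_gt0.
  apply: differentiableM; last by apply: differentiableV.
  by apply: differentiableM => //; exact: df.
have [B1 [B2 [D1 D2 E12]]] := circle_primitives x12 lnpL dK.
have pi0 : 0 < pi *+ 2 :> R by rewrite mulrn_wgt0 // pi_gt0.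
have cnormE (x y : R) : 0 < x -> cnorm (cexp (mk (ln x) y)) = x.
  by move=> x0; rewrite cnorm_cexp /= lnK.
have b1 : `|B1 (pi *+ 2) - B1 0 - cnorm d * (pi *+ 2 - 0)| <= e * (pi *+ 2 - 0).
  apply: (mvt_bound (ltW pi0)) => [y /andP[y0 y2]|y _]; first by apply: D1; lra.
  cbv beta; set z := cexp _.
  have zs : cnorm z = s by rewrite /z cnormE.
  have z0 : z != 0 by exact: cexp_neq0.
  have := Hr z; rewrite zs => /(_ sr); rewrite add0r f0 subr0 => Hz.
  have -> : complex.Im (K z) - cnorm d = complex.Im (c * ((f z - d * z) / z)).
    rewrite [X in _ = complex.Im X](_ : _ = K z - c * d); last by rewrite /K; field.
    by rewrite cd cImD cImN cImM /=; ring.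
  rewrite (le_trans (Im_le_cnorm _)) // !cnormM c1 mul1r cnormV zs.
  by rewrite ler_pdivrMr.
have b2 : `|B2 (pi *+ 2) - B2 0 - 0 * (pi *+ 2 - 0)| <= q * (pi *+ 2 - 0).
  apply: (mvt_bound (ltW pi0)) => [y /andP[y0 y2]|y _]; first by apply: D2; lra.
  cbv beta; set z := cexp _.
  have zs : cnorm z = p by rewrite /z cnormE.
  rewrite subr0 (le_trans (Im_le_cnorm _)) // /K. rewrite !cnormM c1 mul1r cnormV zs.
  by rewrite /p invrK ler_piMl ?f1 ?zs // ltW // (lt_trans ltr01).
move: b1 b2; rewrite E12 subr0 mul0r subr0 !ler_norml => /andP[h1 _] /andP[_ h2].
have : (cnorm d - e - q) * pi *+ 2 <= 0 by lra.
have -> : cnorm d - e - q = e by rewrite /e; lra.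
by rewrite leNgt -mulrnAr mulr_gt0.
Qed.
End Polar.

(** * The Schwarz-Pick lemma *)

Section SchwarzPick.
Context {R : realType}.
Local Notation C := (Cplx R).
Implicit Types (x y : R) (z w a : C).

Lemma eps_is_derive (f : R -> R) x d :
  (forall e, 0 < e -> exists2 r, 0 < r &
    forall h, `|h| < r -> `|f (x + h) - f x - d * h| <= e * `|h|) ->
  is_derive x 1 f d.
Proof.
move=> H.
have cv : (fun h => h^-1 *: ((f \o shift x) h%:A - f x)) @ 0^' --> d.
  apply/cvgrPdist_le => e e0; have [r r0 Hr] := H e e0.
  rewrite near_withinE; apply/nbhs_normP; exists r => // h /=.
  rewrite sub0r normrN => hr h0; have := Hr h hr.
  rewrite -ler_pdivrMr ?normr_gt0 // -normfV -normrM [h%:A]mulr1 /= (addrC h x).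
  have -> : (f (x + h) - f x - d * h) / h = - (d - h^-1 *: (f (x + h) - f x)).
    by rewrite /GRing.scale /=; field.
  by rewrite normrN.
by split; [apply/cvg_ex; exists d|exact/cvg_lim].
Qed.

Lemma ReMreal z x : complex.Re (z * x%:C%C) = complex.Re z * x.
Proof. by case: z => a b /=; rewrite mulr0 subr0. Qed.

(** The derivative along a real line; c = 1 gives the real part of f, and
    c = - i its imaginary part. *)
Lemma cderiv_line (f : C -> C) z u c d x : cderiv f (z + x%:C%C * u) d ->
  is_derive x 1 (fun s : R => complex.Re (c * f (z + s%:C%C * u))) (complex.Re (c * d * u)).
Proof.
move=> fd; apply: eps_is_derive => e e0.
have k0 : 0 < cnorm c * cnorm u + 1.
  by rewrite ltr_wpDl // mulr_ge0 ?cnorm_ge0.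
have u0 : 0 < cnorm u + 1 by rewrite ltr_wpDl ?cnorm_ge0.
have [r r0 Hr] := fd _ (divr_gt0 e0 k0).
exists (r / (cnorm u + 1)); first exact: divr_gt0.
move=> h; rewrite ltr_pdivlMr // => hr.
have hu : cnorm (h%:C%C * u) = `|h| * cnorm u by rewrite cnormM cnorm_real.
have hur : cnorm (h%:C%C * u) < r.
  by rewrite hu (le_lt_trans _ hr) // ler_wpM2l // lerDl.
set A := z + x%:C%C * u.
have -> : z + (x + h)%:C%C * u = A + h%:C%C * u by rewrite rmorphD /= /A; ring.
have -> : complex.Re (c * f (A + h%:C%C * u)) - complex.Re (c * f A) - complex.Re (c * d * u) * h
    = complex.Re (c * (f (A + h%:C%C * u) - f A - d * (h%:C%C * u))).
  have -> : complex.Re (c * d * u) * h = complex.Re (c * (d * (h%:C%C * u))).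
    have -> : c * (d * (h%:C%C * u)) = (c * d * u) * h%:C%C by ring.
    by rewrite ReMreal.
  by rewrite !mulrBr !(cReD, cReN).
rewrite (le_trans (Re_le_cnorm _)) // cnormM.
rewrite (le_trans (ler_wpM2l (cnorm_ge0 c) (Hr _ hur))) // hu.
have -> : cnorm c * (e / (cnorm c * cnorm u + 1) * (`|h| * cnorm u)) =
  e * `|h| * ((cnorm c * cnorm u) / (cnorm c * cnorm u + 1)) by ring.
rewrite ler_piMr ?mulr_ge0 ?(ltW e0) // ler_pdivrMr // mul1r lerDl //.
Qed.

(** The automorphism of the disc that moves a to 0. *)
Definition mobius a z : C := (z - a) / (1 - a^* * z).

Lemma mobius_den_neq0 a z : cnorm a < 1 -> cnorm z <= 1 -> 1 - a^* * z != 0.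
Proof.
move=> a1 z1; rewrite subr_eq0; apply/eqP => /(congr1 (@cnorm R)).
rewrite cnorm1 cnormM cnorm_conj => h.
have : cnorm a * cnorm z < 1.
  by rewrite (le_lt_trans _ a1) // ler_piMr ?cnorm_ge0.
by rewrite -h ltxx.
Qed.

Lemma sqr_cnorm_mobius_den a z : cnorm (1 - a^* * z) ^+ 2 =
  cnorm (z - a) ^+ 2 + (1 - cnorm a ^+ 2) * (1 - cnorm z ^+ 2).
Proof. by case: a => a b; case: z => x y; rewrite !sqr_cnorm /=; ring. Qed.

Lemma cnorm_mobius a z : cnorm a < 1 -> cnorm z <= 1 ->
  1 - cnorm (mobius a z) ^+ 2 =
  (1 - cnorm a ^+ 2) * (1 - cnorm z ^+ 2) / cnorm (1 - a^* * z) ^+ 2.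
Proof.
move=> a1 z1; have := mobius_den_neq0 a1 z1; rewrite -cnorm_eq0 => n0.
rewrite /mobius cnormM cnormV exprMn exprVn.
have -> : (1 - cnorm a ^+ 2) * (1 - cnorm z ^+ 2) =
  cnorm (1 - a^* * z) ^+ 2 - cnorm (z - a) ^+ 2 by rewrite sqr_cnorm_mobius_den; ring.
by field.
Qed.

Lemma subr_sqr_gt0 x : 0 <= x -> (0 < 1 - x ^+ 2) = (x < 1).
Proof. by move=> x0; rewrite subr_gt0 expr_lt1. Qed.

Lemma mobius_disc a z : cnorm a < 1 -> cnorm z < 1 -> cnorm (mobius a z) < 1.
Proof.
move=> a1 z1; rewrite -subr_sqr_gt0 ?cnorm_ge0 // cnorm_mobius ?ltW //.
apply: divr_gt0; first by rewrite mulr_gt0 ?subr_sqr_gt0 ?cnorm_ge0.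
by rewrite exprn_gt0 // cnorm_gt0 mobius_den_neq0 // ltW.
Qed.

Lemma mobius0 a : mobius a a = 0. Proof. by rewrite /mobius subrr mul0r. Qed.

Lemma mobiusK a z : cnorm a < 1 -> cnorm z < 1 -> mobius (- a) (mobius a z) = z.
Proof.
move=> a1 z1; have n0 := mobius_den_neq0 a1 (ltW z1).
have k0 : 1 - a^* * a != 0 by apply: mobius_den_neq0 => //; exact: ltW.
rewrite /mobius opprK rmorphN /= mulNr opprK.
have -> : 1 + a^* * ((z - a) / (1 - a^* * z)) = (1 - a^* * a) / (1 - a^* * z) by field.
field; by rewrite k0 n0.
Qed.

Lemma differentiable_mobius a z : cnorm a < 1 -> cnorm z < 1 -> differentiable (mobius a) z.
Proof.
move=> a1 z1; apply: differentiableM; first exact: differentiableB.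
apply: differentiableV; last by apply: mobius_den_neq0 => //; exact: ltW.
by apply: differentiableB => //; apply: differentiableM.
Qed.

Lemma cderiv_mobius a z : cnorm a < 1 -> cnorm z < 1 ->
  cderiv (mobius a) z ((1 - a^* * a) / (1 - a^* * z) ^+ 2).
Proof.
move=> a1 z1 e e0; have n0 := mobius_den_neq0 a1 (ltW z1).
set D := 1 - a^* * z in n0 *.
have D0 : 0 < cnorm D by rewrite cnorm_gt0.
pose K := cnorm (a^* * (1 - a^* * a)) + 1.
have K0 : 0 < K by rewrite ltr_wpDl ?cnorm_ge0.
exists (Num.min (cnorm D / 2) (e * cnorm D ^+ 3 / 2 / K)).
  by rewrite lt_min !divr_gt0 // mulr_gt0 // exprn_gt0.
move=> h; rewrite lt_min => /andP[hD he].
have ah : cnorm (a^* * h) <= cnorm h.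
  by rewrite cnormM cnorm_conj ler_piMl ?cnorm_ge0 // ltW.
have D'E : 1 - a^* * (z + h) = D - a^* * h by rewrite /D; ring.
have D'n : cnorm D / 2 <= cnorm (1 - a^* * (z + h)).
  by rewrite D'E; have := cnormB_le D (a^* * h); lra.
have D'0 : 1 - a^* * (z + h) != 0.
  by rewrite -cnorm_gt0 (lt_le_trans _ D'n) // divr_gt0.
have -> : mobius a (z + h) - mobius a z - (1 - a^* * a) / D ^+ 2 * h =
    h * h * (a^* * (1 - a^* * a)) / (D ^+ 2 * (1 - a^* * (z + h))).
  rewrite /mobius -/D; rewrite /D; field.
  by rewrite n0 D'0.
rewrite cnormM cnormV ler_pdivrMr ?cnorm_gt0 ?mulf_neq0 ?expf_neq0 //.
have -> : h * h * (a^* * (1 - a^* * a)) = h * (a^* * (1 - a^* * a)) * h by ring.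
rewrite cnormM [X in _ <= X]mulrAC ler_wpM2r ?cnorm_ge0 //.
have hK : cnorm (h * (a^* * (1 - a^* * a))) <= cnorm h * K.
  by rewrite cnormM ler_wpM2l ?cnorm_ge0 // /K lerDl.
have : cnorm h * K <= e * cnorm D ^+ 3 / 2 by rewrite -ler_pdivlMr // ltW.
move=> /(le_trans hK)/le_trans; apply.
have -> : e * cnorm D ^+ 3 / 2 = e * (cnorm D * (cnorm D * (cnorm D / 2))) by ring.
rewrite expr2 !cnormM -mulrA; apply: ler_wpM2l; first exact: ltW.
by do 2 (apply: ler_wpM2l; first exact: ltW).
Qed.

Section SelfMap.
Variable f : C -> C.
Hypothesis df : forall z, cnorm z < 1 -> differentiable f z.
Hypothesis f1 : forall z, cnorm z < 1 -> cnorm (f z) < 1.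

(** Composing with Moebius maps on both sides moves a and f a to 0, where
    cderiv_Cauchy_le applies. *)
Lemma schwarz_pick_derivative a d : cnorm a < 1 -> cderiv f a d ->
  cnorm d * (1 - cnorm a ^+ 2) <= 1 - cnorm (f a) ^+ 2.
Proof.
move=> a1 fd; have b1 := f1 a1; set b := f a in b1 *.
have na1 : cnorm (- a) < 1 by rewrite cnormN.
have m0 : mobius (- a) 0 = a by rewrite /mobius mulr0 subr0 divr1 opprK add0r.
pose g := mobius b \o (f \o mobius (- a)).
have gd : cderiv g 0 ((1 - b^* * b) / (1 - b^* * b) ^+ 2 * (d * ((1 - a^* * a) / 1 ^+ 2))).
  have z1 : cnorm (0 : C) < 1 by rewrite cnorm0.
  have := cderiv_mobius na1 z1; rewrite mulr0 subr0 rmorphN /= mulrNN => ma.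
  have fm : cderiv f (mobius (- a) 0) d by rewrite m0.
  apply: (cderiv_comp (cderiv_comp ma fm)).
  by rewrite /= m0; exact: cderiv_mobius.
have dg z : cnorm z < 1 -> differentiable g z.
  move=> z1; have mz := mobius_disc na1 z1.
  apply: differentiable_comp; last first.
    by apply: differentiable_mobius => //; exact: f1.
  by apply: differentiable_comp; [exact: differentiable_mobius|exact: df].
have g1 z : cnorm z < 1 -> cnorm (g z) <= 1.
  by move=> z1; rewrite ltW // mobius_disc // f1 // mobius_disc.
have g0 : g 0 = 0 by rewrite /g /= m0 mobius0.
have := cderiv_Cauchy_le dg g1 g0 gd.
have pos (c : C) : cnorm c < 1 -> cnorm (1 - c^* * c) = 1 - cnorm c ^+ 2.
  move=> c1; have -> : 1 - c^* * c = ((1 - cnorm c ^+ 2)%:C%C : C).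
    by rewrite mulrC mulc_conj rmorphB rmorph1.
  by rewrite cnorm_real ger0_norm // subr_ge0 expr_le1 ?cnorm_ge0 // ltW.
have b0 : 0 < 1 - cnorm b ^+ 2 by rewrite subr_sqr_gt0 ?cnorm_ge0.
rewrite !cnormM !cnormV expr1n cnorm1 invr1 mulr1 [cnorm (_ ^+ 2)]cnormM !pos //.
have -> : (1 - cnorm b ^+ 2) / ((1 - cnorm b ^+ 2) * (1 - cnorm b ^+ 2)) *
    (cnorm d * (1 - cnorm a ^+ 2)) = cnorm d * (1 - cnorm a ^+ 2) / (1 - cnorm b ^+ 2).
  by field; rewrite gt_eqF.
by rewrite ler_pdivrMr // mul1r.
Qed.

(** With p s = Re (c f (s u)), where u points to z and c to f z, the bound on the
    derivative reads p' / (1 - p^2) <= 1 / (1 - s^2). Hence artanh p - artanh s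
    decreases from its value 0 at s = 0. *)
Lemma schwarz z : f 0 = 0 -> cnorm z < 1 -> cnorm (f z) <= cnorm z.
Proof.
move=> f0 z1.
have [->|fz0] := eqVneq (f z) 0; first by rewrite cnorm0 cnorm_ge0.
have z0 : z != 0 by apply: contra_neq fz0 => ->.
set r := cnorm z in z1 *.
have r0 : 0 < r by rewrite cnorm_gt0.
pose u := z / r%:C%C.
have rC : r%:C%C != 0 :> C by rewrite -normCE normr_eq0.
have u1 : cnorm u = 1.
  by rewrite /u cnormM cnormV cnorm_real ger0_norm ?ltW // divff ?gt_eqF.
have fC : (cnorm (f z))%:C%C != 0 :> C by rewrite -normCE normr_eq0.
pose c := (f z)^* / (cnorm (f z))%:C%C.
have cf : c * f z = (cnorm (f z))%:C%C.
  rewrite (_ : c * f z = (f z * (f z)^*) / (cnorm (f z))%:C%C); last by rewrite /c; ring.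
  by rewrite mulc_conj rmorphXn /=; field.
have c1 : cnorm c = 1.
  rewrite /c cnormM cnormV cnorm_conj cnorm_real ger0_norm ?cnorm_ge0 //.
  by rewrite divff // cnorm_eq0.
clearbody c.
pose p (s : R) := complex.Re (c * f (0 + s%:C%C * u)).
have su s : 0 <= s -> cnorm (0 + s%:C%C * u) = s.
  by move=> s0; rewrite add0r cnormM cnorm_real u1 mulr1 ger0_norm.
have pf s : `|p s| <= cnorm (f (0 + s%:C%C * u)).
  by rewrite (le_trans (Re_le_cnorm _)) // cnormM c1 mul1r.
have pr : p r = cnorm (f z).
  rewrite /p (_ : 0 + _ = z); last by rewrite /u; field.
  by rewrite cf.
clearbody u.
have p0 : p 0 = 0 by rewrite /p mul0r addr0 f0 mulr0.
have p1 s : 0 <= s <= r -> -1 < p s < 1.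
  move=> /andP[s0 sr]; rewrite -ltr_norml (le_lt_trans (pf s)) // f1 // su //.
  exact: le_lt_trans sr z1.
have dp s : 0 <= s <= r -> exists2 p', is_derive s 1 p p' &
    p' * (1 - s ^+ 2) <= 1 - p s ^+ 2.
  move=> sr; have /andP[s0 s1] := sr.
  have k1 : cnorm (0 + s%:C%C * u) < 1 by rewrite su // (le_lt_trans s1).
  have [d Hd] := differentiable_cderiv (df k1).
  exists (complex.Re (c * d * u)); first exact: cderiv_line.
  have := schwarz_pick_derivative k1 Hd; rewrite su // => Hle.
  have h1 : complex.Re (c * d * u) <= cnorm d.
    rewrite (le_trans (ler_norm _)) // (le_trans (Re_le_cnorm _)) //.
    by rewrite !cnormM c1 u1 mul1r mulr1.
  have s2 : 0 <= 1 - s ^+ 2 by rewrite subr_ge0 expr_le1 // ltW // (le_lt_trans s1).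
  rewrite (le_trans (ler_wpM2r s2 h1)) // (le_trans Hle) // lerD2l lerN2.
  by rewrite -(real_normK (num_real (p s))) ler_sqr ?nnegrE ?cnorm_ge0.
pose L s := (ln (1 + p s) - ln (1 - p s)) - (ln (1 + s) - ln (1 - s)).
have dL s : 0 <= s <= r -> exists2 l, is_derive s 1 L l & l <= 0.
  move=> sr; have [p' Dp Hp] := dp s sr; have /andP[s0 s1] := sr.
  have /andP[pn1 pp1] := p1 s sr.
  have Hs1 : s < 1 by exact: le_lt_trans s1 z1.
  exists (((1 + p s)^-1 * p' - (1 - p s)^-1 * (- p')) - ((1 + s)^-1 - (1 - s)^-1 * (-1))).
    apply: is_deriveB; apply: is_deriveB.
    - have h : 0 < 1 + p s by lra.
      apply: (@is_derive1_comp R (@ln R) (fun s => 1 + p s)); first exact: is_derive1_ln.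
      by rewrite -[p']add0r; apply: is_deriveD.
    - have h : 0 < 1 - p s by lra.
      apply: (@is_derive1_comp R (@ln R) (fun s => 1 - p s)); first exact: is_derive1_ln.
      by rewrite -[- p']add0r; apply: is_deriveB.
    - have h : 0 < 1 + s by lra.
      rewrite -[_^-1]mulr1.
      apply: (@is_derive1_comp R (@ln R) (fun s => 1 + s)); first exact: is_derive1_ln.
      by have := is_deriveD (is_derive_cst (1 : R) s (1 : R)) (is_derive_id s (1 : R)); rewrite add0r.
    - have h : 0 < 1 - s by lra.
      apply: (@is_derive1_comp R (@ln R) (fun s => 1 - s)); first exact: is_derive1_ln.
      by rewrite -[-1]add0r; apply: is_deriveB.
  have h1 : 1 + p s != 0 by rewrite gt_eqF //; lra.
  have h2 : 1 - p s != 0 by rewrite gt_eqF //; lra.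
  have h3 : 1 + s != 0 by rewrite gt_eqF //; lra.
  have h4 : 1 - s != 0 by rewrite gt_eqF //; lra.
  have g1 : 0 < (1 + p s) * (1 - p s) by apply: mulr_gt0; lra.
  have g2 : 0 < (1 + s) * (1 - s) by apply: mulr_gt0; lra.
  rewrite (_ : _ - _ = 2 * (p' * (1 - s ^+ 2) - (1 - p s ^+ 2)) /
    (((1 + p s) * (1 - p s)) * ((1 + s) * (1 - s)))); last by field; rewrite h1 h2 h3 h4.
  rewrite pmulr_lle0 ?invr_gt0 ?mulr_gt0 //; lra.
have [l Hl] : exists l : R -> R, forall s, 0 <= s <= r -> is_derive s 1 L (l s) /\ l s <= 0.
  have [l Hl] : {l : R -> R & forall s, 0 <= s <= r -> is_derive s 1 L (l s) /\ l s <= 0}.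
    apply: (@choice R R (fun s l => 0 <= s <= r -> is_derive s 1 L l /\ l <= 0)) => s.
    have [/dL[l ? ?]|n] := boolP (0 <= s <= r); first by exists l.
    by exists 0.
  by exists l.
have [s sr Hs] : exists2 s, s \in `[0, r]%R & L r - L 0 = l s * (r - 0).
  apply: MVT_segment => [|s|]; first exact: ltW.
    by rewrite in_itv /= => /andP[s0 s1]; have [] := Hl s; rewrite // !ltW.
  by apply: derivable_within_continuous => s; rewrite in_itv /= => /Hl[[]].
move: sr; rewrite in_itv /= => /Hl[_ ls0].
have : L r - L 0 <= 0 by rewrite Hs subr0 mulr_le0_ge0 // ltW.
rewrite {2}/L p0 addr0 subr0 !ln1 !subr0 /L pr.
set q := cnorm (f z).
have q1 : q < 1 by rewrite /q f1.
have q0 : 0 <= q by rewrite cnorm_ge0.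
rewrite subr_le0 -!ln_div ?posrE; try lra.
rewrite ler_ln ?posrE; try by apply: divr_gt0; lra.
have a1 : 0 < 1 - q by lra.
have a2 : 0 < 1 - r by lra.
rewrite ler_pdivrMr // mulrAC ler_pdivlMr //; lra.
Qed.

End SelfMap.

End SchwarzPick.

Section PoincareDistance.
Context {R : realType}.
Local Notation C := (Cplx R).
Implicit Types (x y : R) (z w a : C).

(** Reduction to f 0 = 0 by Moebius maps on both sides. *)
Theorem schwarz_pick (f : C -> C) z w :
  (forall z, cnorm z < 1 -> differentiable f z) ->
  (forall z, cnorm z < 1 -> cnorm (f z) < 1) ->
  cnorm z < 1 -> cnorm w < 1 ->
  cnorm (mobius (f w) (f z)) <= cnorm (mobius w z).
Proof.
move=> df f1 z1 w1; have nw1 : cnorm (- w) < 1 by rewrite cnormN.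
have m0 : mobius (- w) 0 = w by rewrite /mobius mulr0 subr0 divr1 opprK add0r.
pose g := mobius (f w) \o (f \o mobius (- w)).
have dg (t : C) : cnorm t < 1 -> differentiable g t.
  move=> t1; have mt := mobius_disc nw1 t1.
  apply: differentiable_comp; last first.
    by apply: differentiable_mobius; exact: f1.
  by apply: differentiable_comp; [exact: differentiable_mobius|exact: df].
have g1 (t : C) : cnorm t < 1 -> cnorm (g t) < 1.
  by move=> t1; rewrite mobius_disc // f1 // mobius_disc.
have g0 : g 0 = 0 by rewrite /g /= m0 mobius0.
by have := schwarz dg g1 g0 (mobius_disc w1 z1); rewrite /g /= mobiusK.
Qed.

(** * The hyperbolic distance of the disc *)

Definition artanh x : R := 2^-1 * ln ((1 + x) / (1 - x)).

Lemma poincareE z w : poincare z w = artanh (cnorm (mobius w z)).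
Proof. by []. Qed.

Lemma artanh_le x y : 0 <= x -> x <= y -> y < 1 -> artanh x <= artanh y.
Proof.
move=> x0 xy y1; have hx : 0 < 1 - x by lra.
have hy : 0 < 1 - y by lra.
rewrite /artanh ler_wpM2l ?invr_ge0 // ler_ln ?posrE; try by apply: divr_gt0; lra.
by rewrite ler_pdivrMr // mulrAC ler_pdivlMr //; lra.
Qed.

Lemma artanh0 : artanh 0 = 0.
Proof. by rewrite /artanh addr0 subr0 divr1 ln1 mulr0. Qed.

Lemma artanhD x y : 0 <= x < 1 -> 0 <= y < 1 ->
  artanh x + artanh y = artanh ((x + y) / (1 + x * y)).
Proof.
move=> /andP[x0 x1] /andP[y0 y1].
have h1 : 0 < 1 - x by lra.
have h2 : 0 < 1 - y by lra.
have h3 : 0 < 1 + x by lra.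
have h4 : 0 < 1 + y by lra.
have h5 : 0 < 1 + x * y by rewrite ltr_wpDr ?mulr_ge0.
rewrite /artanh -mulrDr -lnM ?posrE ?divr_gt0 //; congr (_ * ln _).
have -> : 1 + (x + y) / (1 + x * y) = (1 + x) * (1 + y) / (1 + x * y).
  by field; rewrite gt_eqF.
have -> : 1 - (x + y) / (1 + x * y) = (1 - x) * (1 - y) / (1 + x * y).
  by field; rewrite gt_eqF.
by field; rewrite !gt_eqF.
Qed.

Lemma cnorm_mobiusC z w : cnorm (mobius z w) = cnorm (mobius w z).
Proof.
rewrite /mobius !cnormM !cnormV cnormB; congr (_ / _).
by rewrite -cnorm_conj rmorphB rmorphM rmorph1 /= conjCK mulrC.
Qed.

Lemma poincareC z w : poincare z w = poincare w z.
Proof. by rewrite !poincareE cnorm_mobiusC. Qed.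

(** When the middle point y is moved to 0, the other two are at distances |p| and
    |q| from it, and |1 - q^* p| <= 1 + |p| |q| is the addition formula of artanh. *)
Lemma poincare_triangle (x y z : C) : cnorm x < 1 -> cnorm y < 1 -> cnorm z < 1 ->
  poincare x z <= poincare x y + poincare y z.
Proof.
move=> x1 y1 z1; rewrite !poincareE.
have ny1 : cnorm (- y) < 1 by rewrite cnormN.
pose p := mobius y x; pose q := mobius y z.
have p1 : cnorm p < 1 by exact: mobius_disc.
have q1 : cnorm q < 1 by exact: mobius_disc.
have p0 : 0 <= cnorm p by exact: cnorm_ge0.
have q0 : 0 <= cnorm q by exact: cnorm_ge0.
have -> : cnorm (mobius z y) = cnorm q by rewrite cnorm_mobiusC.
rewrite artanhD ?p0 ?q0 //; apply: artanh_le; rewrite ?cnorm_ge0 //; last first.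
  by rewrite ltr_pdivrMr ?mul1r; nra.
have := @schwarz_pick (mobius (- y)) p q (fun t => differentiable_mobius ny1)
  (fun t => mobius_disc ny1) p1 q1.
rewrite /p /q !mobiusK // -/p -/q => /le_trans; apply.
have d0 : 0 < 1 + cnorm p * cnorm q by nra.
rewrite -(ler_pXn2r (n := 2)) ?nnegrE ?cnorm_ge0 ?divr_ge0 ?addr_ge0 ?mulr_ge0 //.
have -> : ((cnorm p + cnorm q) / (1 + cnorm p * cnorm q)) ^+ 2 =
    1 - (1 - cnorm q ^+ 2) * (1 - cnorm p ^+ 2) / (1 + cnorm p * cnorm q) ^+ 2.
  by field; rewrite gt_eqF.
rewrite -[X in X <= _](subKr 1) (cnorm_mobius q1 (ltW p1)) lerD2l lerN2.
have n0 := mobius_den_neq0 q1 (ltW p1).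
apply: ler_wpM2l; first by rewrite mulr_ge0 ?subr_ge0 ?expr_le1 // ltW.
rewrite lef_pV2 ?posrE ?exprn_gt0 ?cnorm_gt0 //.
rewrite ler_sqr ?nnegrE ?cnorm_ge0 ?(ltW d0) // (le_trans (cnormD _ _)) //.
by rewrite cnorm1 cnormN cnormM cnorm_conj mulrC.
Qed.
End PoincareDistance.

(** * The Hermitian form and the complex slices of the ball *)

Section Ball.
Context {R : realType}.
Local Notation C := (Cplx R).

Definition herm n (z w : 'rV[C]_n) : C := \sum_i z 0 i * (w 0 i)^*.

Lemma cconjM (z w : C) : (z * w)^* = z^* * w^*. Proof. exact: rmorphM. Qed.
Lemma cconjD (z w : C) : (z + w)^* = z^* + w^*. Proof. exact: rmorphD. Qed.
Lemma cconjB (z w : C) : (z - w)^* = z^* - w^*. Proof. exact: rmorphB. Qed.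
Lemma cconj_real (x : R) : (x%:C%C : C)^* = x%:C%C. Proof. exact: conjc_real. Qed.
Lemma real_complexM (x y : R) : ((x * y)%:C%C : C) = x%:C%C * y%:C%C.
Proof. exact: rmorphM. Qed.
Lemma real_complexB (x y : R) : ((x - y)%:C%C : C) = x%:C%C - y%:C%C.
Proof. exact: rmorphB. Qed.
Lemma real_complexX (x : R) k : ((x ^+ k)%:C%C : C) = x%:C%C ^+ k.
Proof. exact: rmorphXn. Qed.
Lemma real_complexV (x : R) : ((x^-1)%:C%C : C) = (x%:C%C)^-1.
Proof. exact: fmorphV. Qed.

Section Herm.
Variable n : nat.
Implicit Types (x y z w : 'rV[C]_n) (k : C).

Lemma hermDl x y z : herm (x + y) z = herm x z + herm y z.
Proof. by rewrite /herm -big_split; apply: eq_bigr => i _; rewrite mxE mulrDl. Qed.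

Lemma hermZl k x z : herm (k *: x) z = k * herm x z.
Proof. by rewrite /herm mulr_sumr; apply: eq_bigr => i _; rewrite mxE mulrA. Qed.

Lemma herm_conj x y : herm y x = (herm x y)^*.
Proof. 
rewrite /herm rmorph_sum; apply: eq_bigr => i _.
by rewrite rmorphM /= conjCK mulrC.
Qed.

Lemma hermBl x y z : herm (x - y) z = herm x z - herm y z.
Proof. by rewrite -scaleN1r hermDl hermZl mulN1r. Qed.

Lemma hermDr x y z : herm x (y + z) = herm x y + herm x z.
Proof. by rewrite herm_conj hermDl rmorphD /= -!herm_conj. Qed.

Lemma hermBr x y z : herm x (y - z) = herm x y - herm x z.
Proof. by rewrite herm_conj hermBl rmorphB /= -!herm_conj. Qed.

Lemma hermZr k x z : herm x (k *: z) = k^* * herm x z.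
Proof. by rewrite herm_conj hermZl rmorphM /= -herm_conj. Qed.

Lemma enorm_ge0 x : 0 <= enorm x. Proof. exact: sqrtr_ge0. Qed.

Lemma sqr_enorm x : enorm x ^+ 2 = \sum_i cnorm (x 0 i) ^+ 2.
Proof. by rewrite sqr_sqrtr // sumr_ge0 // => i _; rewrite sqr_ge0. Qed.

Lemma hermxx x : herm x x = (enorm x ^+ 2)%:C%C.
Proof.
by rewrite sqr_enorm rmorph_sum; apply: eq_bigr => i _; rewrite mulc_conj.
Qed.

Lemma Re_hermxx x : complex.Re (herm x x) = enorm x ^+ 2.
Proof. by rewrite hermxx. Qed.

Lemma enorm_eq0 x : enorm x = 0 -> x = 0.
Proof.
move=> h; have : enorm x ^+ 2 == 0 by rewrite h expr0n.
rewrite sqr_enorm psumr_eq0 => [/allP H|i _]; last exact: sqr_ge0.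
apply/rowP => i; rewrite mxE; apply/eqP.
by have := H i (mem_index_enum i); rewrite expf_eq0 /= cnorm_eq0.
Qed.

Lemma enormZ k x : enorm (k *: x) = cnorm k * enorm x.
Proof.
apply/eqP; rewrite -(eqrXn2 (n := 2)) ?enorm_ge0 ?mulr_ge0 ?cnorm_ge0 ?enorm_ge0 //.
rewrite exprMn !sqr_enorm mulr_sumr; apply/eqP/eq_bigr => i _.
by rewrite mxE cnormM exprMn.
Qed.

Lemma enorm0 : enorm (0 : 'rV[C]_n) = 0.
Proof. by rewrite -[0](scale0r (0 : 'rV[C]_n)) enormZ cnorm0 mul0r. Qed.

(** Weaker than the Cauchy-Schwarz inequality, but enough to keep 1 - herm x y
    away from 0. *)
Lemma cnorm_herm_le x y : cnorm (herm x y) <= (enorm x ^+ 2 + enorm y ^+ 2) / 2.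
Proof.
have tri (s : seq 'I_n) (F : 'I_n -> C) : cnorm (\sum_(i <- s) F i) <= \sum_(i <- s) cnorm (F i).
  elim: s => [|i s IH]; first by rewrite !big_nil cnorm0.
  by rewrite !big_cons (le_trans (cnormD _ _)) // lerD2l.
rewrite (le_trans (tri _ _)) // !sqr_enorm -big_split /= mulr_suml ler_sum // => i _.
rewrite cnormM cnorm_conj ler_pdivlMr //.
have := sqr_ge0 (cnorm (x 0 i) - cnorm (y 0 i)); lra.
Qed.

Lemma herm_den_neq0 x y : enorm x < 1 -> enorm y <= 1 -> 1 - herm x y != 0.
Proof.
move=> x1 y1; rewrite subr_eq0; apply/eqP => /(congr1 (@cnorm R)).
rewrite cnorm1 => h; have := cnorm_herm_le x y; rewrite -h.
have : enorm x ^+ 2 < 1 by rewrite expr_lt1 ?enorm_ge0.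
have : enorm y ^+ 2 <= 1 by rewrite expr_le1 ?enorm_ge0.
lra.
Qed.

Lemma differentiable_herm y x : differentiable (fun z : 'rV[C]_n => herm z y) x.
Proof.
have -> : (fun z : 'rV[C]_n => herm z y) = \sum_(i < n) (fun x : 'rV[C]_n => x 0 i * (y 0 i)^*).
  by apply/funext => z; rewrite fct_sumE.
apply: differentiable_sum => i; apply: differentiableM => //.
exact: differentiable_coord.
Qed.

(** The squared pseudo-hyperbolic distance of the ball. *)
Definition sqr_rho x y : R :=
  1 - (1 - enorm x ^+ 2) * (1 - enorm y ^+ 2) / cnorm (1 - herm x y) ^+ 2.
End Herm.

Section Slice.
Variable n : nat.
Implicit Types (x y z : 'rV[C]_n) (l m : C).

(** For c orthogonal to the unit vector v, the complex line c + C v meets the ball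
    in a disc of radius r = sqrt (1 - |c|^2). *)
Definition slice (c v : 'rV[C]_n) (r : R) l : 'rV[C]_n := c + (r%:C%C * l) *: v.
(** A left inverse of slice that is holomorphic on the whole ball. It makes slices
    complex geodesics, without any use of automorphisms of the ball. *)
Definition slice_inv (c v : 'rV[C]_n) (r : R) z : C := r%:C%C * herm z v / (1 - herm z c).

Definition slice_data (c v : 'rV[C]_n) r :=
  [/\ 0 < r, r ^+ 2 = 1 - enorm c ^+ 2, enorm v = 1 & herm v c = 0].

Section Data.
Variables (c v : 'rV[C]_n) (r : R).
Hypothesis H : slice_data c v r.

Lemma herm_slice l m :
  1 - herm (slice c v r l) (slice c v r m) = (r ^+ 2)%:C%C * (1 - l * m^*).
Proof.
have [r0 rc v1 vc] := H.
have cv : herm c v = 0 by rewrite herm_conj vc rmorph0.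
rewrite /slice !(hermDl, hermDr, hermZl, hermZr) cv vc !hermxx v1 cconjM cconj_real.
have -> : (enorm c ^+ 2)%:C%C = 1 - (r ^+ 2)%:C%C :> C.
  by rewrite rc real_complexB subKr.
by rewrite expr1n !real_complexX; ring.
Qed.

Lemma enorm_slice l : 1 - enorm (slice c v r l) ^+ 2 = r ^+ 2 * (1 - cnorm l ^+ 2).
Proof.
have := herm_slice l l; rewrite hermxx mulc_conj => /(congr1 (@complex.Re R)).
by rewrite -[X in X - _](real_complexX 1 0) -!real_complexB -real_complexM.
Qed.

Lemma slice_ball l : (enorm (slice c v r l) < 1) = (cnorm l < 1).
Proof.
have [r0 _ _ _] := H.
by rewrite -subr_sqr_gt0 ?enorm_ge0 // enorm_slice pmulr_rgt0 ?exprn_gt0 //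
  subr_sqr_gt0 // cnorm_ge0.
Qed.

Lemma sqr_rho_slice l m : cnorm l < 1 -> cnorm m < 1 ->
  sqr_rho (slice c v r l) (slice c v r m) = cnorm (mobius m l) ^+ 2.
Proof.
move=> l1 m1; have [r0 _ _ _] := H.
rewrite /sqr_rho !enorm_slice herm_slice -[RHS](subKr 1) (cnorm_mobius m1 (ltW l1)).
have := mobius_den_neq0 m1 (ltW l1); rewrite -cnorm_eq0 => n0.
rewrite cnormM cnorm_real normrX gtr0_norm // (mulrC l).
by congr (1 - _); field; rewrite n0 gt_eqF.
Qed.

Lemma sliceK l : slice_inv c v r (slice c v r l) = l.
Proof.
have [r0 rc v1 vc] := H.
have cv : herm c v = 0 by rewrite herm_conj vc rmorph0.
rewrite /slice_inv /slice !(hermDl, hermZl) cv vc !hermxx v1 mulr0 addr0.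
have -> : 1 - (enorm c ^+ 2)%:C%C = (r ^+ 2)%:C%C :> C.
  by rewrite rc real_complexB.
have rC : r%:C%C != 0 :> C by rewrite -cnorm_gt0 cnorm_real normr_gt0 gt_eqF.
by rewrite expr1n real_complexX; field.
Qed.

(** With a = herm z c and b = herm z v, Bessel's inequality bounds |b|^2 by
    |z|^2 - |a|^2 / |c|^2 when c is not 0, and the claim becomes |a - |c|^2|^2 >= 0. *)
Lemma slice_inv_disc z : enorm z < 1 -> cnorm (slice_inv c v r z) < 1.
Proof.
move=> z1; have [r0 rc v1 vc] := H.
have cv : herm c v = 0 by rewrite herm_conj vc rmorph0.
have c1 : enorm c < 1.
  by rewrite -subr_sqr_gt0 ?enorm_ge0 // -rc exprn_gt0.
have n0 := herm_den_neq0 z1 (ltW c1).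
rewrite /slice_inv cnormM cnormV ltr_pdivrMr ?cnorm_gt0 // mul1r.
rewrite -(ltr_pXn2r (n := 2)) ?nnegrE ?cnorm_ge0 // cnormM exprMn cnorm_real.
rewrite real_normK ?num_real // rc.
set b := herm z v; set a := herm z c.
(* Bessel's inequality for the orthogonal vectors v and c *)
have bessel (t : C) :
    cnorm b ^+ 2 <= enorm z ^+ 2 - 2 * complex.Re (t^* * a) + cnorm t ^+ 2 * enorm c ^+ 2.
  rewrite -subr_ge0 -[X in 0 <= X](_ : enorm (z - b *: v - t *: c) ^+ 2 = _); first exact: sqr_ge0.
  rewrite -Re_hermxx !(hermBl, hermBr, hermZl, hermZr) cv vc !hermxx v1.
  have -> : herm v z = b^* by rewrite herm_conj.
  have -> : herm c z = a^* by rewrite herm_conj.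
  rewrite -/a -/b !sqr_cnorm expr1n.
  by case: (a) => a1 a2; case: (b) => b1 b2; case: (t) => t1 t2 /=; ring.
have z2 : enorm z ^+ 2 < 1 by rewrite expr_lt1 ?enorm_ge0.
have [c0|c0] := eqVneq (enorm c) 0.
  have a0 : a = 0.
    by rewrite /a (enorm_eq0 c0) -[0](scale0r c) hermZr rmorph0 mul0r.
  have := bessel 0; rewrite a0 c0 subr0 cnorm1 cnorm0 expr1n mulr0.
  by rewrite (_ : complex.Re (0 : C) = 0) // (_ : 0 ^+ 2 = 0 :> R) ?expr0n //; lra.
have c2 : 0 < enorm c ^+ 2 by rewrite exprn_gt0 // lt_def c0 enorm_ge0.
have c21 : enorm c ^+ 2 < 1 by rewrite expr_lt1 ?enorm_ge0.
have := bessel (a / (enorm c ^+ 2)%:C%C).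
rewrite cnormM cnormV cnorm_real (gtr0_norm c2) cconjM -real_complexV cconj_real.
set s := enorm c ^+ 2 in c2 c21 *.
have -> : a^* * (s^-1)%:C%C * a = (s^-1 * cnorm a ^+ 2)%:C%C.
  rewrite real_complexM -mulc_conj; ring.
rewrite [complex.Re _]/= exprMn => Hb.
have {}Hb : cnorm b ^+ 2 <= enorm z ^+ 2 - cnorm a ^+ 2 / s.
  rewrite (le_trans Hb) // le_eqVlt; apply/orP; left; apply/eqP.
  by field; rewrite gt_eqF.
have : (1 - s) * cnorm b ^+ 2 <= (1 - s) * (enorm z ^+ 2 - cnorm a ^+ 2 / s).
  by rewrite ler_wpM2l // subr_ge0 ltW.
move/le_lt_trans; apply.
have : (1 - s) * (enorm z ^+ 2 - cnorm a ^+ 2 / s) < (1 - s) * (1 - cnorm a ^+ 2 / s).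
  by rewrite ltr_pM2l ?subr_gt0 // ltrD2r.
move/lt_le_trans; apply.
have -> : cnorm (1 - a) ^+ 2 = 1 - 2 * complex.Re a + cnorm a ^+ 2.
  by rewrite !sqr_cnorm; case: (a) => a1 a2 /=; ring.
have : 0 <= (cnorm (a - s%:C%C)) ^+ 2 / s by rewrite divr_ge0 ?sqr_ge0 // ltW.
have -> : cnorm (a - s%:C%C) ^+ 2 = cnorm a ^+ 2 - 2 * s * complex.Re a + s ^+ 2.
  by rewrite !sqr_cnorm; case: (a) => a1 a2 /=; ring.
have -> : (cnorm a ^+ 2 - 2 * s * complex.Re a + s ^+ 2) / s =
  cnorm a ^+ 2 / s - 2 * complex.Re a + s by field; rewrite gt_eqF.
have -> : (1 - s) * (1 - cnorm a ^+ 2 / s) = 1 - cnorm a ^+ 2 / s - s + cnorm a ^+ 2.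
  by field; rewrite gt_eqF.
lra.
Qed.

Lemma differentiable_slice l : differentiable (slice c v r) l.
Proof.
apply: differentiableD => //; apply: differentiableZl.
exact: differentiableM.
Qed.

Lemma differentiable_slice_inv z : enorm z < 1 -> differentiable (slice_inv c v r) z.
Proof.
move=> z1; have [r0 rc v1 vc] := H.
have c1 : enorm c < 1.
  by rewrite -subr_sqr_gt0 ?enorm_ge0 // -rc exprn_gt0.
apply: differentiableM.
  by apply: differentiableM => //; exact: differentiable_herm.
apply: differentiableV; last exact: herm_den_neq0 (ltW c1).
by apply: differentiableB => //; exact: differentiable_herm.
Qed.
End Data.
End Slice.
End Ball.

(** * The Kobayashi distance of the ball *)

Section KobayashiBall.
Context {R : realType}.
Local Notation C := (Cplx R).
Variable n : nat.
Implicit Types (x y z w : 'rV[C]_n.+1) (l m : C).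

(** c is the point closest to 0 on the complex line through x and y; for x = y any
    direction v will do. *)
Lemma exists_slice x y : enorm x < 1 -> enorm y < 1 ->
  exists c v r l m, [/\ slice_data c v r, cnorm l < 1, cnorm m < 1,
    x = slice c v r l & y = slice c v r m].
Proof.
move=> x1 y1.
have [v [v1 [k yE]]] : exists v : 'rV[C]_n.+1, enorm v = 1 /\ exists k : C, y = x + k *: v.
  have [->|xy] := eqVneq y x.
    exists (delta_mx 0 0); split; last by exists 0; rewrite scale0r addr0.
    apply/eqP; rewrite -(eqrXn2 (n := 2)) ?enorm_ge0 // sqr_enorm (bigD1 ord0) //=.
    rewrite big1 => [|i i0]; last by rewrite mxE (negPf i0) cnorm0 expr0n.
    by rewrite mxE !eqxx cnorm1 addr0 expr1n.
  have d0 : 0 < enorm (y - x).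
    rewrite lt_def enorm_ge0 andbT; apply: contra_neq xy => /enorm_eq0 /subr0_eq //.
  exists ((((enorm (y - x))^-1)%:C%C : C) *: (y - x)); split.
    by rewrite enormZ cnorm_real ger0_norm ?invr_ge0 ?(ltW d0) // mulVf // gt_eqF.
  exists ((enorm (y - x))%:C%C); rewrite scalerA -real_complexM divff ?gt_eqF //.
  by rewrite scale1r addrC subrK.
pose k0 := herm x v; pose c := x - k0 *: v.
have vc : herm v c = 0.
  rewrite /c hermBr hermZr hermxx v1 expr1n mulr1 /k0.
  by rewrite (herm_conj x v) subrr.
have xE : x = c + k0 *: v by rewrite /c subrK.
clearbody c k0.
have xc : enorm x ^+ 2 = enorm c ^+ 2 + cnorm k0 ^+ 2.
  have cv : herm c v = 0 by rewrite herm_conj vc rmorph0.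
  rewrite xE -[LHS]Re_hermxx !(hermDl, hermDr, hermZl, hermZr) cv vc !hermxx v1.
  by rewrite !mulr0 addr0 add0r expr1n mulr1 mulc_conj.
have x2 : enorm x ^+ 2 < 1 by rewrite expr_lt1 ?enorm_ge0.
have c2 : 0 < 1 - enorm c ^+ 2 by have := sqr_ge0 (cnorm k0); lra.
pose r := Num.sqrt (1 - enorm c ^+ 2).
have r0 : 0 < r by rewrite sqrtr_gt0.
have rC : r%:C%C != 0 :> C by rewrite -cnorm_gt0 cnorm_real normr_gt0 gt_eqF.
have sd : slice_data c v r by split => //; rewrite sqr_sqrtr // ltW.
have xs : x = slice c v r (k0 / r%:C%C).
  by rewrite /slice (mulrC r%:C%C) divfK // -xE.
have ys : y = slice c v r ((k0 + k) / r%:C%C).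
  by rewrite yE {1}xE -addrA -scalerDl /slice (mulrC r%:C%C) divfK.
exists c, v, r, (k0 / r%:C%C), ((k0 + k) / r%:C%C); split => //.
  by rewrite -(slice_ball sd) -xs.
by rewrite -(slice_ball sd) -ys.
Qed.

(** Schwarz-Pick on each disc of the chain, and the triangle inequality. *)
Lemma disc_chain_contract (u : 'rV[C]_n.+1 -> C) x y s :
  (forall z, enorm z < 1 -> differentiable u z) ->
  (forall z, enorm z < 1 -> cnorm (u z) < 1) ->
  disc_chain (unit_ball n.+1) x y s -> enorm y < 1 ->
  enorm x < 1 /\ poincare (u x) (u y) <= s.
Proof.
move=> du u1; elim=> [z z1|phi a b w s' [dphi phiB] a1 b1 _ IH w1].
  by split=> //; rewrite poincareE mobius0 cnorm0 artanh0.
have [p1 IHw] := IH w1.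
have B t : cnorm t < 1 -> enorm (phi t) < 1.
  by move=> t1; apply: (phiB (phi t)); exists t.
split; first exact: B.
rewrite (le_trans (poincare_triangle (u1 _ (B _ a1)) (u1 _ p1) (u1 _ w1))) // lerD //.
rewrite !poincareE; apply: artanh_le; first exact: cnorm_ge0.
  apply: (@schwarz_pick R (u \o phi)) => // t t1.
    by apply: differentiable_comp; [exact: dphi|apply: du; exact: B].
  by apply: u1; exact: B.
exact: mobius_disc.
Qed.

Definition ball_dist x y : R := artanh (Num.sqrt (sqr_rho x y)).

Lemma ball_dist_slice c v r l m : slice_data c v r -> cnorm l < 1 -> cnorm m < 1 ->
  ball_dist (slice c v r l) (slice c v r m) = poincare l m.
Proof.
move=> H l1 m1; rewrite /ball_dist (sqr_rho_slice H l1 m1).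
by rewrite sqrtr_sqr ger0_norm ?cnorm_ge0.
Qed.

(** The slice through x and y is a chain of one disc; composing with its left
    inverse shows that no chain is shorter. *)
Theorem kobayashi_ball x y : enorm x < 1 -> enorm y < 1 ->
  kobayashi (unit_ball n.+1) x y = (ball_dist x y)%:E.
Proof.
move=> x1 y1; have [c [v [r [l [m [H l1 m1 -> ->]]]]]] := exists_slice x1 y1.
rewrite (ball_dist_slice H l1 m1); apply/eqP; rewrite eq_le; apply/andP; split.
  have hd : holomorphic_disc (unit_ball n.+1) (slice c v r).
    split; first by move=> t _; exact: differentiable_slice.
    by move=> _ [t t1 <-]; rewrite /unit_ball /= (slice_ball H).
  have ch := disc_chain_cons hd l1 m1 (disc_chain_nil (unit_ball n.+1) (slice c v r m)).
  apply: ereal_inf_lbound; exists (poincare l m + 0); first exact: ch.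
  by rewrite addr0.
apply: le_ereal_inf_tmp => _ [s hs <-]; rewrite lee_fin.
have ym : enorm (slice c v r m) < 1 by rewrite (slice_ball H).
have [_] := disc_chain_contract (differentiable_slice_inv H) (slice_inv_disc H) hs ym.
by rewrite !(sliceK H).
Qed.

Lemma sqr_rho_itv x y : enorm x < 1 -> enorm y < 1 -> 0 <= sqr_rho x y < 1.
Proof.
move=> x1 y1; have [c [v [r [l [m [H l1 m1 -> ->]]]]]] := exists_slice x1 y1.
rewrite (sqr_rho_slice H l1 m1) sqr_ge0 expr_lt1 ?cnorm_ge0 //.
exact: mobius_disc.
Qed.

Lemma ball_distxx x : enorm x < 1 -> ball_dist x x = 0.
Proof.
move=> x1; have [c [v [r [l [m [H l1 m1 -> _]]]]]] := exists_slice x1 x1.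
by rewrite (ball_dist_slice H l1 l1) poincareE mobius0 cnorm0 artanh0.
Qed.

(** That is e^(2 artanh r) = (1 + r) / (1 - r), multiplied by 1 - r^2. *)
Lemma expR_ball_dist x y : enorm x < 1 -> enorm y < 1 ->
  expR (2 * ball_dist x y) * (1 - sqr_rho x y) = (1 + Num.sqrt (sqr_rho x y)) ^+ 2.
Proof.
move=> x1 y1; have /andP[s0 s1] := sqr_rho_itv x1 y1.
have q0 := sqrtr_ge0 (sqr_rho x y).
have qE := sqr_sqrtr s0.
have q1 : Num.sqrt (sqr_rho x y) < 1.
  by rewrite -(expr_lt1 (n := 2)) // qE.
rewrite /ball_dist /artanh mulrA divff // mul1r lnK; last by rewrite posrE divr_gt0; lra.
set q := Num.sqrt (sqr_rho x y) in q0 q1 qE *; rewrite -qE; field; lra.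
Qed.
End KobayashiBall.

(** * Length-minimising curves in the ball *)

Section Geodesics.
Context {R : realType}.
Local Notation C := (Cplx R).
Variable n : nat.
Local Notation V := 'rV[C]_n.+1.
Local Notation B := (@unit_ball R n.+1).
Implicit Types (x y z w : V) (g h : R -> V).

Lemma disc_chain_holomorphic (f : V -> V) x y s :
  holomorphic_on B f -> (forall z, enorm z < 1 -> enorm (f z) < 1) ->
  disc_chain B x y s -> disc_chain B (f x) (f y) s.
Proof.
move=> df fB; elim=> [z|phi a b w s' [dphi phiB] a1 b1 _ IH].
  exact: disc_chain_nil.
apply: (@disc_chain_cons _ _ _ (f \o phi)) => //; split.
  move=> t t1; apply: differentiable_comp; first exact: dphi.
  by apply: df; apply: phiB; exists t.
by move=> _ [t t1 <-]; apply: fB; apply: (phiB (phi t)); exists t.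
Qed.

Lemma ball_dist_holomorphic (f : V -> V) x y :
  holomorphic_on B f -> (forall z, enorm z < 1 -> enorm (f z) < 1) ->
  enorm x < 1 -> enorm y < 1 -> ball_dist (f x) (f y) <= ball_dist x y.
Proof.
move=> df fB x1 y1; rewrite -lee_fin -!kobayashi_ball ?fB //.
apply: le_ereal_inf_tmp => _ [s hs <-]; apply: ereal_inf_lbound.
by exists s => //; exact: disc_chain_holomorphic.
Qed.

Lemma kobayashi_length_le g (tau : R -> R) s t : s <= t ->
  (forall r, s <= r <= t -> enorm (g r) < 1) ->
  (forall p q, s <= p -> p <= q -> q <= t -> ball_dist (g p) (g q) <= tau q - tau p) ->
  (kobayashi_length B g s t <= (tau t - tau s)%:E)%E.
Proof.
move=> st gB H; apply: ge_ereal_sup => _ [x + <-].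
elim: x s st gB H => [|y x IH] s st gB H hx.
  by rewrite /= big_nil (itv_partition_nil hx) subrr.
have hy := itv_partition_cons hx; have yt := itv_partition_le hy.
have sy : s < y by move: hx => -[/= /andP[]].
have sy' := ltW sy.
rewrite /= big_cons /= kobayashi_ball ?gB ?lexx ?sy' ?yt //.
have -> : tau t - tau s = (tau y - tau s) + (tau t - tau y) by ring.
rewrite EFinD leeD ?lee_fin ?H //.
apply: IH => // [r /andP[yr rt]|p q yp pq qt].
  by rewrite gB // rt (le_trans sy').
by apply: H => //; exact: le_trans sy' yp.
Qed.

Lemma kobayashi_length_ge1 g s t : s <= t ->
  enorm (g s) < 1 -> enorm (g t) < 1 ->
  ((ball_dist (g s) (g t))%:E <= kobayashi_length B g s t)%E.
Proof.
rewrite le_eqVlt => /predU1P[<-|st] gs gt.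
  rewrite ball_distxx //; apply: ereal_sup_ubound; exists [::] => /=.
    by split.
  by rewrite big_nil.
rewrite -kobayashi_ball //; apply: ereal_sup_ubound; exists [:: t].
  exact: itv_partition1.
by rewrite /= big_cons big_nil /= adde0.
Qed.

Lemma kobayashi_length_ge2 g s t u : s < t -> t < u ->
  enorm (g s) < 1 -> enorm (g t) < 1 -> enorm (g u) < 1 ->
  ((ball_dist (g s) (g t) + ball_dist (g t) (g u))%:E <= kobayashi_length B g s u)%E.
Proof.
move=> st tu gs gt gu; rewrite EFinD -!kobayashi_ball //.
apply: ereal_sup_ubound; exists [:: t; u]; first by split; rewrite /= ?st ?tu.
by rewrite /= !big_cons big_nil /= adde0.
Qed.

Lemma continuous_real_complex : continuous (fun t : R => t%:C%C : C).
Proof.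
move=> t A /nbhs_cnorm[r r0 H]; apply/nbhs_normP; exists r => // s /=.
by rewrite distrC => st; apply: H; rewrite -real_complexB cnorm_real.
Qed.

Lemma poincare_ray (w : C) a b : cnorm w = 1 -> 0 <= a -> a <= b -> b < 1 ->
  poincare (a%:C%C * w) (b%:C%C * w) = artanh b - artanh a.
Proof.
move=> w1 a0 ab b1; have ab1 : 0 < 1 - a * b by nra.
have E : cnorm (mobius (b%:C%C * w) (a%:C%C * w)) = (b - a) / (1 - a * b).
  rewrite /mobius cnormM cnormV -mulrBl cnormM w1 mulr1 -real_complexB cnorm_real.
  rewrite distrC ger0_norm ?subr_ge0 //.
  have -> : 1 - (b%:C%C * w)^* * (a%:C%C * w) = (1 - a * b)%:C%C.
    rewrite cconjM cconj_real.
    have -> : b%:C%C * w^* * (a%:C%C * w) = (b%:C%C * a%:C%C) * (w * w^*) by ring.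
    by rewrite mulc_conj w1 expr1n mulr1 -real_complexM real_complexB mulrC.
  by rewrite cnorm_real gtr0_norm.
rewrite poincareE E; apply/eqP; rewrite eq_sym subr_eq; apply/eqP.
have a1 : a < 1 by exact: le_lt_trans b1.
have q0 : 0 <= (b - a) / (1 - a * b) by rewrite divr_ge0 ?subr_ge0 // ltW // -subr_gt0.
have q1 : (b - a) / (1 - a * b) < 1 by rewrite ltr_pdivrMr // mul1r; nra.
rewrite artanhD ?q0 ?a0 //; congr artanh; field.
apply/andP; split; rewrite gt_eqF //; nra.
Qed.

(** A radius of the disc, moved into the slice through x and y: the hyperbolic
    distances along it add up, so its length is the distance of its ends. *)
Lemma exists_minimizing_curve x y : enorm x < 1 -> enorm y < 1 ->
  exists (T : R) h, [/\ 0 <= T, curve_in B `[0, T]%R h, h 0 = x, h T = y &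
    (kobayashi_length B h 0 T <= (ball_dist x y)%:E)%E].
Proof.
move=> x1 y1; have [c [v [r [l [m [H l1 m1 xE yE]]]]]] := exists_slice x1 y1.
pose k := mobius l m; have k1 : cnorm k < 1 by exact: mobius_disc.
have [w w1 kE] : exists2 w : C, cnorm w = 1 & k = (cnorm k)%:C%C * w.
  have [->|k0] := eqVneq k 0; first by exists 1; rewrite ?cnorm1 // cnorm0 mul0r.
  have kC : (cnorm k)%:C%C != 0 :> C by rewrite -normCE normr_eq0.
  exists (k / (cnorm k)%:C%C); last by rewrite mulrC divfK.
  by rewrite cnormM cnormV cnorm_real ger0_norm ?cnorm_ge0 // divff // cnorm_eq0.
have nl1 : cnorm (- l) < 1 by rewrite cnormN.
pose h t := slice c v r (mobius (- l) (t%:C%C * w)).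
have disc t : 0 <= t <= cnorm k -> cnorm (t%:C%C * w) < 1.
  move=> /andP[t0 tk]; rewrite cnormM w1 mulr1 cnorm_real ger0_norm //.
  exact: le_lt_trans tk k1.
have hB t : 0 <= t <= cnorm k -> enorm (h t) < 1.
  by move=> /disc tk; rewrite (slice_ball H) mobius_disc.
exists (cnorm k), h; split.
- exact: cnorm_ge0.
- split; last first.
    by move=> _ [t + <-]; rewrite /= in_itv /= => /hB.
  apply: continuous_in_subspaceT => t; rewrite inE /= in_itv /= => tk.
  pose hC : C -> V := slice c v r \o (mobius (- l) \o (fun z : C => z * w)).
  rewrite (_ : h = hC \o (fun t : R => t%:C%C : C)) //.
  apply: continuous_comp; first exact: continuous_real_complex.
  apply: differentiable_continuous.
  apply: differentiable_comp; last exact: differentiable_slice.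
  apply: differentiable_comp; first exact: differentiableM.
  by apply: differentiable_mobius => //; exact: disc.
- by rewrite /h mul0r /mobius mulr0 subr0 divr1 opprK add0r -xE.
- by rewrite /h -kE /k mobiusK.
- have -> : ball_dist x y = artanh (cnorm k) - artanh 0.
    by rewrite xE yE (ball_dist_slice H) // artanh0 subr0 poincareC.
  apply: kobayashi_length_le; [exact: cnorm_ge0|exact: hB|move=> p q p0 pq qk].
  have p1 : cnorm (p%:C%C * w) < 1 by apply: disc; rewrite p0 (le_trans pq).
  have q1 : cnorm (q%:C%C * w) < 1 by apply: disc; rewrite qk (le_trans p0).
  rewrite (ball_dist_slice H) ?mobius_disc // -(poincare_ray w1 p0 pq (le_lt_trans qk k1)).
  rewrite !poincareE; apply: artanh_le; first exact: cnorm_ge0.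
    apply: (@schwarz_pick R (mobius (- l))) p1 q1 => t t1.
      exact: differentiable_mobius.
    exact: mobius_disc.
  exact: mobius_disc.
Qed.

Lemma geodesic_in_ball g t : geodesic B `]-oo, +oo[%R g -> enorm (g t) < 1.
Proof. by move=> [[_ gB] _]; apply: (gB (g t)); exists t => //=; rewrite in_itv. Qed.

(** A geodesic is at most as long as the curve of exists_minimizing_curve, and at
    least as long as the two chords through an intermediate point. With the
    triangle inequality, distances add up along a geodesic. *)
Lemma geodesic_dist g s t u : geodesic B `]-oo, +oo[%R g -> s <= t -> t <= u ->
  ball_dist (g s) (g t) + ball_dist (g t) (g u) <= ball_dist (g s) (g u).
Proof.
move=> gg; have gB r := geodesic_in_ball r gg.
rewrite le_eqVlt => /predU1P[<- _|st]; first by rewrite ball_distxx // add0r.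
rewrite le_eqVlt => /predU1P[<-|tu]; first by rewrite (ball_distxx (gB t)) addr0.
have [T [h [T0 hc h0 hT hlen]]] := exists_minimizing_curve (gB s) (gB u).
rewrite -lee_fin (le_trans _ hlen) // (le_trans (kobayashi_length_ge2 st tu _ _ _)) //.
by apply: gg.2 => //; rewrite ?in_itv // ltW // (lt_trans st).
Qed.

Lemma geodesic_of_dist g (tau : R -> R) : continuous g -> (forall t, enorm (g t) < 1) ->
  (forall s t, s <= t -> ball_dist (g s) (g t) = tau t - tau s) ->
  geodesic B `]-oo, +oo[%R g.
Proof.
move=> cg gB H; split.
  by split; [exact: continuous_subspaceT|move=> _ [t _ <-]; exact: gB].
move=> s t _ _ st u v h uv [_ hB] hu hv.
apply: (@le_trans _ _ (ball_dist (g s) (g t))%:E).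
  rewrite H //; apply: kobayashi_length_le => // p q _ pq _; by rewrite H.
by rewrite -hu -hv; apply: kobayashi_length_ge1 => //; rewrite ?hu ?hv.
Qed.
End Geodesics.

(** * The Cayley transform *)

Section Siegel.
Context {R : realType}.
Local Notation C := (Cplx R).

Section VCons.
Variable n : nat.
Implicit Types (z w : 'rV[C]_n.+1) (c : C) (v : 'rV[C]_n).

Lemma vhead_vcons c v : vhead (vcons c v) = c.
Proof.
rewrite /vhead /vcons (_ : 0 = lshift n (0 : 'I_1)); last exact: val_inj.
by rewrite (@row_mxEl _ 1 1 n) mxE eqxx.
Qed.

Lemma vtail_vcons c v : vtail (vcons c v) = v.
Proof. exact: row_mxKr. Qed.

Lemma vcons_coord c v (j : 'I_n) : vcons c v 0 (lift 0 j) = v 0 j.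
Proof.
rewrite /vcons (_ : lift 0 j = rshift 1 j); last exact: val_inj.
by rewrite (@row_mxEr _ 1 1 n).
Qed.

Lemma vtail_coord z (j : 'I_n) : vtail z 0 j = z 0 (lift 0 j).
Proof. by rewrite /vtail mxE; congr (z 0 _); apply: val_inj. Qed.

Lemma vconsP z w : vhead z = vhead w -> vtail z = vtail w -> z = w.
Proof.
move=> h t; apply/rowP => i; case: (unliftP 0 i) => [j ->|->]; last exact: h.
by rewrite -!vtail_coord t.
Qed.

Lemma vcons_headtail z : vcons (vhead z) (vtail z) = z.
Proof. by apply: vconsP; rewrite ?vhead_vcons ?vtail_vcons. Qed.

Lemma vheadD z w : vhead (z + w) = vhead z + vhead w. Proof. by rewrite /vhead mxE. Qed.
Lemma vheadZ c w : vhead (c *: w) = c * vhead w. Proof. by rewrite /vhead mxE. Qed.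
Lemma vtailD z w : vtail (z + w) = vtail z + vtail w.
Proof. by apply/rowP => j; rewrite !(vtail_coord, mxE). Qed.
Lemma vtailZ c w : vtail (c *: w) = c *: vtail w.
Proof. by apply/rowP => j; rewrite !(vtail_coord, mxE). Qed.

Lemma vhead_e1 : vhead (e1 n : 'rV[C]_n.+1) = 1.
Proof. by rewrite /vhead /e1 mxE eqxx. Qed.
Lemma vtail_e1 : vtail (e1 n : 'rV[C]_n.+1) = 0.
Proof. by apply/rowP => j; rewrite vtail_coord !mxE. Qed.

Lemma herm_headtail z w :
  herm z w = vhead z * (vhead w)^* + herm (vtail z) (vtail w).
Proof.
rewrite /herm big_ord_recl; congr (_ + _); apply: eq_bigr => j _.
by rewrite !vtail_coord.
Qed.

Lemma herm_e1 z : herm z (e1 n) = vhead z.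
Proof.
rewrite herm_headtail vhead_e1 vtail_e1 rmorph1 mulr1.
by rewrite -[X in herm _ X](scale0r 0) hermZr rmorph0 mul0r addr0.
Qed.

Lemma enorm_e1 : enorm (e1 n : 'rV[C]_n.+1) = 1.
Proof.
apply/eqP; rewrite -(eqrXn2 (n := 2)) ?enorm_ge0 // expr1n -Re_hermxx herm_e1.
by rewrite vhead_e1.
Qed.

End VCons.

Lemma differentiable_rV (U : normedModType C) m (G : U -> 'rV[C]_m) x :
  (forall j, differentiable (fun z => G z 0 j : C) x) -> differentiable G x.
Proof.
move=> H; have -> : G = \sum_(j < m) (fun z => G z 0 j *: (delta_mx 0 j : 'rV[C]_m)).
  apply/funext => z; rewrite fct_sumE; exact: row_sum_delta.
by apply: differentiable_sum => j; exact: differentiableZl.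
Qed.

Lemma differentiable_vcons (U : normedModType C) m (c : U -> C) (G : U -> 'rV[C]_m) x :
  differentiable c x -> differentiable G x ->
  differentiable (fun z => vcons (c z) (G z)) x.
Proof.
move=> dc dG; apply: differentiable_rV => j; case: (unliftP 0 j) => [i ->|->].
  under eq_fun do rewrite vcons_coord.
  by apply: (@differentiable_comp _ _ _ _ G (fun v => v 0 i)) => //; exact: differentiable_coord.
by under eq_fun do rewrite -[vcons _ _ 0 0]/(vhead _) vhead_vcons.
Qed.

Lemma differentiable_vhead m (x : 'rV[C]_m.+1) : differentiable (@vhead R m) x.
Proof. exact: differentiable_coord. Qed.

Lemma differentiable_vtail m (x : 'rV[C]_m.+1) : differentiable (@vtail R m) x.
Proof. exact: (@differentiable_rsubmx _ 1 1 m). Qed.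

Section Cayley.
Variable n : nat.
Implicit Types (x y z w X Y Z : 'rV[C]_n.+1).

(** The polarised defining function of the Siegel domain, up to a factor 2i. *)
Definition sform X Y : C :=
  vhead X - (vhead Y)^* - 2 * 'i * herm (vtail X) (vtail Y).

Definition sheight X : R := complex.Im (vhead X) - enorm (vtail X) ^+ 2.

Lemma ball_vhead_neq1 x : enorm x < 1 -> 1 - vhead x != 0.
Proof. by move=> x1; rewrite -herm_e1 herm_den_neq0 ?enorm_e1. Qed.

(** The factor 1 - herm x y in the distance of the ball is the polarised form of
    the Siegel domain, up to factors that depend on one point each. *)
Lemma sform_cayley x y : 1 - vhead x != 0 -> 1 - vhead y != 0 ->
  sform (cayley x) (cayley y) =
  2 * 'i * (1 - herm x y) / ((1 - vhead x) * (1 - vhead y)^*).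
Proof.
move=> x1 y1; have y1' : (1 - vhead y)^* != 0 by rewrite conjc_eq0.
rewrite /sform /cayley !vhead_vcons !vtail_vcons hermZl hermZr herm_headtail.
rewrite !(cconjM, fmorphV, cconjD, cconjB) /= conjCi.
move: y1'; rewrite cconjB rmorph1 => y1'.
set a := vhead x; set b := (vhead y)^*; set h := herm _ _.
have i2 : ('i : C) * 'i = -1 by rewrite -expr2 sqrCi.
have -> : 2 * 'i * ('i / (1 - a) * (- 'i / (1 - b) * h)) =
    2 * 'i * ('i * - 'i) * h / ((1 - a) * (1 - b)).
  by field; rewrite x1 y1'.
rewrite mulrN i2 opprK mulr1.
by field; rewrite x1 y1'.
Qed.

Lemma sformxx X : sform X X = 2 * 'i * (sheight X)%:C%C.
Proof.
rewrite /sform hermxx /sheight -complexiE.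
by case: (vhead X) => a b; apply: complexP => /=; ring.
Qed.

Lemma sheight_cayley x : 1 - vhead x != 0 ->
  sheight (cayley x) = (1 - enorm x ^+ 2) / cnorm (1 - vhead x) ^+ 2.
Proof.
move=> x1; have := sform_cayley x1 x1; rewrite sformxx hermxx mulc_conj.
have i0 : 2 * 'i != 0 :> C by rewrite mulf_neq0 ?pnatr_eq0 // neq0Ci.
rewrite -[X in _ = X]mulrA => /(mulfI i0).
by rewrite -[X in (X - _) / _](real_complexX 1 0) -real_complexB -real_complexV -real_complexM => -[].
Qed.

Definition cayley_inverse Z : 'rV[C]_n.+1 :=
  vcons ((vhead Z - 'i) / (vhead Z + 'i)) ((2 / (vhead Z + 'i)) *: vtail Z).

Lemma cayleyK x : 1 - vhead x != 0 -> cayley_inverse (cayley x) = x.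
Proof.
move=> x1; have i0 : 'i != 0 :> C by exact: neq0Ci.
have d : 'i * ((1 + vhead x) / (1 - vhead x)) + 'i = 2 * 'i / (1 - vhead x) by field.
rewrite /cayley_inverse /cayley !vhead_vcons !vtail_vcons d; apply: vconsP.
  by rewrite vhead_vcons; field; rewrite x1 i0.
rewrite vtail_vcons scalerA (_ : _ * _ = 1) ?scale1r //.
by field; rewrite x1 i0.
Qed.

Lemma cayley_inverseK Z : vhead Z + 'i != 0 -> 1 - vhead (cayley_inverse Z) != 0 /\
  cayley (cayley_inverse Z) = Z.
Proof.
move=> Z1; have i0 : 'i != 0 :> C by exact: neq0Ci.
have d : 1 - (vhead Z - 'i) / (vhead Z + 'i) = 2 * 'i / (vhead Z + 'i) by field.
rewrite /cayley_inverse vhead_vcons d; split.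
  by rewrite mulf_neq0 ?invr_eq0 ?mulf_neq0 ?pnatr_eq0.
rewrite /cayley vhead_vcons vtail_vcons d; apply: vconsP.
  by rewrite vhead_vcons; field; rewrite Z1 i0.
rewrite vtail_vcons scalerA (_ : _ * _ = 1) ?scale1r //.
by field; rewrite Z1 i0.
Qed.

Lemma differentiable_cayley x : enorm x < 1 -> differentiable (@cayley R n) x.
Proof.
move=> /ball_vhead_neq1 x1.
have dh : differentiable (@vhead R n) x by exact: differentiable_vhead.
have dV : differentiable (fun z : 'rV[C]_n.+1 => (1 - vhead z)^-1 : C) x.
  apply: differentiableV; last exact: x1.
  by apply: differentiableB; [exact: differentiable_cst|exact: dh].
apply: differentiable_vcons.
  apply: differentiableM; first exact: differentiable_cst.
  apply: differentiableM; last exact: dV.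
  by apply: differentiableD; [exact: differentiable_cst|exact: dh].
apply: differentiable_rV => j.
have -> : (fun z : 'rV[C]_n.+1 => (('i / (1 - vhead z)) *: vtail z) 0 j : C) =
    (fun z => 'i * (1 - vhead z)^-1 * z 0 (lift 0 j)).
  by apply/funext => z; rewrite mxE vtail_coord.
apply: differentiableM; last exact: differentiable_coord.
by apply: differentiableM; [exact: differentiable_cst|exact: dV].
Qed.

Lemma siegel_den Z : 0 <= complex.Im (vhead Z) -> vhead Z + 'i != 0.
Proof.
move=> Z0; apply/eqP => /(congr1 (@complex.Im R)).
rewrite cImD -complexiE /=; lra.
Qed.

Lemma siegel_Im Z : 0 <= sheight Z -> 0 <= complex.Im (vhead Z).
Proof. by rewrite subr_ge0; apply: le_trans; exact: sqr_ge0. Qed.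

Lemma differentiable_cayley_inverse Z : 0 < sheight Z -> differentiable cayley_inverse Z.
Proof.
move=> /ltW/siegel_Im/siegel_den Z1.
have dh : differentiable (@vhead R n) Z by exact: differentiable_vhead.
have dV : differentiable (fun z : 'rV[C]_n.+1 => (vhead z + 'i)^-1 : C) Z.
  apply: differentiableV; last exact: Z1.
  by apply: differentiableD; [exact: dh|exact: differentiable_cst].
apply: differentiable_vcons.
  apply: differentiableM; last exact: dV.
  by apply: differentiableB; [exact: dh|exact: differentiable_cst].
apply: differentiable_rV => j.
have -> : (fun z : 'rV[C]_n.+1 => ((2 / (vhead z + 'i)) *: vtail z) 0 j : C) =
    (fun z => 2 * (vhead z + 'i)^-1 * z 0 (lift 0 j)).
  by apply/funext => z; rewrite mxE vtail_coord.
apply: differentiableM; last exact: differentiable_coord.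
by apply: differentiableM; [exact: differentiable_cst|exact: dV].
Qed.

Lemma cayley_inverse_ball Z : 0 < sheight Z -> enorm (cayley_inverse Z) < 1.
Proof.
move=> Z0; have [h1 h2] := cayley_inverseK (siegel_den (siegel_Im (ltW Z0))).
move: Z0; rewrite -{1}h2 sheight_cayley // pmulr_lgt0 ?invr_gt0 ?exprn_gt0 ?cnorm_gt0 //.
by rewrite subr_sqr_gt0 ?enorm_ge0.
Qed.

Lemma cayley_inverse_sphere Z : sheight Z = 0 -> enorm (cayley_inverse Z) = 1.
Proof.
move=> Z0; have Z0' : 0 <= sheight Z by rewrite Z0.
have [h1 h2] := cayley_inverseK (siegel_den (siegel_Im Z0')).
move: Z0; rewrite -{1}h2 sheight_cayley // => /eqP.
rewrite mulf_eq0 invr_eq0 expf_eq0 /= cnorm_eq0 (negPf h1) orbF subr_eq0 eq_sym.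
by rewrite sqrf_eq1 => /orP[/eqP//|/eqP h]; have := enorm_ge0 (cayley_inverse Z); rewrite h; lra.
Qed.

Lemma cayley_siegel x : enorm x < 1 -> 0 < sheight (cayley x).
Proof.
move=> x1; have h := ball_vhead_neq1 x1.
by rewrite sheight_cayley // divr_gt0 ?exprn_gt0 ?cnorm_gt0 // subr_sqr_gt0 ?enorm_ge0.
Qed.

Lemma cayley_invE Z : 0 < sheight Z -> cayley_inv Z = cayley_inverse Z.
Proof.
move=> Z0; rewrite /cayley_inv.
have [_ {1}<-] := cayley_inverseK (siegel_den (siegel_Im (ltW Z0))).
rewrite pinvKV // ?inE; last exact: cayley_inverse_ball.
by move=> x y; rewrite !inE /unit_ball /= => /ball_vhead_neq1 hx /ball_vhead_neq1 hy;
  move=> /(congr1 cayley_inverse); rewrite !cayleyK.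
Qed.

(** The imaginary part of sform X Y is the sum of the heights plus |X' - Y'|^2, so
    the hypothesis leaves no room for X' - Y' nor for the real part, which is then
    Re X_1 - Re Y_1. *)
Lemma sform_rigid X Y : cnorm (sform X Y) <= sheight X + sheight Y ->
  vtail X = vtail Y /\ complex.Re (vhead X) = complex.Re (vhead Y).
Proof.
move=> H; have ImE : complex.Im (sform X Y) =
    sheight X + sheight Y + enorm (vtail X - vtail Y) ^+ 2.
  rewrite -[X in _ = _ + X]Re_hermxx !(hermBl, hermBr) (herm_conj (vtail X) (vtail Y)).
  rewrite !hermxx /sheight /sform -complexiE.
  case: (vhead X) => a b; case: (vhead Y) => c d.
  by case: (herm _ _) => p q /=; ring.
have Im_le := le_trans (ler_norm _) (le_trans (Im_le_cnorm (sform X Y)) H).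
have T0 : vtail X = vtail Y.
  apply/subr0_eq/enorm_eq0/eqP.
  have : enorm (vtail X - vtail Y) ^+ 2 <= 0 by move: Im_le; rewrite ImE; lra.
  by rewrite -sqrf_eq0 eq_le sqr_ge0 andbT => ->.
split => //.
have ReE : complex.Re (sform X Y) = complex.Re (vhead X) - complex.Re (vhead Y).
  rewrite /sform T0 hermxx -complexiE.
  by case: (vhead X) => a b; case: (vhead Y) => c d /=; ring.
have : cnorm (sform X Y) ^+ 2 <= complex.Im (sform X Y) ^+ 2.
  rewrite ImE T0 subrr enorm0 expr0n addr0.
  by rewrite ler_sqr ?nnegrE ?cnorm_ge0 // (le_trans (cnorm_ge0 _) H).
rewrite sqr_cnorm gerDr ReE => h.
have : (complex.Re (vhead X) - complex.Re (vhead Y)) ^+ 2 == 0 by rewrite eq_le h sqr_ge0.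
by rewrite expf_eq0 /= subr_eq0 => /eqP.
Qed.
End Cayley.
End Siegel.

(** * Busemann functions at the point e1 *)

Section Busemann.
Context {R : realType}.
Local Notation C := (Cplx R).

Lemma continuous_cnorm : continuous (@cnorm R : C -> R).
Proof.
move=> z A /nbhs_normP[e e0 H]; apply/nbhs_cnorm; exists e => // w wz.
apply: H; rewrite /= ltr_norml; have := cnormB_le z w; have := cnormB_le w z.
by move: wz; rewrite (cnormB w z); lra.
Qed.

Lemma continuous_sqr_enorm m : continuous (fun z : 'rV[C]_m => enorm z ^+ 2).
Proof.
have -> : (fun z : 'rV[C]_m => enorm z ^+ 2) =
    (fun z => \sum_(i < m) (fun i (z : 'rV[C]_m) => cnorm (z 0 i) ^+ 2) i z).
  by apply/funext => z; rewrite sqr_enorm.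
apply: continuous_big => [|i _ z]; first exact: add_continuous.
apply: (@continuous_comp _ _ _ (fun z : 'rV[C]_m => cnorm (z 0 i)) (fun r => r ^+ 2)).
  apply: (@continuous_comp _ _ _ (fun z : 'rV[C]_m => z 0 i : C)).
    exact: coord_continuous.
  exact: continuous_cnorm.
exact: exprn_continuous.
Qed.

Variable n : nat.
Local Notation V := 'rV[C]_n.+1.
Local Notation B := (@unit_ball R n.+1).
Implicit Types (x y z w : V).

Lemma open_ball : open B.
Proof.
have -> : B = (fun z : V => enorm z ^+ 2) @^-1` [set r : R | r < 1].
  by apply/funext => z; apply/propext; rewrite /unit_ball /= expr_lt1 ?enorm_ge0.
by apply: open_comp => [z _|]; [exact: continuous_sqr_enorm|exact: open_lt].
Qed.

Lemma boundary_ballE p : boundary B p <-> closure B p /\ ~ B p.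
Proof. by rewrite /boundary; move/interior_id: open_ball => ->. Qed.

Lemma closure_cvg_ball (T : Type) (F : set_system T) {PF : ProperFilter F} (g : T -> V) p :
  (forall t, enorm (g t) < 1) -> g @ F --> p -> closure B p.
Proof.
move=> gB gp; apply: (@closed_cvg _ _ _ PF g) gp => //; first exact: closed_closure.
by apply: filterE => t; apply: subset_closure; exact: gB.
Qed.

Lemma ball_distC x y : ball_dist x y = ball_dist y x.
Proof.
rewrite /ball_dist /sqr_rho (herm_conj x y) -(cnorm_conj (1 - herm x y)).
by rewrite cconjB rmorph1 (mulrC (1 - enorm x ^+ 2)).
Qed.

(* busemann x w is (1 - |w|^2) e^(2 d(x, w)), which extends continuously to w = e1. *)
Let busemann x w := (1 + Num.sqrt (sqr_rho x w)) ^+ 2 *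
  cnorm (1 - herm x w) ^+ 2 / (1 - enorm x ^+ 2).

Let busemannE x w : enorm x < 1 -> enorm w < 1 ->
  busemann x w = expR (2 * ball_dist x w) * (1 - enorm w ^+ 2).
Proof.
move=> x1 w1; rewrite /busemann -expR_ball_dist // /sqr_rho subKr.
have := herm_den_neq0 x1 (ltW w1); rewrite -cnorm_eq0 => h.
have x2 : 1 - enorm x ^+ 2 != 0 by rewrite gt_eqF // subr_sqr_gt0 ?enorm_ge0.
by field; rewrite h x2.
Qed.

Let busemann_cvg (F : set_system V) x : ProperFilter F -> F --> e1 n -> enorm x < 1 ->
  busemann x w @[w --> F] --> 4 / sheight (cayley x).
Proof.
move=> PF Fe x1; have h1 := ball_vhead_neq1 x1.
have at_e1 (k : V -> R) : {for e1 n, continuous k} -> k w @[w --> F] --> k (e1 n).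
  by move=> ck; exact: cvg_trans (cvg_app k Fe) ck.
have sq (k : V -> R) (l : R) : k w @[w --> F] --> l -> k w ^+ 2 @[w --> F] --> l ^+ 2.
  by move=> kl; exact: (cvg_comp _ _ kl (@exprn_continuous R 2 l)).
have c1 : cnorm (1 - herm x w) @[w --> F] --> cnorm (1 - vhead x).
  have -> : (fun w => cnorm (1 - herm x w)) = (@cnorm R : C -> R) \o (fun w => 1 - herm w x).
    by apply/funext => w; rewrite /= (herm_conj w x) -(cnorm_conj (1 - herm w x)) cconjB rmorph1.
  have -> : cnorm (1 - vhead x) = ((@cnorm R : C -> R) \o (fun w => 1 - herm w x)) (e1 n).
    by rewrite /= -herm_e1 -(cnorm_conj (1 - herm (e1 n) x)) cconjB rmorph1 -herm_conj.
  apply: at_e1; apply: continuous_comp; last exact: continuous_cnorm.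
  apply: differentiable_continuous; apply: differentiableB => //.
  exact: differentiable_herm.
have c2 : 1 - enorm w ^+ 2 @[w --> F] --> (0 : R).
  have -> : 0 = 1 - enorm (e1 n : V) ^+ 2 by rewrite enorm_e1 expr1n subrr.
  apply: cvgB; first exact: cvg_cst.
  by apply: (at_e1 (fun w => enorm w ^+ 2)); exact: continuous_sqr_enorm.
have k0 : cnorm (1 - vhead x) ^+ 2 != 0 by rewrite expf_neq0 // cnorm_eq0.
have c3 : sqr_rho x w @[w --> F] --> (1 : R).
  have -> : 1 = 1 - (1 - enorm x ^+ 2) * 0 / cnorm (1 - vhead x) ^+ 2 :> R.
    by rewrite mulr0 mul0r subr0.
  apply: cvgB; first exact: cvg_cst.
  apply: cvgM; first by apply: cvgM => //; exact: cvg_cst.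
  by apply: cvgV => //; exact: sq.
have c4 : Num.sqrt (sqr_rho x w) @[w --> F] --> (1 : R).
  rewrite -[X in _ --> X]sqrtr1.
  exact: (cvg_comp _ _ c3 (@sqrt_continuous R 1)).
have -> : 4 / sheight (cayley x) =
    (1 + 1) ^+ 2 * cnorm (1 - vhead x) ^+ 2 / (1 - enorm x ^+ 2).
  rewrite sheight_cayley //; field.
  by rewrite -cnorm_eq0 in h1; rewrite h1 gt_eqF // subr_sqr_gt0 ?enorm_ge0.
apply: cvgM; last exact: cvg_cst.
apply: cvgM; last exact: sq.
by apply: sq; apply: cvgD => //; exact: cvg_cst.
Qed.

Lemma sqr_rho_sform x y : enorm x < 1 -> enorm y < 1 ->
  (1 - sqr_rho x y) * cnorm (sform (cayley x) (cayley y)) ^+ 2 =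
  4 * sheight (cayley x) * sheight (cayley y).
Proof.
move=> x1 y1; have hx := ball_vhead_neq1 x1; have hy := ball_vhead_neq1 y1.
have := herm_den_neq0 x1 (ltW y1).
rewrite sform_cayley // !sheight_cayley // /sqr_rho subKr !cnormM cnormV !cnormM cnorm_conj.
rewrite (_ : cnorm (2 : C) = 2); last by rewrite -[2 : C](rmorph_nat (real_complex R)) cnorm_real ger0_norm.
rewrite (_ : cnorm ('i : C) = 1); last by rewrite -complexiE /= expr0n expr1n add0r sqrtr1.
rewrite -!cnorm_eq0 in hx hy *; move=> h.
by field; rewrite h hx hy.
Qed.

(* If e^(2 d) = E = (1 + q) / (1 - q) then E <= b / a means q (a + b) <= b - a, and
   S^2 = 4 a b / (1 - q^2) is at most (a + b)^2. *)
Let busemann_algebra (a b E q S : R) : 0 < a -> 0 < b -> 0 <= q < 1 -> 0 <= S ->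
  E * (4 / b) <= 4 / a -> E * (1 - q ^+ 2) = (1 + q) ^+ 2 ->
  (1 - q ^+ 2) * S ^+ 2 = 4 * a * b -> S <= a + b.
Proof.
move=> a0 b0 /andP[q0 q1] S0 + rE SE.
rewrite mulrA ler_pdivrMr // mulrAC ler_pdivlMr // => Eab.
have Eq : E * (1 - q) = 1 + q.
  have : (1 + q) * (E * (1 - q)) = (1 + q) * (1 + q) by rewrite -expr2 -rE; ring.
  by apply: mulfI; rewrite gt_eqF //; lra.
have key : (1 - q ^+ 2) * (a + b) ^+ 2 - 4 * a * b = (b - a) ^+ 2 - q ^+ 2 * (a + b) ^+ 2.
  by ring.
have qab : q * (a + b) <= b - a.
  have : (1 + q) * a <= b * (1 - q).
    rewrite -Eq mulrAC; apply: ler_wpM2r; lra.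
  lra.
have q2 : 0 < 1 - q ^+ 2 by rewrite subr_sqr_gt0.
have ab0 : 0 <= q * (a + b) by rewrite mulr_ge0 // addr_ge0 // ltW.
have : (1 - q ^+ 2) * S ^+ 2 <= (1 - q ^+ 2) * (a + b) ^+ 2.
  rewrite SE -subr_ge0 key subr_ge0 -exprMn.
  by rewrite ler_sqr // nnegrE (le_trans ab0).
by rewrite (ler_pM2l q2) ler_sqr // nnegrE addr_ge0 // ltW.
Qed.

(** On a geodesic ray x, y, w with w tending to e1, the difference of the distances
    of w to x and to y is at least the distance of x and y. In the limit it becomes
    half the logarithm of the ratio of the heights of y and x, and then x and y are
    in the equality case of sform_rigid. *)
Lemma busemann_rigid (F : set_system V) {PF : ProperFilter F} x y : F --> e1 n ->
  enorm x < 1 -> enorm y < 1 ->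
  (\forall w \near F, enorm w < 1 /\ ball_dist x y + ball_dist y w <= ball_dist x w) ->
  vtail (cayley x) = vtail (cayley y) /\
  complex.Re (vhead (cayley x)) = complex.Re (vhead (cayley y)).
Proof.
move=> Fe x1 y1 H.
have a0 : 0 < sheight (cayley x) by exact: cayley_siegel.
have b0 : 0 < sheight (cayley y) by exact: cayley_siegel.
have Eab : expR (2 * ball_dist x y) * (4 / sheight (cayley y)) <= 4 / sheight (cayley x).
  apply: (@ler_cvg_to _ F _ R (fun w => expR (2 * ball_dist x y) * busemann y w) (busemann x)).
  - by apply: cvgM; [exact: cvg_cst|exact: busemann_cvg].
  - exact: busemann_cvg.
  near=> w; have [w1 dw] : enorm w < 1 /\ ball_dist x y + ball_dist y w <= ball_dist x w.
    by near: w.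
  rewrite (busemannE x1 w1) (busemannE y1 w1) mulrA; apply: ler_wpM2r.
    by rewrite ltW // subr_sqr_gt0 ?enorm_ge0.
  by rewrite -expRD ler_expR -mulrDr ler_wpM2l.
have /andP[r0 r1] := sqr_rho_itv x1 y1.
have qE := sqr_sqrtr r0.
have q1 : 0 <= Num.sqrt (sqr_rho x y) < 1.
  by rewrite sqrtr_ge0 -(expr_lt1 (n := 2)) ?sqrtr_ge0 // qE.
apply: sform_rigid; apply: (busemann_algebra a0 b0 q1 (cnorm_ge0 _) Eab); rewrite qE.
  exact: expR_ball_dist.
exact: sqr_rho_sform.
Unshelve. all: by end_near. Qed.
End Busemann.

(** * Vertical lines of the Siegel domain *)

Section Vertical.
Context {R : realType}.
Local Notation C := (Cplx R).
Variable n : nat.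
Local Notation V := 'rV[C]_n.+1.
Local Notation B := (@unit_ball R n.+1).

(** The parameter t is the logarithm of the height, which is twice the arc
    length. *)
Definition siegel_line (x : R) (a : 'rV[C]_n) (t : R) : V :=
  vcons (x +i* (enorm a ^+ 2 + expR t))%C a.

Definition vertical (x : R) (a : 'rV[C]_n) (t : R) : V := cayley_inverse (siegel_line x a t).

Section Line.
Variables (x : R) (a : 'rV[C]_n).

Lemma sheight_siegel_line t : sheight (siegel_line x a t) = expR t.
Proof. by rewrite /sheight vhead_vcons vtail_vcons /= addrAC subrr add0r. Qed.

Lemma vertical_ball t : enorm (vertical x a t) < 1.
Proof. by apply: cayley_inverse_ball; rewrite sheight_siegel_line expR_gt0. Qed.

Lemma cayley_vertical t : cayley (vertical x a t) = siegel_line x a t.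
Proof.
have h : 0 <= sheight (siegel_line x a t) by rewrite sheight_siegel_line expR_ge0.
by have [_] := cayley_inverseK (siegel_den (siegel_Im h)).
Qed.

Lemma sform_siegel_line s t : sform (siegel_line x a s) (siegel_line x a t) = 'i * (expR s + expR t)%:C%C.
Proof.
rewrite /sform !vhead_vcons !vtail_vcons hermxx -complexiE.
by apply: complexP => /=; ring.
Qed.

Lemma ball_dist_vertical s t : s <= t ->
  ball_dist (vertical x a s) (vertical x a t) = t / 2 - s / 2.
Proof.
move=> st.
have key X Y : cayley (vertical x a s) = X -> cayley (vertical x a t) = Y ->
    (1 - sqr_rho (vertical x a s) (vertical x a t)) * cnorm (sform X Y) ^+ 2 =
    4 * sheight X * sheight Y.
  by move=> <- <-; exact: sqr_rho_sform (vertical_ball s) (vertical_ball t).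
have := key _ _ (cayley_vertical s) (cayley_vertical t).
rewrite !sheight_siegel_line sform_siegel_line cnormM cnorm_real.
rewrite (_ : cnorm ('i : C) = 1); last by rewrite -complexiE /= expr0n expr1n add0r sqrtr1.
have s0 := expR_gt0 s; have t0 := expR_gt0 t; have ler : expR s <= expR t by rewrite ler_expR.
have st0 : expR s + expR t != 0 by rewrite gt_eqF // addr_gt0.
rewrite mul1r ger0_norm ?addr_ge0 ?expR_ge0 // => E.
have -> : ball_dist (vertical x a s) (vertical x a t) =
    artanh ((expR t - expR s) / (expR s + expR t)).
  rewrite /ball_dist; congr artanh.
  have -> : sqr_rho (vertical x a s) (vertical x a t) =
      ((expR t - expR s) / (expR s + expR t)) ^+ 2.
    apply: (mulIf (expf_neq0 2 st0)).
    rewrite -[sqr_rho _ _](subKr 1) mulrBl E exprMn exprVn mulfVK ?expf_neq0 //; ring.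
  by rewrite sqrtr_sqr ger0_norm // divr_ge0 ?subr_ge0 // addr_ge0 // ltW.
rewrite /artanh (_ : _ / _ = expR t / expR s); last first.
  have h2 : expR s + expR t - (expR t - expR s) != 0.
    by rewrite gt_eqF // (_ : _ - _ = expR s *+ 2) ?pmulrn_lgt0 //; ring.
  by field; rewrite h2 st0 gt_eqF.
by rewrite ln_div ?posrE // !expRK; field.
Qed.

(* The line in the ball as a function of the first Siegel coordinate. *)
Let G (l : C) : V := vcons ((l - 'i) / (l + 'i)) ((2 / (l + 'i)) *: a).

Let verticalE t : vertical x a t = G (x +i* (enorm a ^+ 2 + expR t))%C.
Proof. by rewrite /vertical /cayley_inverse vhead_vcons vtail_vcons. Qed.

Let continuous_G (l : C) : 0 <= complex.Im l -> {for l, continuous G}.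
Proof.
move=> l0; have li : l + 'i != 0.
  by have := @siegel_den R n (vcons l 0); rewrite vhead_vcons; apply.
have dli : differentiable (fun l : C => l + 'i) l by exact: differentiableD.
apply: differentiable_continuous; apply: differentiable_vcons.
  by apply: differentiableM; [exact: differentiableB|exact: differentiableV].
apply: differentiableZl; apply: differentiableM; first exact: differentiable_cst.
exact: differentiableV.
Qed.

Let complex_line_cvg (T : Type) (F : set_system T) (k : T -> R) (y : R) : Filter F ->
  k @ F --> y -> (fun t => (x +i* k t)%C : C) @ F --> ((x +i* y)%C : C).
Proof.
move=> FF ky; have -> : (fun t => (x +i* k t)%C : C) =
    (fun s : R => (x%:C%C + 'i * s%:C%C : C)) \o k.
  by apply/funext => t /=; rewrite -complexiE; apply: complexP => /=; ring.
have -> : (x +i* y)%C = (x%:C%C + 'i * y%:C%C : C).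
  by rewrite -complexiE; apply: complexP => /=; ring.
apply: (cvg_comp _ _ ky).
apply: cvgD; first exact: cvg_cst.
by apply: cvgM; [exact: cvg_cst|exact: continuous_real_complex].
Qed.

Lemma continuous_vertical : continuous (vertical x a).
Proof.
have -> : vertical x a = G \o (fun t => (x +i* (enorm a ^+ 2 + expR t))%C : C).
  by apply/funext => t; rewrite verticalE.
move=> t; apply: continuous_comp; last first.
  by apply: continuous_G; rewrite /= addr_ge0 ?sqr_ge0 ?expR_ge0.
apply: complex_line_cvg; apply: cvgD; first exact: cvg_cst.
exact: continuous_expR.
Qed.

Lemma vertical_cvgNy : exists2 p, enorm p = 1 & vertical x a t @[t --> -oo] --> p.
Proof.
exists (G (x +i* (enorm a ^+ 2))%C).
  have := @cayley_inverse_sphere R n (vcons (x +i* (enorm a ^+ 2))%C a).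
  rewrite /sheight /cayley_inverse vhead_vcons vtail_vcons /= subrr; exact.
apply/cvgNy_compNP.
have -> : vertical x a \o -%R = G \o (fun t => (x +i* (enorm a ^+ 2 + expR (- t)))%C : C).
  by apply/funext => t; rewrite /= verticalE.
have cG : {for ((x +i* (enorm a ^+ 2))%C : C), continuous G}.
  by apply: continuous_G; exact: sqr_ge0.
have lim : (fun t => (x +i* (enorm a ^+ 2 + expR (- t)))%C : C) @ +oo -->
    ((x +i* (enorm a ^+ 2))%C : C).
  apply: complex_line_cvg; rewrite -[X in _ --> X]addr0.
  by apply: cvgD; [exact: cvg_cst|exact: cvgr_expR].
exact: (cvg_comp _ _ lim cG).
Qed.

Lemma vertical_cvgy : vertical x a t @[t --> +oo] --> (e1 n : V).
Proof.
pose w t : C := ((x +i* (enorm a ^+ 2 + expR t))%C + 'i)^-1.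
pose K (w : C) : V := e1 n + w *: vcons (- 2 * 'i) (2 *: a).
have den t : ((x +i* (enorm a ^+ 2 + expR t))%C + 'i : C) != 0.
  have := @siegel_den R n (siegel_line x a t); rewrite vhead_vcons; apply.
  by rewrite /= addr_ge0 ?sqr_ge0 ?expR_ge0.
have -> : vertical x a = K \o w.
  apply/funext => t; rewrite verticalE /G /K /=; apply: vconsP.
    rewrite [RHS]vheadD [vhead (_ *: _)]vheadZ !vhead_vcons vhead_e1 /w; field; exact: den.
  by rewrite [RHS]vtailD [vtail (_ *: _)]vtailZ !vtail_vcons vtail_e1 add0r scalerA mulrC.
have -> : e1 n = K 0 by rewrite /K scale0r addr0.
have cK : {for (0 : C), continuous K}.
  apply: differentiable_continuous.
  apply: (@differentiableD _ _ _ (cst (e1 n)) (fun w : C => w *: _)); first exact: differentiable_cst.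
  exact: (@differentiableZl _ _ _ (@id C)).
suff w0 : w @ +oo --> (0 : C) by exact: (cvg_comp _ _ w0 cK).
move=> A /nbhs_cnorm[r r0 H].
have /cvgr0_norm_lt/(_ _ r0) := @cvgr_expR R.
apply: filterS => t; rewrite (ger0_norm (expR_ge0 _)) => tr; apply: H; rewrite subr0 (le_lt_trans _ tr) //.
rewrite /w cnormV expRN lef_pV2 ?posrE ?expR_gt0 ?cnorm_gt0 //.
rewrite (le_trans _ (Im_le_cnorm _)) // cImD -complexiE /=.
by rewrite (le_trans _ (ler_norm _)) //; have := sqr_ge0 (enorm a); lra.
Qed.
End Line.

(** Away from neighbourhoods of the two ends only a compact part of the line is
    left, and it lies in the open ball. *)
Lemma geodesic_line_end (g : R -> V) b : geodesic_line B g -> closure (range g) b -> ~ B b ->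
  g t @[t --> +oo] --> b \/ g t @[t --> -oo] --> b.
Proof.
move=> [gg [p _ gp] [q _ gq]] cb bB.
have [<-|bq] := pselect (q = b); first by left.
have [<-|bp] := pselect (p = b); first by right.
exfalso; apply: bB.
have haus : hausdorff_space V by exact: norm_hausdorff.
have sep c : c <> b -> exists A W, [/\ nbhs c W, nbhs b A & A `&` W = set0].
  move=> cb'; have : ~ cluster (nbhs b) c by move=> /haus /esym.
  move=> /existsNP[A] /existsNP[W] /not_implyP[bA] /not_implyP[cW] /nonemptyPn AW.
  by exists A, W.
have [A [W [qW bA AW]]] := sep q bq.
have [A' [W' [pW' bA' AW']]] := sep p bp.
have [T1 [_ HT1]] : \forall t \near +oo, W (g t) by exact: gq.
have [T2 [_ HT2]] : \forall t \near -oo, W' (g t) by exact: gp.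
have gc : continuous g.
  by have [[gc _] _] := gg; rewrite set_itvNyy in gc; exact/continuous_subspace_setT.
have cK : compact (g @` `[T2, T1]).
  by apply: continuous_compact; [exact: continuous_subspaceT|exact: segment_compact].
have : closure (g @` `[T2, T1]) b.
  move=> N bN; have [_ [[t _ <-] [[Nt At] At']]] := cb _ (filterI (filterI bN bA) bA').
  exists (g t); split => //; exists t => //=; rewrite in_itv /=; apply/andP; split.
    rewrite leNgt; apply/negP => /HT2 Wt; suff : (A' `&` W') (g t) by rewrite AW'.
    by [].
  rewrite leNgt; apply/negP => /HT1 Wt; suff : (A `&` W) (g t) by rewrite AW.
  by [].
by move/(compact_closed haus cK) => [t _ <-]; exact: geodesic_in_ball.
Qed.
End Vertical.

(** * Automorphisms of the closed ball *)

Section Automorphisms.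
Context {R : realType}.
Local Notation C := (Cplx R).
Variable n : nat.
Local Notation V := 'rV[C]_n.+1.
Local Notation B := (@unit_ball R n.+1).

Lemma compact_closure_ball : compact (closure B).
Proof.
pose sq : set C := (fun p : R * R => p.1%:C%C + 'i * p.2%:C%C : C) @` (`[-1, 1] `*` `[-1, 1]).
have csq : compact sq.
  apply: continuous_compact.
    apply: continuous_subspaceT => p; apply: cvgD.
      by apply: (@continuous_comp _ _ _ fst); [exact: cvg_fst|exact: continuous_real_complex].
    apply: cvgM; first exact: cvg_cst.
    by apply: (@continuous_comp _ _ _ snd); [exact: cvg_snd|exact: continuous_real_complex].
  by apply: compact_setX; exact: segment_compact.
have cbox : compact [set v : V | forall i, sq (v ord0 i)] by exact: (@rV_compact C n.+1 (fun=> sq) (fun=> csq)).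
apply: (subclosed_compact _ cbox); first exact: closed_closure.
have cl : closed [set z : V | enorm z ^+ 2 <= 1].
  rewrite (_ : [set z : V | _] = (fun z : V => enorm z ^+ 2) @^-1` [set r : R | r <= 1]) //.
  by apply: closed_comp => [z _|]; [exact: continuous_sqr_enorm|exact: closed_le].
have sub : closure B `<=` [set z : V | enorm z ^+ 2 <= 1].
  move/closure_id: cl => ->; apply: closureS => z; rewrite /unit_ball /= => z1.
  by rewrite expr_le1 ?enorm_ge0 // ltW.
move=> z /sub /= z1 i.
have zi : cnorm (z 0 i) <= 1.
  rewrite -(expr_le1 (n := 2)) ?cnorm_ge0 // (le_trans _ z1) // sqr_enorm.
  by rewrite (bigD1 i) //= lerDl sumr_ge0 // => j _; rewrite sqr_ge0.
exists (complex.Re (z 0 i), complex.Im (z 0 i)).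
  split; rewrite /= in_itv /= -ler_norml (le_trans _ zi) //.
    exact: Re_le_cnorm.
  exact: Im_le_cnorm.
by rewrite /= -complexiE; apply: complexP => /=; ring.
Qed.

Lemma boundary_e1 : boundary B (e1 n).
Proof.
apply/boundary_ballE; split; last by rewrite /unit_ball /= enorm_e1 ltxx.
exact: (closure_cvg_ball (vertical_ball (0 : R) (0 : 'rV[C]_n)) (@vertical_cvgy R n 0 0)).
Qed.

Section Aut.
Variable Phi : V -> V.
Hypothesis aut : closed_ball_automorphism Phi.

Let Psi := 'pinv_(fun=> 0) B Phi.

Lemma aut_ball z : enorm z < 1 -> enorm (Phi z) < 1.
Proof. by have [[[fB _ _] _ _] _ _] := aut => z1; exact: fB. Qed.

Let Phi_inj : {in B &, injective Phi}.
Proof. by have [[[_ iB _] _ _] _ _] := aut. Qed.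

Let cPhi_inj : {in closure B &, injective Phi}.
Proof. by have [_ [_ iB _] _] := aut. Qed.

Lemma autK z : enorm z < 1 -> Psi (Phi z) = z.
Proof. by move=> z1; rewrite /Psi pinvKV // inE. Qed.

Lemma aut_inv_surj z : enorm z < 1 -> exists2 y, enorm y < 1 & Phi y = z.
Proof.
move=> z1; have [[[_ _ sB] _ _] _ _] := aut.
by have [y y1 yz] := sB z z1; exists y.
Qed.

Lemma aut_invK z : enorm z < 1 -> Phi (Psi z) = z.
Proof. by move=> /aut_inv_surj[y y1 <-]; rewrite autK. Qed.

Lemma aut_inv_ball z : enorm z < 1 -> enorm (Psi z) < 1.
Proof. by move=> /aut_inv_surj[y y1 <-]; rewrite autK. Qed.

Lemma aut_closed_inv z : enorm z < 1 -> 'pinv_(fun=> 0) (closure B) Phi z = Psi z.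
Proof.
move=> /aut_inv_surj[y y1 <-]; rewrite autK // pinvKV // inE.
exact: subset_closure.
Qed.

Lemma holomorphic_aut : holomorphic_on B Phi.
Proof. by have [[_ dPhi _] _ _] := aut. Qed.

Lemma holomorphic_aut_inv : holomorphic_on B Psi.
Proof. by have [[_ _ dPsi] _ _] := aut. Qed.

Lemma ball_dist_aut x y : enorm x < 1 -> enorm y < 1 ->
  ball_dist (Phi x) (Phi y) = ball_dist x y.
Proof.
move=> x1 y1; apply/eqP; rewrite eq_le; apply/andP; split.
  by apply: ball_dist_holomorphic => //; [exact: holomorphic_aut|exact: aut_ball].
rewrite -{1}(autK x1) -{1}(autK y1).
apply: ball_dist_holomorphic; try exact: aut_ball.
  exact: holomorphic_aut_inv.
exact: aut_inv_ball.
Qed.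

Lemma aut_cvg (T : Type) (F : set_system T) {FF : Filter F} (g : T -> V) p :
  (forall t, enorm (g t) < 1) -> closure B p -> g @ F --> p -> Phi \o g @ F --> Phi p.
Proof.
move=> gB cp gp; have [_ _ /subspace_continuousP cPhi] := aut.
apply: cvg_comp (cPhi p cp) => A wA.
change (F (g @^-1` A)).
have : F (g @^-1` [set y | closure B y -> A y]) := gp _ wA.
apply: filterS => t /=; apply; apply: (@subset_closure _ B); exact: gB.
Qed.

Lemma aut_boundary p : boundary B p -> boundary B (Phi p).
Proof.
move=> /boundary_ballE[cp pB]; apply/boundary_ballE.
have [_ [fB _ _] _] := aut; split; first exact: fB.
move=> /aut_inv_surj[y y1 yp]; apply: pB.
have cy : closure B y by exact: (@subset_closure _ B).
have <- : y = p := cPhi_inj (mem_set cy) (mem_set cp) yp.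
exact: y1.
Qed.

(** Automorphisms preserve the Kobayashi distance, and being injective on the
    closed ball they map boundary points to boundary points. *)
Lemma aut_vertical (x : R) (a : 'rV[C]_n) :
  geodesic_lines_at B (Phi (e1 n)) (range (Phi \o vertical x a)).
Proof.
have vB := vertical_ball x a.
have [p p1 vp] := vertical_cvgNy x a.
have cp : closure B p by exact: closure_cvg_ball vB vp.
have bp : boundary B p by apply/boundary_ballE; split => //; rewrite /unit_ball /= p1 ltxx.
have /boundary_ballE[ce _] := boundary_e1.
have lim : (Phi \o vertical x a) t @[t --> +oo] --> Phi (e1 n).
  exact: aut_cvg vB ce (@vertical_cvgy R n x a).
split; last first.
  have nearG : \forall t \near +oo, closure (range (Phi \o vertical x a)) ((Phi \o vertical x a) t).
    by apply: filterE => t; apply: subset_closure; exists t.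
  exact: (@closed_cvg _ _ _ _ _ (closure _) (@closed_closure _ _) nearG _ lim).
exists (Phi \o vertical x a); last reflexivity.
split.
- apply: (@geodesic_of_dist _ _ _ (fun t => t / 2)).
  + move=> t; apply: continuous_comp; first exact: continuous_vertical.
    by apply: differentiable_continuous; apply: holomorphic_aut; exact: vB.
  + by move=> t; exact: aut_ball (vB t).
  + by move=> s t st; rewrite /= ball_dist_aut // ball_dist_vertical.
- by exists (Phi p); [exact: aut_boundary|exact: aut_cvg vB cp vp].
- by exists (Phi (e1 n)); [exact: aut_boundary boundary_e1|].
Qed.

(** The line Psi (g t) need not be known to converge: it has a cluster point in the
    compact closed ball, which is e1 because Phi is continuous and injective there.
    A filter that refines the end of the line and converges to e1 is enough for
    busemann_rigid. *)
Lemma geodesic_end_rigid (g : R -> V) (F : set_system R) {PF : ProperFilter F} y z :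
  (forall t, enorm (g t) < 1) -> g @ F --> Phi (e1 n) ->
  enorm y < 1 -> enorm z < 1 ->
  (\forall t \near F, ball_dist y z + ball_dist z (g t) <= ball_dist y (g t)) ->
  vtail (cayley (Psi y)) = vtail (cayley (Psi z)) /\
  complex.Re (vhead (cayley (Psi y))) = complex.Re (vhead (cayley (Psi z))).
Proof.
move=> gB gb y1 z1 H.
have cB : \forall w \near (Psi \o g) @ F, closure B w.
  change (F ((Psi \o g) @^-1` closure B)); apply: filterE => t.
  by apply: (@subset_closure _ B); exact: aut_inv_ball.
have [p [cp]] := @compact_closure_ball ((Psi \o g) @ F) _ cB.
rewrite cluster_cvgE => -[G PG [Gp HG]].
have GB : \forall w \near G, enorm w < 1.
  apply: HG; change (F ((Psi \o g) @^-1` B)); apply: filterE => t.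
  exact: aut_inv_ball.
have Phip : Phi p = Phi (e1 n).
  have [_ _ /subspace_continuousP cPhi] := aut.
  have lim1 : Phi @ G --> Phi p.
    apply: cvg_trans _ (cPhi p cp) => A wA.
    change (G (Phi @^-1` A)); have Gw : G [set w | closure B w -> A (Phi w)] := Gp _ wA.
    by apply: filterS2 GB Gw => w w1; apply; exact: (@subset_closure _ B).
  have lim2 : Phi @ G --> Phi (e1 n).
    move=> A nA; have gA : F (g @^-1` A) := gb A nA; change (G (Phi @^-1` A)); apply: HG.
    change (F ((Psi \o g) @^-1` (Phi @^-1` A))); apply: filterS gA => t /=.
    by rewrite aut_invK.
  exact: (cvg_unique (@norm_hausdorff C V) lim1 lim2).
have pe : p = e1 n.
  have /boundary_ballE[ce _] := boundary_e1.
  exact: cPhi_inj (mem_set cp) (mem_set ce) Phip.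
rewrite pe in Gp.
have distPsi u v : enorm u < 1 -> enorm v < 1 -> ball_dist (Psi u) (Psi v) = ball_dist u v.
  by move=> u1 v1; rewrite -ball_dist_aut ?aut_inv_ball // !aut_invK.
apply: (busemann_rigid Gp); try exact: aut_inv_ball.
apply: HG.
change (F ((Psi \o g) @^-1` [set w | enorm w < 1 /\
  ball_dist (Psi y) (Psi z) + ball_dist (Psi z) w <= ball_dist (Psi y) w])).
apply: filterS H => t /=.
by rewrite !distPsi // => ?; split => //; exact: aut_inv_ball.
Qed.

(** One end of the line is Phi (e1 n), and the comparison of Busemann functions at
    this end puts any two points of the line on the same vertical line. *)
Lemma geodesic_line_siegel (G : set V) : geodesic_lines_at B (Phi (e1 n)) G ->
  exists (x : R) (a : 'rV[C]_n), forall z, G z ->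
    [/\ enorm z < 1, vtail (cayley (Psi z)) = a & complex.Re (vhead (cayley (Psi z))) = x].
Proof.
move=> [[g gline ->] cb]; have [gg _ _] := gline.
have gB t : enorm (g t) < 1 by exact: geodesic_in_ball.
have /boundary_ballE[_ bB] := aut_boundary boundary_e1.
suff H s t : s <= t -> vtail (cayley (Psi (g s))) = vtail (cayley (Psi (g t))) /\
    complex.Re (vhead (cayley (Psi (g s)))) = complex.Re (vhead (cayley (Psi (g t)))).
  exists (complex.Re (vhead (cayley (Psi (g 0))))), (vtail (cayley (Psi (g 0)))).
  move=> _ [t _ <-]; have [/H[h1 h2]|/ltW/H[h1 h2]] := leP 0 t; split.
  - exact: gB.
  - exact: esym h1.
  - exact: esym h2.
  - exact: gB.
  - exact: h1.
  - exact: h2.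
move=> st; have [gy|gNy] := geodesic_line_end gline cb bB.
  apply: (geodesic_end_rigid gB gy) => //.
  by exists t; split; [exact: num_real|move=> u /ltW tu; exact: geodesic_dist].
suff [h1 h2] : vtail (cayley (Psi (g t))) = vtail (cayley (Psi (g s))) /\
    complex.Re (vhead (cayley (Psi (g t)))) = complex.Re (vhead (cayley (Psi (g s)))).
  by split; [exact: esym h1|exact: esym h2].
apply: (geodesic_end_rigid gB gNy) => //.
exists s; split; [exact: num_real|move=> u /ltW us].
rewrite (ball_distC (g t)) (ball_distC (g s) (g u)) (ball_distC (g t)) addrC.
exact: geodesic_dist.
Qed.
End Aut.
End Automorphisms.

(** * Holomorphic functions on a half-plane *)

Section Analysis.
Context {R : realType}.
Local Notation C := (Cplx R).
Implicit Types (f g k : C -> C) (z w : C).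

Lemma near_differentiable (U W : normedModType C) (f g : U -> W) x :
  (\forall y \near x, f y = g y) -> differentiable f x -> differentiable g x.
Proof.
move=> fg df; have fgx : f x = g x by exact: nbhs_singleton fg.
have [cd dE] := (diff_locallyP x f).1 df.
suff E : g \o shift x = cst (g x) + 'd f x +o_ 0 id.
  by apply/diff_locallyP; rewrite (diff_unique cd E).
apply/eqaddoP => e e0; have /eqaddoP/(_ e e0) dEe := dE.
have sh : \forall h \near (0 : U), f (h + x) = g (h + x).
  have : (fun h : U => h + x) @ (0 : U) --> (0 + x : U).
    by apply: cvgD; [exact: (@cvg_id _ (nbhs (0 : U)))|exact: cvg_cst].
  by rewrite add0r => cv; exact: (cv _ fg).
apply: filterS2 sh dEe => h fgh; rewrite !fctE /=.
by rewrite -fgh -fgx.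
Qed.

Lemma cderivD f g z d e : cderiv f z d -> cderiv g z e -> cderiv (fun w => f w + g w) z (d + e).
Proof.
move=> fd ge k k0; have k2 : 0 < k / 2 by rewrite divr_gt0.
have [r r0 Hr] := fd _ k2; have [s s0 Hs] := ge _ k2.
exists (Num.min r s) => [|h]; first by rewrite lt_min r0.
rewrite lt_min => /andP[/Hr h1 /Hs h2].
have -> : f (z + h) + g (z + h) - (f z + g z) - (d + e) * h =
  (f (z + h) - f z - d * h) + (g (z + h) - g z - e * h) by ring.
by rewrite (le_trans (cnormD _ _)) // (le_trans (lerD h1 h2)) // -mulrDl -splitr.
Qed.

Lemma cderiv_linear (m z : C) : cderiv (fun w => m * w) z m.
Proof.
move=> e e0; exists 1 => // h _.
by rewrite (_ : _ - _ - _ = 0) ?cnorm0 ?mulr_ge0 ?cnorm_ge0 ?ltW //; ring.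
Qed.

Lemma cderiv0_const f z w :
  (forall t : R, 0 <= t <= 1 -> cderiv f (z + t%:C%C * (w - z)) 0) -> f z = f w.
Proof.
move=> H.
have E c : complex.Re (c * f w) = complex.Re (c * f z).
  pose F (t : R) := complex.Re (c * f (z + t%:C%C * (w - z))).
  have : `|F 1 - F 0 - 0 * (1 - 0)| <= 0 * (1 - 0).
    apply: (@mvt_bound R F (fun=> 0)) => // t t01; last by rewrite subrr normr0.
    have := cderiv_line c (H t t01); rewrite mulr0 mul0r; exact.
  rewrite !mul0r subr0 normr_le0 subr_eq0 /F => /eqP.
  by rewrite mul0r addr0 mul1r addrC subrK.
apply: complexP; first by have := E 1; rewrite !mul1r.
have := E (- 'i); rewrite -complexiE.
by case: (f z) => a b; case: (f w) => c d /=; rewrite !oppr0 !mul0r !mulN1r !sub0r !opprK.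
Qed.

(** Only increments on one side enter: going up stays inside a half-plane
    Im z > c, going down may leave it. *)
Lemma is_derive_right0 (F : R -> R) (x d : R) : is_derive x 1 F d ->
  (forall h, 0 < h -> F (x + h) = F x) -> d = 0.
Proof.
move=> Fd F0; apply/eqP; rewrite -normr_le0; apply/ler_addgt0Pr => e e0.
have [r r0 Hr] := is_derive_eps Fd e0.
have h0 : 0 < r / 2 by rewrite divr_gt0.
have hr : r / 2 < r by rewrite ltr_pdivrMr //; lra.
move: (r / 2) h0 hr => h h0 hr; have := Hr h.
rewrite F0 // subrr sub0r normrN normrM (gtr0_norm h0) add0r ler_pM2r //; exact.
Qed.

Section HalfPlane.
Variables (f : C -> C) (c : R).
Hypothesis df : forall z, c < complex.Im z -> exists d, cderiv f z d.

Let D_exists : exists D : C -> C, forall z, c < complex.Im z -> cderiv f z (D z).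
Proof.
have [D HD] : {D : C -> C & forall z, c < complex.Im z -> cderiv f z (D z)}.
  apply: (@choice C C (fun z d => c < complex.Im z -> cderiv f z d)) => z.
  by have [/df[d ?]|?] := boolP (c < complex.Im z); [exists d|exists 0].
by exists D.
Qed.

Let Im_seg z w (t : R) : c < complex.Im z -> c < complex.Im w -> 0 <= t <= 1 ->
  c < complex.Im (z + t%:C%C * (w - z)).
Proof.
case: z => a b; case: w => a' b' /= h1 h2 /andP[t0 t1].
rewrite mul0r addr0; have [bb|bb] := leP b b'.
  have : 0 <= t * (b' - b) by rewrite mulr_ge0 ?subr_ge0.
  lra.
have : t * (b - b') <= b - b' by rewrite ler_piMl // subr_ge0 ltW.
lra.
Qed.

(** The derivative D is real, as Re f does not change in the direction i. Then Im f
    does not change in the direction 1. So Re D depends neither on y, being the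
    derivative of Re f along 1, nor on x, being that of Im f along i. *)
Lemma half_plane_affine :
  (forall x y y', c < y -> c < y' ->
    complex.Re (f (x +i* y)%C) = complex.Re (f (x +i* y')%C)) ->
  exists m : R, forall z w, c < complex.Im z -> c < complex.Im w ->
    f z - f w = m%:C%C * (z - w).
Proof.
move=> vert; have [D HD] := D_exists.
have line (k : C) z u : c < complex.Im z ->
    is_derive (0 : R) 1 (fun s : R => complex.Re (k * f (z + s%:C%C * u))) (complex.Re (k * D z * u)).
  by move=> zc; apply: cderiv_line; rewrite mul0r addr0; exact: HD.
have up (x y s : R) : (x +i* y)%C + s%:C%C * 'i = (x +i* (y + s))%C :> C.
  by rewrite -complexiE; apply: complexP => /=; ring.
have right (x y s : R) : (x +i* y)%C + s%:C%C * 1 = ((x + s) +i* y)%C :> C.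
  by apply: complexP => /=; ring.
have ReN1i (z : C) : complex.Re (- 'i * z) = complex.Im z.
  by rewrite -complexiE; case: z => a b /=; ring.
have ImD0 z : c < complex.Im z -> complex.Im (D z) = 0.
  case: z => x y zc; have H := is_derive_right0 (line 1 (x +i* y)%C 'i zc).
  have : complex.Re (1 * D (x +i* y)%C * 'i) = 0.
    apply: H => s s0; rewrite !mul1r !up add0r addr0; apply: vert => //.
    by rewrite ltr_wpDr // ltW.
  by rewrite mul1r -complexiE; case: (D _) => a b /=; lra.
have Imhor (x x' y : R) : c < y -> complex.Im (f (x +i* y)%C) = complex.Im (f (x' +i* y)%C).
  move=> yc; wlog xx' : x x' / x <= x'.
    by move=> W; have [/W|/ltW/W] := leP x x'.
  pose F (s : R) := complex.Re (- 'i * f ((0 +i* y)%C + s%:C%C * 1)).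
  have : `|F x' - F x - 0 * (x' - x)| <= 0 * (x' - x).
    apply: (@mvt_bound R F (fun=> 0)) => // t tx; last by rewrite subrr normr0.
    have zc : c < complex.Im ((0 +i* y)%C + t%:C%C * 1) by rewrite right.
    have := cderiv_line (- 'i) (HD _ zc).
    by rewrite (mulr1 (- 'i * _)) ReN1i ImD0.
  rewrite !mul0r subr0 normr_le0 subr_eq0 /F !right !add0r !ReN1i => /eqP.
  by move=> ->.
have ReD_x (x y y' : R) : c < y -> c < y' ->
    complex.Re (D (x +i* y)%C) = complex.Re (D (x +i* y')%C).
  move=> yc yc'; apply/subr0_eq.
  have d1 := line 1 (x +i* y)%C 1 yc; have d2 := line 1 (x +i* y')%C 1 yc'.
  have := is_derive_right0 (is_deriveB d1 d2); rewrite !mul1r !mulr1; apply => h h0.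
  rewrite !fctE !mul1r !right (vert _ _ _ yc yc').
  by rewrite (vert (x + 0) _ _ yc yc') !subrr.
have ReD_y (x x' y : R) : c < y ->
    complex.Re (D (x +i* y)%C) = complex.Re (D (x' +i* y)%C).
  move=> yc; apply/subr0_eq.
  have d1 := line (- 'i) (x +i* y)%C 'i yc; have d2 := line (- 'i) (x' +i* y)%C 'i yc.
  have E (z : C) : complex.Re (- 'i * z * 'i) = complex.Re z.
    by rewrite -complexiE; case: z => a b /=; ring.
  have := is_derive_right0 (is_deriveB d1 d2); rewrite !E; apply => h h0.
  rewrite !fctE !up !ReN1i (Imhor x x'); last by rewrite add0r ltr_wpDr // ltW.
  by rewrite (Imhor x x' (y + 0)) ?addr0 // !subrr.
pose z0 : C := (0 +i* (c + 1))%C; pose m := complex.Re (D z0).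
have Dm z : c < complex.Im z -> D z = m%:C%C.
  case: z => x y zc; apply: complexP; last exact: ImD0.
  rewrite [RHS]/= /m /z0 -(ReD_x 0 y); [exact: ReD_y|exact: zc|by rewrite ltrDl].
exists m => z w zc wc.
have E : f z + - m%:C%C * z = f w + - m%:C%C * w.
  apply: (@cderiv0_const (fun v => f v + - m%:C%C * v)) => t t01.
  have := Im_seg zc wc t01; set v := z + _ => vc.
  by have := cderivD (HD v vc) (cderiv_linear (- m%:C%C) v); rewrite (Dm v vc) subrr.
have -> : f z - f w = (f z + - m%:C%C * z) - (f w + - m%:C%C * w) + m%:C%C * (z - w) by ring.
by rewrite E subrr add0r.
Qed.
End HalfPlane.
End Analysis.

(** * Entire functions *)

Section Entire.
Context {R : realType}.
Local Notation C := (Cplx R).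
Implicit Types (f g k : C -> C) (z w : C).

(** Schwarz-Pick on the disc of radius r, for r large. *)
Lemma liouville k z w : (forall z, differentiable k z) -> (forall z, cnorm (k z) < 1) ->
  k z = k w.
Proof.
move=> dk k1.
suff H z' : k z' = k 0 by rewrite (H z) (H w).
have m0 : cnorm (mobius (k 0) (k z')) = 0.
  apply/eqP; rewrite eq_le cnorm_ge0 andbT.
  apply/ler_addgt0Pr => e e0; rewrite add0r.
  pose r := cnorm z' / e + cnorm z' + 1.
  have z0 := cnorm_ge0 z'.
  have r1 : cnorm z' < r.
    have : 0 <= cnorm z' / e by rewrite divr_ge0 // ltW.
    rewrite /r; lra.
  have r0 : 0 < r by exact: le_lt_trans r1.
  have rC : r%:C%C != 0 :> C by rewrite -cnorm_gt0 cnorm_real normr_gt0 gt_eqF.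
  pose g : C -> C := k \o (fun s : C => r%:C%C * s).
  have dg (s : C) : cnorm s < 1 -> differentiable g s.
    move=> _; apply: differentiable_comp.
      exact: differentiableM.
    exact: dk.
  have g1 (s : C) : cnorm s < 1 -> cnorm (g s) < 1 by move=> _; exact: k1.
  have s1 : cnorm (z' / r%:C%C) < 1.
    by rewrite cnormM cnormV cnorm_real gtr0_norm // ltr_pdivrMr // mul1r.
  have o1 : cnorm (0 : C) < 1 by rewrite cnorm0.
  have := schwarz_pick dg g1 s1 o1.
  rewrite /g /= mulr0 (mulrC r%:C%C) divfK // {2}/mobius rmorph0 mul0r !subr0 divr1.
  move=> /le_trans; apply; rewrite cnormM cnormV cnorm_real gtr0_norm // ler_pdivrMr //.
  rewrite /r !mulrDr mulr1 mulrC divfK ?gt_eqF // -addrA lerDl addr_ge0 ?mulr_ge0 // ltW //.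
have n0 := mobius_den_neq0 (k1 0) (ltW (k1 z')).
by move/eqP: m0; rewrite cnorm_eq0 mulf_eq0 invr_eq0 (negPf n0) orbF subr_eq0 => /eqP.
Qed.

(** The real part of i k vanishes, so i k is affine with a real slope on every
    half-plane; as k is real, the slope is 0. *)
Lemma entire_real_const k z w : (forall z, differentiable k z) ->
  (forall z, complex.Im (k z) = 0) -> k z = k w.
Proof.
move=> dk k0; pose c := Num.min (complex.Im z) (complex.Im w) - 1.
have [m Hm] : exists m : R, forall z w, c < complex.Im z -> c < complex.Im w ->
    'i * k z - 'i * k w = m%:C%C * (z - w).
  apply: (@half_plane_affine R (fun z => 'i * k z)) => [v _|x y y' _ _].
    by apply: differentiable_cderiv; exact: differentiableM.
  rewrite -complexiE !cReM /= !k0; ring.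
have m0 : m = 0.
  have i1 : c < complex.Im (1 +i* (c + 1) : C)%C by rewrite ltrDl.
  have i2 : c < complex.Im (0 +i* (c + 1) : C)%C by rewrite ltrDl.
  have /(congr1 (@complex.Re R)) := Hm _ _ i1 i2.
  rewrite cReD cReN -complexiE !(cReM 'i%C) !k0 /= => E; lra.
have cz : c < complex.Im z.
  by rewrite /c ltrBlDr (le_lt_trans (_ : _ <= complex.Im z)) ?ltrDl // ge_min lexx.
have cw : c < complex.Im w.
  by rewrite /c ltrBlDr (le_lt_trans (_ : _ <= complex.Im w)) ?ltrDl // ge_min lexx orbT.
have := Hm _ _ cz cw; rewrite m0 mul0r -mulrBr => /eqP.
by rewrite mulf_eq0 (negPf (neq0Ci _)) /= subr_eq0 => /eqP.
Qed.
End Entire.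

(** * Maps of the Siegel domain that preserve vertical lines *)

Section SiegelMaps.
Context {R : realType}.
Local Notation C := (Cplx R).
Variable n : nat.
Local Notation V := 'rV[C]_n.+1.
Implicit Types (Z W : V) (w : 'rV[C]_n).

Section Map.
Variable T : V -> V.
Hypothesis T_diff : forall Z, 0 < sheight Z -> differentiable T Z.
Hypothesis T_vert : forall x a t t',
  vtail (T (siegel_line x a t)) = vtail (T (siegel_line x a t')) /\
  complex.Re (vhead (T (siegel_line x a t))) = complex.Re (vhead (T (siegel_line x a t'))).

Let sheight_vcons (z : C) w : sheight (vcons z w) = complex.Im z - enorm w ^+ 2.
Proof. by rewrite /sheight vhead_vcons vtail_vcons. Qed.

Let in_siegel (z : C) w : enorm w ^+ 2 < complex.Im z -> 0 < sheight (vcons z w).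
Proof. by rewrite sheight_vcons subr_gt0. Qed.

Let vert (x y y' : R) w : enorm w ^+ 2 < y -> enorm w ^+ 2 < y' ->
  vtail (T (vcons (x +i* y)%C w)) = vtail (T (vcons (x +i* y')%C w)) /\
  complex.Re (vhead (T (vcons (x +i* y)%C w))) =
    complex.Re (vhead (T (vcons (x +i* y')%C w))).
Proof.
move=> h h'; have := T_vert x w (ln (y - enorm w ^+ 2)) (ln (y' - enorm w ^+ 2)).
by rewrite /siegel_line !lnK ?posrE ?subr_gt0 // !subrKC.
Qed.

Let diff_head (z : C) w : enorm w ^+ 2 < complex.Im z ->
  differentiable (fun z : C => T (vcons z w)) z.
Proof.
move=> h; change (differentiable ((T \o (fun z : C => vcons z w))) z).
apply: differentiable_comp.
  by apply: differentiable_vcons => //; exact: differentiable_cst.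
by apply: T_diff; exact: in_siegel.
Qed.

Let diff_tail (z : C) w : enorm w ^+ 2 < complex.Im z ->
  differentiable (fun w : 'rV[C]_n => T (vcons z w)) w.
Proof.
move=> h; change (differentiable ((T \o (fun w : 'rV[C]_n => vcons z w))) w).
apply: differentiable_comp.
  by apply: differentiable_vcons => //; exact: differentiable_cst.
by apply: T_diff; exact: in_siegel.
Qed.

Let slope_exists w : exists m : R, forall z z' : C,
  enorm w ^+ 2 < complex.Im z -> enorm w ^+ 2 < complex.Im z' ->
  vhead (T (vcons z w)) - vhead (T (vcons z' w)) = m%:C%C * (z - z').
Proof.
apply: (@half_plane_affine R (fun z : C => vhead (T (vcons z w)))) => [z h|x y y' h h'].
  apply: differentiable_cderiv.
  change (differentiable ((@vhead R n \o (fun z : C => T (vcons z w)))) z).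
  by apply: differentiable_comp; [exact: diff_head|exact: differentiable_vhead].
by have [] := vert x h h'.
Qed.

Let tail_const w (z z' : C) : enorm w ^+ 2 < complex.Im z -> enorm w ^+ 2 < complex.Im z' ->
  vtail (T (vcons z w)) = vtail (T (vcons z' w)).
Proof.
move=> h h'; apply/rowP => j; rewrite !vtail_coord.
have [m Hm] : exists m : R, forall z z' : C,
    enorm w ^+ 2 < complex.Im z -> enorm w ^+ 2 < complex.Im z' ->
    T (vcons z w) 0 (lift 0 j) - T (vcons z' w) 0 (lift 0 j) = m%:C%C * (z - z').
  apply: (@half_plane_affine R (fun z : C => T (vcons z w) 0 (lift 0 j))) => [v hv|x y y' hy hy'].
    apply: differentiable_cderiv.
    change (differentiable (((fun Z : V => Z 0 (lift 0 j) : C) \o (fun z : C => T (vcons z w)))) v).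
    by apply: differentiable_comp; [exact: diff_head|exact: differentiable_coord].
  by rewrite -!vtail_coord; have [-> _] := vert x hy hy'.
have m0 : m = 0.
  have h1 : enorm w ^+ 2 < enorm w ^+ 2 + 1 by rewrite ltrDl.
  have h2 : enorm w ^+ 2 < enorm w ^+ 2 + 2 by rewrite ltrDl.
  have := Hm (0 +i* (enorm w ^+ 2 + 1))%C (0 +i* (enorm w ^+ 2 + 2))%C h1 h2.
  rewrite -!vtail_coord; have [-> _] := vert 0 h1 h2.
  by rewrite subrr => /(congr1 (@complex.Im R)) /=; lra.
by apply/subr0_eq; rewrite (Hm _ _ h h') m0 mul0r.
Qed.

Let pt (K : R) : C := (0 +i* K)%C.

Let near_ball w0 : \forall w \near w0, enorm w ^+ 2 < enorm w0 ^+ 2 + 1.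
Proof.
have := @continuous_sqr_enorm R n w0 [set r : R | r < enorm w0 ^+ 2 + 1].
by apply; apply: lt_nbhsl; rewrite ltrDl.
Qed.

(* Along each complex line the slope is an entire function with real values. *)
Let slope_const (mu : 'rV[C]_n -> R) :
  (forall w (z z' : C), enorm w ^+ 2 < complex.Im z -> enorm w ^+ 2 < complex.Im z' ->
    vhead (T (vcons z w)) - vhead (T (vcons z' w)) = (mu w)%:C%C * (z - z')) ->
  forall w w', mu w = mu w'.
Proof.
move=> Hmu w w'; pose l (s : C) : 'rV[C]_n := w + s *: (w' - w).
have dl s : differentiable l s.
  apply: (@differentiableD _ _ _ (cst w) (fun s : C => s *: _)); first exact: differentiable_cst.
  exact: (@differentiableZl _ _ _ (@id C)).
pose k (s : C) : C := (mu (l s))%:C%C.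
have dk s : differentiable k s.
  pose K := enorm (l s) ^+ 2 + 1.
  pose phi (K : R) (w : 'rV[C]_n) := vhead (T (vcons (pt K) w)).
  have dphi (K' : R) : K <= K' -> differentiable (phi K' \o l) s.
    move=> KK; apply: differentiable_comp => //.
    change (differentiable ((@vhead R n \o (fun w => T (vcons (pt K') w)))) (l s)).
    apply: differentiable_comp.
      by apply: diff_tail; rewrite /= (lt_le_trans _ KK) // /K ltrDl.
    exact: differentiable_vhead.
  apply: (@near_differentiable _ _ _ (fun s => - 'i * ((phi (K + 1) \o l) s - (phi K \o l) s))).
    have nb : \forall v \near s, enorm (l v) ^+ 2 < K.
      exact: differentiable_continuous (dl s) _ (near_ball (l s)).
    apply: filterS nb => v hv.
    rewrite /phi Hmu /=; [|by rewrite (lt_trans hv) // ltrDl|by []].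
    rewrite /k -complexiE; apply: complexP => /=; ring.
  apply: differentiableM; first exact: differentiable_cst.
  by apply: differentiableB; apply: dphi; rewrite // lerDl.
have := @entire_real_const R k 0 1 dk (fun=> erefl).
by rewrite /k /l scale0r addr0 scale1r addrC subrK => -[].
Qed.

(** Over each fixed tail w the head of T is affine with a real slope and the tail of
    T is constant; the slope does not depend on w. The point over w at which beta
    and Ft are read off can be kept fixed near a given tail, so they inherit the
    differentiability of T. *)
Lemma siegel_affine : exists (m : R) (beta : 'rV[C]_n -> C) (Ft : 'rV[C]_n -> 'rV[C]_n),
  [/\ holomorphic_on [set: 'rV[C]_n] beta, holomorphic_on [set: 'rV[C]_n] Ft &
    forall Z, 0 < sheight Z ->
      T Z = vcons (m%:C%C * vhead Z + beta (vtail Z)) (Ft (vtail Z))].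
Proof.
have [mu Hmu] := choice slope_exists.
pose m := mu 0; have mE w : mu w = m by exact: slope_const.
pose top w : C := pt (enorm w ^+ 2 + 1).
have top_in w : enorm w ^+ 2 < complex.Im (top w) by rewrite ltrDl.
pose beta w := vhead (T (vcons (top w) w)) - m%:C%C * top w.
pose Ft w := vtail (T (vcons (top w) w)).
have betaE w (z : C) : enorm w ^+ 2 < complex.Im z ->
    vhead (T (vcons z w)) - m%:C%C * z = beta w.
  move=> h; have H := Hmu w z (top w) h (top_in w); rewrite mE in H.
  rewrite /beta; apply/subr0_eq; move: H.
  move: (vhead (T (vcons z w))) (vhead (T (vcons (top w) w))) => p q H.
  have -> : p - m%:C%C * z - (q - m%:C%C * top w) = p - q - m%:C%C * (z - top w) by ring.
  by rewrite H subrr.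
exists m, beta, Ft; split.
- move=> w0 _; apply: (@near_differentiable _ _ _ (fun w => vhead (T (vcons (top w0) w)) - m%:C%C * top w0)).
    by apply: filterS (near_ball w0) => w hw; exact: betaE.
  apply: differentiableB; last exact: differentiable_cst.
  change (differentiable ((@vhead R n \o (fun w => T (vcons (top w0) w)))) w0).
  apply: differentiable_comp.
    by apply: diff_tail.
  exact: differentiable_vhead.
- move=> w0 _; apply: (@near_differentiable _ _ _ (fun w => vtail (T (vcons (top w0) w)))).
    by apply: filterS (near_ball w0) => w hw; exact: tail_const.
  change (differentiable ((@vtail R n \o (fun w => T (vcons (top w0) w)))) w0).
  apply: differentiable_comp.
    by apply: diff_tail.
  exact: differentiable_vtail.
- move=> Z Z0; have h : enorm (vtail Z) ^+ 2 < complex.Im (vhead Z) by rewrite -subr_gt0.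
  apply: vconsP.
    by rewrite [RHS]vhead_vcons -(betaE _ _ h) vcons_headtail; ring.
  by rewrite [RHS]vtail_vcons -[in LHS](vcons_headtail Z); exact: tail_const.
Qed.
End Map.
End SiegelMaps.

Section SiegelPositivity.
Context {R : realType}.
Local Notation C := (Cplx R).
Variable n : nat.
Local Notation V := 'rV[C]_n.+1.

(** The inequality is the limit of Im (T Z)_1 > |(T Z)'|^2 at the boundary. Heights
    stay positive on the way up, so m >= 0. *)
Lemma siegel_affine_pos (T : V -> V) (m : R) (beta : 'rV[C]_n -> C) (Ft : 'rV[C]_n -> 'rV[C]_n) :
  (forall Z, 0 < sheight Z -> 0 < sheight (T Z)) ->
  holomorphic_on [set: 'rV[C]_n] beta -> holomorphic_on [set: 'rV[C]_n] Ft ->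
  (forall Z, 0 < sheight Z -> T Z = vcons (m%:C%C * vhead Z + beta (vtail Z)) (Ft (vtail Z))) ->
  (exists Z W, [/\ 0 < sheight Z, 0 < sheight W & T Z <> T W]) ->
  0 < m /\ forall w, enorm (Ft w) ^+ 2 <= m * enorm w ^+ 2 + complex.Im (beta w).
Proof.
move=> TS dbeta dFt TE [Z [W [Z0 W0 ZW]]].
have pos w y : enorm w ^+ 2 < y -> enorm (Ft w) ^+ 2 < m * y + complex.Im (beta w).
  move=> wy; have h : 0 < sheight (vcons (0 +i* y : C)%C w).
    by rewrite /sheight vhead_vcons vtail_vcons subr_gt0.
  have := TS _ h; rewrite TE // /sheight vhead_vcons vtail_vcons vhead_vcons vtail_vcons.
  by rewrite subr_gt0 cImD cImM /= mul0r addr0.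
have m0 : 0 <= m.
  rewrite leNgt; apply/negP => mN.
  pose y := Num.max (enorm (0 : 'rV[C]_n) ^+ 2 + 1) (complex.Im (beta 0) / - m).
  have y1 : enorm (0 : 'rV[C]_n) ^+ 2 < y by rewrite lt_max ltrDl ltr01.
  have y2 : complex.Im (beta 0) / - m <= y by rewrite le_max lexx orbT.
  have := pos _ _ y1; have := sqr_ge0 (enorm (Ft 0)).
  by move: y2; rewrite ler_pdivrMr ?oppr_gt0 //; lra.
split; last first.
  move=> w; apply/ler_addgt0Pr => e e0.
  have m1 : 0 < m + 1 by rewrite ltr_wpDl.
  have := pos w (enorm w ^+ 2 + e / (m + 1)); rewrite ltrDl divr_gt0 // => /(_ isT) h.
  apply: (le_trans (ltW h)).
  have : m * (e / (m + 1)) <= e.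
    by rewrite mulrA ler_pdivrMr // mulrDr mulr1 mulrC lerDl ltW.
  lra.
rewrite lt_def m0 andbT; apply/eqP => mz; apply: ZW.
(* If m = 0 then beta maps into the upper half-plane, so it is constant by
   Liouville's theorem for its image q in the disc; Ft is bounded by Im beta, hence
   constant too, and so is T. *)
have {}pos w : enorm (Ft w) ^+ 2 < complex.Im (beta w).
  by have := pos w (enorm w ^+ 2 + 1); rewrite mz mul0r add0r; apply; rewrite ltrDl.
have Imb w : 0 < complex.Im (beta w) by exact: le_lt_trans (sqr_ge0 _) (pos w).
have bi w : beta w + 'i != 0.
  apply/eqP => /(congr1 (@complex.Im R)); rewrite cImD -complexiE /=.
  by have := Imb w; lra.
have dline (w w' : 'rV[C]_n) (s : C) : differentiable (fun s : C => w + s *: (w' - w)) s.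
  apply: (@differentiableD _ _ _ (cst w) (fun s : C => s *: _)); first exact: differentiable_cst.
  exact: (@differentiableZl _ _ _ (@id C)).
have betaE w w' : beta w = beta w'.
  pose q w := (beta w - 'i) / (beta w + 'i).
  have bq w0 : beta w0 = 'i * (1 + q w0) / (1 - q w0).
    have i0 : 'i != 0 :> C by exact: neq0Ci.
    have -> : 1 - q w0 = 2 * 'i / (beta w0 + 'i) by rewrite /q; field; exact: bi.
    by rewrite /q; field; rewrite i0 bi.
  rewrite (bq w) (bq w').
  suff -> : q w = q w' by [].
  pose k : C -> C := q \o (fun s : C => w + s *: (w' - w)).
  have dk s : differentiable k s.
    apply: differentiable_comp; first exact: dline.
    apply: differentiableM; first by apply: differentiableB; [exact: dbeta|exact: differentiable_cst].
    apply: differentiableV; last exact: bi.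
    by apply: differentiableD; [exact: dbeta|exact: differentiable_cst].
  have k1 s : cnorm (k s) < 1.
    rewrite /k /q /=; set v := w + _.
    rewrite cnormM cnormV ltr_pdivrMr ?cnorm_gt0 // mul1r.
    rewrite -(ltr_pXn2r (n := 2)) ?nnegrE ?cnorm_ge0 // !sqr_cnorm -complexiE.
    by have := Imb v; case: (beta v) => a b /= b0; nra.
  have := liouville 0 1 dk k1.
  by rewrite /k /= scale0r addr0 scale1r addrC subrK.
have FtE w w' : Ft w = Ft w'.
  apply/rowP => j.
  pose M := complex.Im (beta w) + 1.
  have M0 : 0 < M by rewrite addr_gt0.
  have MC : M%:C%C != 0 :> C by rewrite -cnorm_gt0 cnorm_real normr_gt0 gt_eqF.
  pose k : C -> C := (fun v : 'rV[C]_n => Ft v 0 j / M%:C%C) \o (fun s : C => w + s *: (w' - w)).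
  have dk s : differentiable k s.
    apply: differentiable_comp; first exact: dline.
    apply: differentiableM; last exact: differentiable_cst.
    change (differentiable ((fun v : 'rV[C]_n => v 0 j : C) \o Ft) (w + s *: (w' - w))).
    by apply: differentiable_comp; [exact: dFt|exact: differentiable_coord].
  have k1 s : cnorm (k s) < 1.
    rewrite /k /=; set v := w + _.
    rewrite cnormM cnormV cnorm_real gtr0_norm // ltr_pdivrMr // mul1r.
    have : cnorm (Ft v 0 j) ^+ 2 < complex.Im (beta w).
      rewrite (betaE w v) (le_lt_trans _ (pos v)) // sqr_enorm (bigD1 j) //= lerDl.
      by rewrite sumr_ge0 // => i _; rewrite sqr_ge0.
    by rewrite /M; have := cnorm_ge0 (Ft v 0 j); have := Imb w; nra.
  have := liouville 0 1 dk k1.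
  rewrite /k /= scale0r addr0 scale1r addrC subrK => /(mulIf (invr_neq0 MC)).
  by [].
rewrite !TE // mz !mul0r !add0r (betaE _ (vtail W)) (FtE _ (vtail W)) //.
Qed.
End SiegelPositivity.

Theorem theorem3 (R : realType) (n : nat) (a b : 'rV[Cplx R]_n.+1)
    (ha : boundary (unit_ball n.+1) a) (hb : boundary (unit_ball n.+1) b)
    (Phi : 'rV[Cplx R]_n.+1 -> 'rV[Cplx R]_n.+1 -> 'rV[Cplx R]_n.+1)
    (hPhi : forall zeta, [set a; b] zeta ->
       closed_ball_automorphism (Phi zeta) /\ Phi zeta (e1 n) = zeta)
    (f : 'rV[Cplx R]_n.+1 -> 'rV[Cplx R]_n.+1)
    (hf : geodesic_preserving (unit_ball n.+1) (unit_ball n.+1)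
            (geodesic_lines_at (unit_ball n.+1) a)
            (geodesic_lines_at (unit_ball n.+1) b) f)
    (hf_nonconst : exists z w,
       [/\ unit_ball n.+1 z, unit_ball n.+1 w & f z <> f w]) :
  exists (m : R) (beta : 'rV[Cplx R]_n -> Cplx R)
    (Ft : 'rV[Cplx R]_n -> 'rV[Cplx R]_n)
    (F : 'rV[Cplx R]_n.+1 -> 'rV[Cplx R]_n.+1),
    [/\ 0 < m,
        holomorphic_on [set: 'rV[Cplx R]_n] beta,
        holomorphic_on [set: 'rV[Cplx R]_n] Ft
      & forall w : 'rV[Cplx R]_n,
          enorm (Ft w) ^+ 2 <= m * enorm w ^+ 2 + complex.Im (beta w)] /\
    [/\ forall z, siegel n z ->
          F z = vcons (m%:C%C * vhead z + beta (vtail z)) (Ft (vtail z))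
      & forall z, unit_ball n.+1 z ->
          f z = Phi b (cayley_inv (F (cayley
            ('pinv_(fun=> 0) (closure (unit_ball n.+1)) (Phi a) z))))].
Proof.
have [autA ea] := hPhi a (or_introl erefl).
have [autB eb] := hPhi b (or_intror erefl).
have [df fB fG] := hf.
have fB' z : enorm z < 1 -> enorm (f z) < 1 by move=> z1; apply: (fB (f z)); exists z.
set PsiB := 'pinv_(fun=> 0) (unit_ball n.+1) (Phi b).
set PsiA := 'pinv_(fun=> 0) (unit_ball n.+1) (Phi a).
(* T is f seen from the Siegel domain, with a and b moved to e1 *)
pose T Z := cayley (PsiB (f (Phi a (cayley_inverse Z)))).
have PA Z : 0 < sheight Z -> enorm (Phi a (cayley_inverse Z)) < 1.
  by move=> Z0; apply: (aut_ball autA); exact: cayley_inverse_ball.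
have PB Z : 0 < sheight Z -> enorm (PsiB (f (Phi a (cayley_inverse Z)))) < 1.
  by move=> Z0; apply: (aut_inv_ball autB); apply: fB'; exact: PA.
have T_siegel Z : 0 < sheight Z -> 0 < sheight (T Z).
  by move=> Z0; apply: cayley_siegel; exact: PB.
have T_diff Z : 0 < sheight Z -> differentiable T Z.
  move=> Z0.
  change (differentiable (@cayley R n \o (PsiB \o (f \o (Phi a \o @cayley_inverse R n)))) Z).
  apply: differentiable_comp; last by apply: differentiable_cayley; exact: PB.
  apply: differentiable_comp; last first.
    by apply: (holomorphic_aut_inv autB); apply: fB'; exact: PA.
  apply: differentiable_comp; last by apply: df; exact: PA.
  apply: differentiable_comp; first exact: differentiable_cayley_inverse.
  by apply: (holomorphic_aut autA); exact: cayley_inverse_ball.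
have T_vert x c t t' :
    vtail (T (siegel_line x c t)) = vtail (T (siegel_line x c t')) /\
    complex.Re (vhead (T (siegel_line x c t))) = complex.Re (vhead (T (siegel_line x c t'))).
  have [G2 G2b fG2] : exists2 G2, geodesic_lines_at (unit_ball n.+1) b G2 &
      f @` range (Phi a \o vertical x c) `<=` G2.
    by apply: fG; have := aut_vertical autA x c; rewrite ea.
  have [x' [c' H]] : exists (x' : R) (c' : 'rV[Cplx R]_n), forall z, G2 z ->
      [/\ enorm z < 1, vtail (cayley (PsiB z)) = c' & complex.Re (vhead (cayley (PsiB z))) = x'].
    by apply: (geodesic_line_siegel autB); rewrite eb.
  have inG2 s : G2 (f (Phi a (vertical x c s))).
    by apply: fG2; exists (Phi a (vertical x c s)) => //; exists s.
  have [_ h1 h2] := H _ (inG2 t); have [_ h1' h2'] := H _ (inG2 t').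
  split; [exact: etrans h1 (esym h1')|exact: etrans h2 (esym h2')].
have [m [beta [Ft [dbeta dFt TE]]]] := siegel_affine T_diff T_vert.
(* f is recovered from T by undoing the conjugation *)
have fE z : enorm z < 1 -> [/\ enorm (PsiA z) < 1, 0 < sheight (cayley (PsiA z)) &
    f z = Phi b (cayley_inverse (T (cayley (PsiA z))))].
  move=> z1; have y1 := aut_inv_ball autA z1.
  have Z0 := cayley_siegel y1; split => //.
  have E : T (cayley (PsiA z)) = cayley (PsiB (f z)).
    rewrite /T (cayleyK (ball_vhead_neq1 y1)); congr (cayley (PsiB (f _))).
    exact: aut_invK.
  rewrite E (cayleyK (ball_vhead_neq1 _)); last exact: aut_inv_ball (fB' _ z1).
  by rewrite (aut_invK autB (fB' _ z1)).
clearbody T.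
have nonconst : exists Z W, [/\ 0 < sheight Z, 0 < sheight W & T Z <> T W].
  have [z [w [z1 w1 zw]]] := hf_nonconst.
  have [_ Z0 zE] := fE z z1; have [_ W0 wE] := fE w w1.
  exists (cayley (PsiA z)), (cayley (PsiA w)); split=> [||E]; [exact: Z0|exact: W0|apply: zw].
  exact: etrans zE (etrans (congr1 (Phi b \o @cayley_inverse _ n) E) (esym wE)).
have [m0 ineq] := siegel_affine_pos T_siegel dbeta dFt TE nonconst.
exists m, beta, Ft, (fun z => vcons (m%:C%C * vhead z + beta (vtail z)) (Ft (vtail z))).
split; first by split; [exact: m0|exact: dbeta|exact: dFt|exact: ineq].
split=> [z _ //|z z1]; have [y1 Z0 zE] := fE z z1.
by rewrite (aut_closed_inv autA z1) -(TE _ Z0) (cayley_invE (T_siegel _ Z0)).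
Qed.
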